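(* Let $F:\mathbb B\to\mathbb C$ be a (strict) 2-functor of 2-categories which is a 2-fibration in the sense of Buckley, dualized to require coCartesian rather than Cartesian 2-morphisms. Then the induced map $$\mathrm N^{\mathrm{sc}}(F):(\mathrm N^{\mathrm{sc}}(\mathbb B),M_{\mathbb B},T_{\mathbb B}\subseteq C_{\mathbb B})\to \mathrm N^{\mathrm{sc}}(\mathbb C)$$ is a 2-Cartesian fibration, where $T_{\mathbb B}$ is the set of thin triangles of $\mathrm N^{\mathrm{sc}}(\mathbb B)$, $M_{\mathbb B}$ is the set of Cartesian edges, and $C_{\mathbb B}$ is the set of coCartesian triangles.
   Context: Dualized Buckley 2-fibration: a strict 2-functor $F:\mathbb B\to\mathbb C$ such that (1) each functor $F_{a,b}:\mathbb B(a,b)\to\mathbb C(F a,F b)$ is an opfibration (coCartesian fibration of ordinary categories), whose coCartesian morphisms are called coCartesian 2-morphisms; (2) horizontal composites of coCartesian 2-morphisms are coCartesian; (3) for every 1-morphism $g:c\to F(b)$ in $\mathbb C$ there is a Cartesian 1-morphism $\tilde g:\tilde c\to b$ in $\mathbb B$ with $F(\tilde g)=g$. Here a 1-morphism $h:x\to y$ is Cartesian if for every $z$ the square with vertices $\mathbb B(z,x)$, $\mathbb B(z,y)$, $\mathbb C(Fz,Fx)$, $\mathbb C(Fz,Fy)$, given by postcomposition with $h$ and $F(h)$, is a (strict) pullback of categories. $\mathrm N^{\mathrm{sc}}(\mathbb B)$ is the scaled nerve of the 2-category: the underlying simplicial set is the homotopy coherent (Duskin) nerve, whose triangles consist of $f:x\to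 y$, $g:y\to z$, $h:x\to z$ and a 2-morphism $h\Rightarrow g\circ f$; a triangle is thin iff this 2-morphism is invertible. It is an $\infty$-bicategory (a fibrant object in Lurie's model structure on scaled simplicial sets, i.e. simplicial sets with a set of thin triangles containing the degenerate ones). Write $p:X\to S$ for $\mathrm N^{\mathrm{sc}}(F):\mathrm N^{\mathrm{sc}}(\mathbb B)\to \mathrm N^{\mathrm{sc}}(\mathbb C)$. A 2-simplex $\sigma$ is left-degenerate if $\sigma|_{\Delta^{\{0,1\}}}$ is degenerate. A left-degenerate $\sigma$ of $X$ is $p$-coCartesian if for all $n\ge3$ every lifting problem $f:\Lambda^n_0\to X$, $\Delta^n\to S$ against $p$ with $f|_{\Delta^{\{0,1,n\}}}=\sigma$ has a solution. A left-degenerate $\tau$ is the left-degeneration of $\sigma$ if there is a 3-simplex $\rho$ of $X$ with $d_3\rho=s_0(d_2\sigma)$, $d_2\rho=\tau$, $d_1\rho=\sigma$ and $d_0\rho$ thin. A triangle is coCartesian if its left-degeneration is $p$-coCartesian. An edge $e$ of $X$ is $p$-Cartesian (a Cartesian edge) if for all $n\ge 3$ every lifting problem $f:\Lambda^n_n\to X$, $\Delta^n\to S$ against $p$ with $f|_{\Delta^{\{n-1,n\}}}=e$ and $f|_{\Delta^{\{0,n-1,n\}}}$ thin has a solution, and for $n=2$ every lifting problem $f:\Lambda^2_2\to X$, $\Delta^2\to S$ with $f|_{\Delta^{\{1,2\}}}=e$ and thin $\Delta^2\to S$ has a solution which is a thin triangle. A marked biscaled (mb) simplicial set $(X,E_X,T_X\subseteq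 C_X)$ is a simplicial set with marked edges $E_X\subseteq X_1$ containing all degenerate edges, and thin, resp. lean, triangles $T_X\subseteq C_X\subseteq X_2$, with $T_X$ containing all degenerate triangles. Maps preserve the collections. In any slot $\flat$ means only degenerate simplices, $\sharp$ all simplices; $(X,E,T)$ abbreviates $(X,E,T\subseteq T)$; only nondegenerate members are listed and listed triangles not contained in the simplicial set are ignored. $\mathbf{MB}$-anodyne maps: the weakly saturated class generated by (A1) $(\Lambda^n_i,\flat,\{\Delta^{\{i-1,i,i+1\}}\})\to(\Delta^n,\flat,\{\Delta^{\{i-1,i,i+1\}}\})$, $n\ge2$, $0<i<n$; (A2) $(\Delta^4,\flat,T)\to(\Delta^4,\flat,T\cup\{\Delta^{\{0,3,4\}},\Delta^{\{0,1,4\}}\})$, $T=\{\Delta^{\{0,2,4\}},\Delta^{\{1,2,3\}},\Delta^{\{0,1,3\}},\Delta^{\{1,3,4\}},\Delta^{\{0,1,2\}}\}$; (A3) $(\Lambda^n_0\coprod_{\Delta^{\{0,1\}}}\Delta^0,\flat,\flat\subseteq\{\Delta^{\{0,1,n\}}\})\to(\Delta^n\coprod_{\Delta^{\{0,1\}}}\Delta^0,\flat,\flat\subseteq\{\Delta^{\{0,1,n\}}\})$, $n\ge2$; (A4) $(\Lambda^n_n,\{\Delta^{\{n-1,n\}}\},\flat\subseteq\{\Delta^{\{0,n-1,n\}}\})\to(\Delta^n,\{\Delta^{\{n-1,n\}}\},\flat\subseteq\{\Delta^{\{0,n-1,n\}}\})$, $n\ge2$; (A5) the inclusion of the terminal vertex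 $(\Delta^0,\sharp,\sharp)\to(\Delta^1,\sharp,\sharp)$; (S1) $(\Delta^2,\{\Delta^{\{0,1\}},\Delta^{\{1,2\}}\},\sharp)\to(\Delta^2,\sharp,\sharp)$; (S2) $(\Delta^2,\flat,\flat\subseteq\sharp)\to(\Delta^2,\flat,\sharp)$; (S3) $(\Delta^3,\flat,\{\Delta^{\{i-1,i,i+1\}}\}\subseteq U_i)\to(\Delta^3,\flat,\{\Delta^{\{i-1,i,i+1\}}\}\subseteq\sharp)$, $0<i<3$; (S4) $(\Delta^3\coprod_{\Delta^{\{0,1\}}}\Delta^0,\flat,\flat\subseteq U_0)\to(\Delta^3\coprod_{\Delta^{\{0,1\}}}\Delta^0,\flat,\flat\subseteq\sharp)$; (S5) $(\Delta^3,\{\Delta^{\{2,3\}}\},\flat\subseteq U_3)\to(\Delta^3,\{\Delta^{\{2,3\}}\},\flat\subseteq\sharp)$; (E) $(K,\flat,\sharp)\to(K,\sharp,\sharp)$ for every Kan complex $K$; where $U_i$ is the collection of all triangles except the face missing vertex $i$. A map of mb simplicial sets with target $(S,\sharp,T_S\subseteq\sharp)$, for $S=(S,T_S)$ a scaled simplicial set (here $\mathrm N^{\mathrm{sc}}(\mathbb C)$), is a 2-Cartesian fibration if it has the right lifting property against all $\mathbf{MB}$-anodyne maps. *)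

(* Defs.v *)
From Stdlib Require Import ProofIrrelevance FunctionalExtensionality.
From mathcomp Require Import all_boot.

Set Implicit Arguments.
Unset Strict Implicit.
Unset Printing Implicit Defensive.

(** * Strict categories *)

Record cat := Cat {
  c_ob :> Type;
  c_hom : c_ob -> c_ob -> Type;
  c_id : forall a, c_hom a a;
  c_comp : forall a b c, c_hom b c -> c_hom a b -> c_hom a c;
  c_compA : forall a b c d (w : c_hom c d) (v : c_hom b c) (u : c_hom a b),
    c_comp w (c_comp v u) = c_comp (c_comp w v) u;
  c_comp1l : forall a b (u : c_hom a b), c_comp (c_id b) u = u;
  c_comp1r : forall a b (u : c_hom a b), c_comp u (c_id a) = u }.

Arguments c_id {c0} a : rename.

(* Equality of two arrows whose endpoints are only propositionally equal: it
   entails the equality of the sources and of the targets. *)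
Inductive arr_eq {C : cat} {a b : C} (u : c_hom a b) :
    forall a' b' : C, c_hom a' b' -> Prop :=
  arr_eq_refl : arr_eq u u.

Definition is_iso {C : cat} {a b : C} (u : c_hom a b) : Prop :=
  exists v : c_hom b a, c_comp v u = c_id a /\ c_comp u v = c_id b.

Record functor (C D : cat) := Functor {
  f_ob :> C -> D;
  f_hom : forall a b, c_hom a b -> c_hom (f_ob a) (f_ob b);
  f_id : forall a, f_hom (c_id a) = c_id (f_ob a);
  f_comp : forall a b c (v : c_hom b c) (u : c_hom a b),
    f_hom (c_comp v u) = c_comp (f_hom v) (f_hom u) }.

Arguments f_hom {C D} f {a b} u.

Definition cocartesian {C D : cat} (P : functor C D) {a b : C} (u : c_hom a b) :=
  forall (c : C) (v : c_hom a c) (w : c_hom (P b) (P c)),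
    c_comp w (f_hom P u) = f_hom P v ->
    exists! t : c_hom b c, f_hom P t = w /\ c_comp t u = v.

Definition opfibration {C D : cat} (P : functor C D) : Prop :=
  forall (a : C) (d : D) (w : c_hom (P a) d),
    exists (b : C) (u : c_hom a b), arr_eq (f_hom P u) w /\ cocartesian P u.

(* The square  R \o P = S \o Q  with vertices A, B, C, D commutes strictly and
   the comparison functor from A to the fibre product of B and C over D is
   bijective on objects and on arrows. *)
Definition strict_pullback {A B C D : cat} (P : functor A B) (Q : functor A C)
    (R : functor B D) (S : functor C D) : Prop :=
  [/\ forall a, R (P a) = S (Q a),
      forall (a a' : A) (u : c_hom a a'),
        arr_eq (f_hom R (f_hom P u)) (f_hom S (f_hom Q u)),
      forall (b : B) (c : C), R b = S c -> exists! a : A, P a = b /\ Q a = c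
    & forall (a a' : A) (v : c_hom (P a) (P a')) (w : c_hom (Q a) (Q a')),
        arr_eq (f_hom R v) (f_hom S w) ->
        exists! u : c_hom a a', f_hom P u = v /\ f_hom Q u = w].

(** * Strict 2-categories and strict 2-functors *)

Record two_cat := TwoCat {
  ob :> Type;
  hom : ob -> ob -> cat;
  id1 : forall x, hom x x;
  comp1 : forall x y z, hom y z -> hom x y -> hom x z;
  hcomp : forall x y z (g g' : hom y z) (f f' : hom x y),
    c_hom g g' -> c_hom f f' -> c_hom (comp1 g f) (comp1 g' f');
  hcomp_id : forall x y z (g : hom y z) (f : hom x y),
    hcomp (c_id g) (c_id f) = c_id (comp1 g f);
  hcomp_comp : forall x y z (g g' g'' : hom y z) (f f' f'' : hom x y)
      (b' : c_hom g' g'') (b : c_hom g g') (a' : c_hom f' f'') (a : c_hom f f'),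
    hcomp (c_comp b' b) (c_comp a' a) = c_comp (hcomp b' a') (hcomp b a);
  comp1A : forall x y z t (h : hom z t) (g : hom y z) (f : hom x y),
    comp1 h (comp1 g f) = comp1 (comp1 h g) f;
  comp1_1l : forall x y (f : hom x y), comp1 (id1 y) f = f;
  comp1_1r : forall x y (f : hom x y), comp1 f (id1 x) = f;
  hcompA : forall x y z t (h h' : hom z t) (g g' : hom y z) (f f' : hom x y)
      (c : c_hom h h') (b : c_hom g g') (a : c_hom f f'),
    arr_eq (hcomp c (hcomp b a)) (hcomp (hcomp c b) a);
  hcomp_1l : forall x y (f f' : hom x y) (a : c_hom f f'),
    arr_eq (hcomp (c_id (id1 y)) a) a;
  hcomp_1r : forall x y (f f' : hom x y) (a : c_hom f f'),
    arr_eq (hcomp a (c_id (id1 x))) a }.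

Arguments hom {t} x y : rename.
Arguments id1 {t} x : rename.
Arguments comp1 {t x y z} g f : rename.
Arguments hcomp {t x y z g g' f f'} b a : rename.

Record two_functor (B C : two_cat) := TwoFunctor {
  F0 :> B -> C;
  F1 : forall x y : B, functor (hom x y) (hom (F0 x) (F0 y));
  F1_id : forall x, F1 x x (id1 x) = id1 (F0 x);
  F1_comp : forall x y z (g : hom y z) (f : hom x y),
    F1 x z (comp1 g f) = comp1 (F1 y z g) (F1 x y f);
  F2_hcomp : forall x y z (g g' : hom y z) (f f' : hom x y)
      (b : c_hom g g') (a : c_hom f f'),
    arr_eq (f_hom (F1 x z) (hcomp b a))
           (hcomp (f_hom (F1 y z) b) (f_hom (F1 x y) a)) }.

Arguments F1 {B C} t {x y}.
Arguments F1_id {B C} t x.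
Arguments F1_comp {B C} t {x y z} g f.
Arguments F2_hcomp {B C} t {x y z g g' f f'} b a.

Definition postcomp {B : two_cat} (z : B) {x y : B} (h : hom x y) :
  functor (hom z x) (hom z y).
Proof.
refine (@Functor (hom z x) (hom z y) (fun f => comp1 h f)
  (fun f f' a => hcomp (c_id h) a) _ _).
- by move=> f; rewrite hcomp_id.
- by move=> f f' f'' a' a; rewrite -hcomp_comp c_comp1l.
Defined.

Definition cartesian1 {B C : two_cat} (F : two_functor B C) {x y : B}
    (h : hom x y) : Prop :=
  forall z : B, strict_pullback (postcomp z h) (@F1 _ _ F z x)
                                (@F1 _ _ F z y) (postcomp (F z) (F1 F h)).

Definition cocartesian2 {B C : two_cat} (F : two_functor B C) {x y : B}
    {f g : hom x y} (a : c_hom f g) : Prop :=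
  cocartesian (@F1 _ _ F x y) a.

(* Buckley's 2-fibrations, with coCartesian instead of Cartesian 2-morphisms. *)
Definition buckley_2fibration {B C : two_cat} (F : two_functor B C) : Prop :=
  [/\ forall a b : B, opfibration (@F1 _ _ F a b),
      forall (x y z : B) (g g' : hom y z) (f f' : hom x y)
        (b : c_hom g g') (a : c_hom f f'),
        cocartesian2 F b -> cocartesian2 F a -> cocartesian2 F (hcomp b a)
    & forall (b : B) (c : C) (g : hom c (F b)),
        exists (c' : B) (g' : hom c' b),
          existT (fun c0 : C => c_ob (hom c0 (F b))) (F c') (F1 F g') =
          existT _ c g
          /\ cartesian1 F g'].

(** * Simplicial sets *)

(* [mono m n] is the set of morphisms [m] -> [n] of the simplex category. *)
Record mono (m n : nat) := Mono {
  mo :> 'I_m.+1 -> 'I_n.+1;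
  moP : forall i j : 'I_m.+1, i <= j -> mo i <= mo j }.

Definition mono_id n : mono n n := @Mono n n (fun i => i) (fun i j h => h).

Definition mono_comp m n p (b : mono n p) (a : mono m n) : mono m p :=
  Mono (fun i j h => moP b (moP a h)).

Record sset := SSet {
  sx :> nat -> Type;
  act : forall m n, mono m n -> sx n -> sx m;
  act_id : forall n (x : sx n), act (mono_id n) x = x;
  act_comp : forall m n p (b : mono n p) (a : mono m n) (x : sx p),
    act (mono_comp b a) x = act a (act b x) }.

Arguments act {s m n} a x.

Record smap (X Y : sset) := SMap {
  sm :> forall n, X n -> Y n;
  sm_act : forall m n (a : mono m n) (x : X n),
    sm (act a x) = act a (sm x) }.

Arguments sm {X Y} s {n} x.

Definition smap_id X : smap X X := @SMap X X (fun n x => x) (fun m n a x => erefl).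

Definition smap_comp X Y Z (g : smap Y Z) (f : smap X Y) : smap X Z.
Proof.
refine (@SMap X Z (fun n x => g n (f n x)) _).
by move=> m n a x; rewrite !sm_act.
Defined.

Definition smap_eq {X Y : sset} (f g : smap X Y) : Prop :=
  forall n (x : X n), f n x = g n x.

Definition degenerate {X : sset} {n} (x : X n) : Prop :=
  exists m (a : mono n m) (y : X m), m < n /\ x = act a y.

Lemma coface_mono n (i : 'I_n.+2) (j k : 'I_n.+1) :
  j <= k -> lift i j <= lift i k.
Proof. by rewrite /= leq_bump2. Qed.

Definition coface {n} (i : nat) : mono n n.+1 := Mono (@coface_mono n (inord i)).

Lemma codeg_bound n i (j : 'I_n.+2) : minn (unbump i j) n < n.+1.
Proof. by rewrite ltnS geq_minr. Qed.

Lemma codeg_mono n i (j k : 'I_n.+2) :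
  j <= k -> Ordinal (codeg_bound i j) <= Ordinal (codeg_bound i k).
Proof.
move=> jk /=; rewrite leq_min geq_minr andbT geq_min /unbump.
case: (ltnP i j) => ij /=; last first.
  rewrite subn0; case: (ltnP i k) => ik /=; last by rewrite subn0 jk.
  by rewrite subn1 -ltnS (ltn_predK ik) (leq_ltn_trans ij ik).
by rewrite (leq_trans ij jk) leq_sub2r.
Qed.

(* For i <= n, the truncation at n does not change [unbump i j]. *)
Definition codeg {n} (i : nat) : mono n.+1 n := Mono (@codeg_mono n i).

Definition face {X : sset} {n} (i : nat) (x : X n.+1) : X n := act (coface i) x.
Definition deg {X : sset} {n} (i : nat) (x : X n) : X n.+1 := act (codeg i) x.

Definition simplex (n : nat) : sset.
Proof.
refine (@SSet (fun m => mono m n) (fun m p a x => mono_comp x a) _ _).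
- by move=> m [].
- by [].
Defined.

(* [on_vertices s x]: the simplex x of the n-simplex is the one with the list
   of vertices s. *)
Definition on_vertices {m n} (s : seq nat) (x : mono m n) : Prop :=
  [seq val (x k) | k <- enum 'I_m.+1] = s.

Definition sub_closed (X : sset) (P : forall n, X n -> bool) : Prop :=
  forall m n (a : mono m n) (x : X n), P n x -> P m (act a x).

Definition sub_sset (X : sset) (P : forall n, X n -> bool)
  (hP : sub_closed P) : sset.
Proof.
refine (@SSet (fun n => {x : X n | P n x})
  (fun m n a x => exist _ (act a (val x)) (hP m n a _ (valP x))) _ _).
- by move=> n x; apply: val_inj; rewrite /= act_id.
- by move=> m n p b a x; apply: val_inj; rewrite /= act_comp.
Defined.

Definition sub_incl (X : sset) (P : forall n, X n -> bool)
  (hP : sub_closed P) : smap (sub_sset hP) X :=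
  @SMap (sub_sset hP) X (fun n x => val x) (fun m n a x => erefl).

Definition horn_pred (n i : nat) (m : nat) (x : simplex n m) : bool :=
  [exists j : 'I_n.+1, (j != i :> nat) && [forall k, x k != j]].

Lemma horn_closed n i : sub_closed (@horn_pred n i).
Proof.
move=> m p a x /existsP[j /andP[ji /forallP h]].
by apply/existsP; exists j; rewrite ji; apply/forallP => k; apply: h.
Qed.

Definition horn (n i : nat) : sset := sub_sset (@horn_closed n i).

Definition horn_incl n i : smap (horn n i) (simplex n) :=
  sub_incl (@horn_closed n i).

Definition kan (K : sset) : Prop :=
  forall n i, 0 < n -> i <= n -> forall f : smap (horn n i) K,
  exists g : smap (simplex n) K, smap_eq (smap_comp g (horn_incl n i)) f.

(* The pushout of  X <- A -> simplex 0,  for a simplicial subset A of X: besides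
   the simplices of X outside A there is one more simplex, None, in each
   dimension (see [collapse_pushout]). *)
Definition collapse (X : sset) (A : forall n, X n -> bool)
  (hA : sub_closed A) : sset.
Proof.
refine (@SSet (fun n => option {x : X n | ~~ A n x})
  (fun m n a => obind (fun x => insub (act a (val x)))) _ _).
- by move=> n [x|] //=; rewrite act_id valK.
- move=> m n p b a [x|] //=; rewrite act_comp.
  case: (insubP _ (act b (val x))) => [u _ <- //|]; rewrite negbK => h /=.
  by rewrite insubN // negbK; apply: hA.
Defined.

Definition collapse_quot (X : sset) (A : forall n, X n -> bool)
  (hA : sub_closed A) : smap X (collapse hA).
Proof.
refine (@SMap X (collapse hA) (fun n x => insub x) _).
move=> m n a x /=; case: (insubP _ x) => [u _ <- //|]; rewrite negbK => h /=.
by rewrite insubN // negbK; apply: hA.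
Defined.

Definition collapse_pt (X : sset) (A : forall n, X n -> bool)
  (hA : sub_closed A) : smap (simplex 0) (collapse hA) :=
  @SMap (simplex 0) (collapse hA) (fun n x => None) (fun m n a x => erefl).

Definition collapse_map (X Y : sset) (A : forall n, X n -> bool)
  (hA : sub_closed A) (B : forall n, Y n -> bool) (hB : sub_closed B)
  (f : smap X Y) (hf : forall n x, A n x -> B n (f n x)) :
  smap (collapse hA) (collapse hB).
Proof.
refine (@SMap (collapse hA) (collapse hB)
  (fun n => obind (fun x => insub (f n (val x)))) _).
move=> m n a [x|] //=.
rewrite -[RHS](sm_act (collapse_quot hB)) /= -sm_act.
case: (insubP _ (act a (val x))) => [u _ <- //|]; rewrite negbK => h /=.
by rewrite insubN // negbK; apply: hf.
Defined.

Lemma mono0_eq m (x y : mono m 0) : x = y.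
Proof.
case: x y => [x hx] [y hy].
have e : x = y by apply: functional_extensionality => i;
  rewrite !ord1.
by case: _ / e hy => hy; congr Mono; apply: proof_irrelevance.
Qed.

Lemma collapse_pushout (X : sset) (A : forall n, X n -> bool)
    (hA : sub_closed A) :
  (forall n (x : X n), A n x ->
    forall y, collapse_quot hA n x = collapse_pt hA n y) /\
  forall (Y : sset) (f : smap X Y) (c : smap (simplex 0) Y),
    (forall n (x : X n), A n x -> forall y, f n x = c n y) ->
    exists h : smap (collapse hA) Y,
      [/\ smap_eq (smap_comp h (collapse_quot hA)) f,
          smap_eq (smap_comp h (collapse_pt hA)) c
        & forall h' : smap (collapse hA) Y,
            smap_eq (smap_comp h' (collapse_quot hA)) f ->
            smap_eq (smap_comp h' (collapse_pt hA)) c -> smap_eq h' h].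
Proof.
pose pt n : mono n 0 := @Mono n 0 (fun => ord0) (fun _ _ _ => isT).
split=> [n x hx y | Y f c fc]; first by rewrite /= insubN // negbK.
pose h0 n (z : collapse hA n) : Y n :=
  if z is Some x then f n (val x) else c n (pt n).
have hq n x : h0 n (insub x) = f n x.
  rewrite /h0; case: insubP => [u _ -> //|]; rewrite negbK => hx.
  by rewrite -(fc _ _ hx).
have h0a m n (a : mono m n) z : h0 m (act a z) = act a (h0 n z).
  case: z => [x|] /=; last by rewrite -sm_act; congr (c _ _); apply: mono0_eq.
  by rewrite hq sm_act.
exists (SMap h0a); split=> [n x | n x | h' e1 e2 n [x|]] /=.
- exact: hq.
- by congr (c _ _); apply: mono0_eq.
- by rewrite -(e1 n (val x)) /= valK.
- exact: (e2 n (pt n)).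
Qed.

Definition edge01_pred (n : nat) (m : nat) (x : simplex n m) : bool :=
  [forall k, x k <= 1].

Lemma edge01_closed n : sub_closed (@edge01_pred n).
Proof.
by move=> m p a x /forallP h; apply/forallP => k; apply: h.
Qed.

Lemma horn_edge01_closed n i :
  sub_closed (fun m (x : horn n i m) => edge01_pred (val x)).
Proof. by move=> m p a x; apply: edge01_closed. Qed.

Definition simplex_c01 (n : nat) : sset := collapse (@edge01_closed n).
Definition horn_c01 (n i : nat) : sset := collapse (@horn_edge01_closed n i).

Definition horn_incl_c01 n i : smap (horn_c01 n i) (simplex_c01 n) :=
  @collapse_map _ _ _ (@horn_edge01_closed n i) _ (@edge01_closed n)
    (horn_incl n i) (fun m x h => h).

Definition quot01 n : smap (simplex n) (simplex_c01 n) :=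
  collapse_quot (@edge01_closed n).
Definition horn_quot01 n i : smap (horn n i) (horn_c01 n i) :=
  collapse_quot (@horn_edge01_closed n i).

(** * Scaled simplicial sets *)

Record scaled := Scaled {
  sc_sset :> sset;
  thin : sc_sset 2 -> Prop;
  thin_deg : forall x : sc_sset 2, degenerate x -> thin x }.

Arguments thin {s} x : rename.

Definition has_lift {A B X S : sset} (i : smap A B) (p : smap X S)
    (f : smap A X) (g : smap B S) : Prop :=
  exists h : smap B X, smap_eq (smap_comp h i) f /\ smap_eq (smap_comp p h) g.

Definition lift_problem {A B X S : sset} (i : smap A B) (p : smap X S)
    (f : smap A X) (g : smap B S) : Prop :=
  smap_eq (smap_comp p f) (smap_comp g i).

Section FibrationNotions.

Context {X S : scaled} (p : smap X S).

Definition left_degenerate (s : X 2) : Prop := degenerate (face 2 s).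

Definition p_cocartesian (s : X 2) : Prop :=
  forall n, 3 <= n -> forall (f : smap (horn n 0) X) (g : smap (simplex n) S),
    lift_problem (horn_incl n 0) p f g ->
    (forall t : horn n 0 2, on_vertices [:: 0; 1; n] (val t) -> f 2 t = s) ->
    has_lift (horn_incl n 0) p f g.

Definition left_degeneration (t s : X 2) : Prop :=
  left_degenerate t /\
  exists r : X 3, [/\ face 3 r = deg 0 (face 2 s), face 2 r = t,
                      face 1 r = s & thin (face 0 r)].

(* Left-degenerations exist in the scaled nerve but are unique only up to
   invertible 2-morphisms. *)
Definition cocartesian_triangle (s : X 2) : Prop :=
  exists t : X 2, left_degeneration t s /\ p_cocartesian t.

Definition cartesian_edge (e : X 1) : Prop :=
  (forall n, 3 <= n -> forall (f : smap (horn n n) X) (g : smap (simplex n) S),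
    lift_problem (horn_incl n n) p f g ->
    (forall t : horn n n 1, on_vertices [:: n.-1; n] (val t) -> f 1 t = e) ->
    (forall t : horn n n 2, on_vertices [:: 0; n.-1; n] (val t) ->
      thin (f 2 t)) ->
    has_lift (horn_incl n n) p f g) /\
  (forall (f : smap (horn 2 2) X) (g : smap (simplex 2) S),
    lift_problem (horn_incl 2 2) p f g ->
    (forall t : horn 2 2 1, on_vertices [:: 1; 2] (val t) -> f 1 t = e) ->
    thin (g 2 (mono_id 2)) ->
    exists h : smap (simplex 2) X,
      [/\ smap_eq (smap_comp h (horn_incl 2 2)) f, smap_eq (smap_comp p h) g
        & thin (h 2 (mono_id 2))]).

End FibrationNotions.

(** * Marked biscaled simplicial sets *)

Definition mb_axioms (X : sset) (E : X 1 -> Prop) (T C : X 2 -> Prop) : Prop :=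
  [/\ forall e, degenerate e -> E e, forall s, degenerate s -> T s
    & forall s, T s -> C s].

Record mbsset := MBSSet {
  mb_sset :> sset;
  marked : mb_sset 1 -> Prop;
  mb_thin : mb_sset 2 -> Prop;
  lean : mb_sset 2 -> Prop;
  mbP : mb_axioms marked mb_thin lean }.

Arguments marked {m} e : rename.
Arguments mb_thin {m} s : rename.
Arguments lean {m} s : rename.

Record mbmap (X Y : mbsset) := MBMap {
  mm :> smap X Y;
  mm_marked : forall e : X 1, marked e -> marked (mm 1 e);
  mm_thin : forall s : X 2, mb_thin s -> mb_thin (mm 2 s);
  mm_lean : forall s : X 2, lean s -> lean (mm 2 s) }.

Definition mbmap_comp X Y Z (g : mbmap Y Z) (f : mbmap X Y) : mbmap X Z :=
  @MBMap X Z (smap_comp g f)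
    (fun e h => mm_marked g (mm_marked f h))
    (fun s h => mm_thin g (mm_thin f h))
    (fun s h => mm_lean g (mm_lean f h)).

Definition mbmap_id X : mbmap X X :=
  @MBMap X X (smap_id X) (fun e h => h) (fun s h => h) (fun s h => h).

(* The marked biscaled simplicial set with the listed marked edges, thin and
   lean triangles: degenerate simplices are added, and thin triangles are made
   lean. *)
Definition listed (X : sset) (E : X 1 -> Prop) (T C : X 2 -> Prop) : mbsset.
Proof.
refine (@MBSSet X (fun e => E e \/ degenerate e) (fun s => T s \/ degenerate s)
  (fun s => [\/ C s, T s | degenerate s]) _).
by split=> [e h | s h | s [h|h]]; [right | right | apply: Or32 | apply: Or33].
Defined.

Definition mb_flat {T : Type} (x : T) : Prop := False.
Definition mb_sharp {T : Type} (x : T) : Prop := True.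

(* (S, sharp, T_S, sharp) *)
Definition mb_of_scaled (S : scaled) : mbsset.
Proof.
refine (@MBSSet S mb_sharp (@thin S) mb_sharp _).
by split=> // s h; apply: thin_deg.
Defined.

Lemma listed_mbmap (X Y : sset) (E : X 1 -> Prop) (T C : X 2 -> Prop)
    (E' : Y 1 -> Prop) (T' C' : Y 2 -> Prop) (f : smap X Y) :
  (forall e, E e -> E' (f 1 e)) -> (forall s, T s -> T' (f 2 s)) ->
  (forall s, C s -> C' (f 2 s)) ->
  exists g : mbmap (listed E T C) (listed E' T' C'), mm g = f.
Proof.
move=> hE hT hC.
have hd n (x : X n) : degenerate x -> degenerate (f n x).
  by move=> [m [a [y [lt ->]]]]; exists m, a, (f m y); rewrite sm_act.
unshelve eexists (@MBMap (listed E T C) (listed E' T' C') f _ _ _) => //=.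
- by move=> e [/hE|/hd]; [left|right].
- by move=> s [/hT|/hd]; [left|right].
- by move=> s [/hC|/hT|/hd]; [apply: Or31|apply: Or32|apply: Or33].
Qed.

(** * Weakly saturated classes *)

Definition mb_class := forall A B : mbsset, mbmap A B -> Prop.

Definition mb_pushout {A B A' B' : mbsset} (f : mbmap A B) (g : mbmap A A')
    (g' : mbmap B B') (f' : mbmap A' B') : Prop :=
  smap_eq (mbmap_comp g' f) (mbmap_comp f' g) /\
  forall (Z : mbsset) (u : mbmap B Z) (v : mbmap A' Z),
    smap_eq (mbmap_comp u f) (mbmap_comp v g) ->
    exists h : mbmap B' Z,
      [/\ smap_eq (mbmap_comp h g') u, smap_eq (mbmap_comp h f') v
        & forall h' : mbmap B' Z, smap_eq (mbmap_comp h' g') u ->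
            smap_eq (mbmap_comp h' f') v -> smap_eq h' h].

Definition mb_retract {A B A' B' : mbsset} (f' : mbmap A' B')
    (f : mbmap A B) : Prop :=
  exists (i : mbmap A' A) (r : mbmap A A') (j : mbmap B' B) (s : mbmap B B'),
    [/\ smap_eq (mbmap_comp r i) (mbmap_id A'),
        smap_eq (mbmap_comp s j) (mbmap_id B'),
        smap_eq (mbmap_comp f i) (mbmap_comp j f')
      & smap_eq (mbmap_comp f' r) (mbmap_comp s f)].

Definition well_order (I : Type) (lt : I -> I -> Prop) : Prop :=
  [/\ well_founded lt, forall i j k, lt i j -> lt j k -> lt i k
    & forall i j, [\/ lt i j, i = j | lt j i]].

(* A diagram of objects under A indexed by a well-ordered set. *)
Record mb_system (I : Type) (lt : I -> I -> Prop) (A : mbsset) := MBSystem {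
  sys :> I -> mbsset;
  sys_in : forall i, mbmap A (sys i);
  sys_tr : forall i j, lt i j -> mbmap (sys i) (sys j);
  sys_tr_in : forall i j (h : lt i j),
    smap_eq (mbmap_comp (sys_tr h) (sys_in i)) (sys_in j);
  sys_tr_tr : forall i j k (h : lt i j) (h' : lt j k) (h'' : lt i k),
    smap_eq (mbmap_comp (sys_tr h') (sys_tr h)) (sys_tr h'') }.

(* Cocones and colimits, in the category of objects under A, of the restriction
   of the system D to a subset J of the indices; when J is empty the colimit
   is A. *)
Definition mb_cocone {I} {lt : I -> I -> Prop} {A} (D : mb_system lt A)
    (J : I -> Prop) (X : mbsset) (a : mbmap A X)
    (c : forall i, J i -> mbmap (D i) X) : Prop :=
  (forall i (h : J i), smap_eq (mbmap_comp (c i h) (sys_in D i)) a) /\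
  (forall i j (hi : J i) (hj : J j) (h : lt i j),
    smap_eq (mbmap_comp (c j hj) (sys_tr D h)) (c i hi)).

Definition mb_colimit {I} {lt : I -> I -> Prop} {A} (D : mb_system lt A)
    (J : I -> Prop) (X : mbsset) (a : mbmap A X)
    (c : forall i, J i -> mbmap (D i) X) : Prop :=
  mb_cocone a c /\
  forall (Z : mbsset) (b : mbmap A Z) (d : forall i, J i -> mbmap (D i) Z),
    mb_cocone b d ->
    exists u : mbmap X Z,
      [/\ smap_eq (mbmap_comp u a) b,
          forall i (h : J i), smap_eq (mbmap_comp u (c i h)) (d i h)
        & forall u' : mbmap X Z, smap_eq (mbmap_comp u' a) b ->
            (forall i (h : J i), smap_eq (mbmap_comp u' (c i h)) (d i h)) ->
            smap_eq u' u].

(* The smallest class containing G and closed under pushouts, retracts and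
   transfinite compositions. In [sat_transfinite], L i is the colimit of the
   D j for j < i, and X is the colimit of the whole system. *)
Inductive saturation (G : mb_class) : mb_class :=
| sat_gen A B (f : mbmap A B) : G A B f -> saturation G f
| sat_pushout A B A' B' (f : mbmap A B) (g : mbmap A A') (g' : mbmap B B')
    (f' : mbmap A' B') :
    mb_pushout f g g' f' -> saturation G f -> saturation G f'
| sat_retract A B A' B' (f : mbmap A B) (f' : mbmap A' B') :
    mb_retract f' f -> saturation G f -> saturation G f'
| sat_transfinite (I : Type) (lt : I -> I -> Prop) (A : mbsset)
    (D : mb_system lt A)
    (L : I -> mbsset) (a : forall i, mbmap A (L i))
    (c : forall i j, lt j i -> mbmap (D j) (L i))
    (l : forall i, mbmap (L i) (D i))
    (X : mbsset) (aX : mbmap A X) (cX : forall i, True -> mbmap (D i) X) :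
    well_order lt ->
    (forall i, @mb_colimit _ _ _ D (fun j => lt j i) (L i) (a i) (c i)) ->
    (forall i, smap_eq (mbmap_comp (l i) (a i)) (sys_in D i)) ->
    (forall i j (h : lt j i),
      smap_eq (mbmap_comp (l i) (c i j h)) (sys_tr D h)) ->
    (forall i, saturation G (l i)) ->
    @mb_colimit _ _ _ D (fun _ => True) X aX cX ->
    saturation G aX.

(** * MB-anodyne maps and 2-Cartesian fibrations *)

Definition on_any {m n} (ss : seq (seq nat)) (x : mono m n) : Prop :=
  exists2 s, s \in ss & on_vertices s x.

(* U_i: the nondegenerate triangles of the 3-simplex containing the vertex i *)
Definition faces_but (i : nat) (x : mono 2 3) : Prop :=
  injective x /\ exists k, val (x k) = i.

Definition image_of {X Y : sset} (q : smap X Y) {n} (P : X n -> Prop)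
    (y : Y n) : Prop :=
  exists2 x, P x & y = q n x.

(* In each clause, f is the map of marked biscaled simplicial sets with the
   displayed source, target and underlying simplicial map (it exists by
   [listed_mbmap]). A horn inherits the listed simplices of the simplex. *)
Inductive mb_generator : mb_class :=
| gen_A1 n i
    (f : mbmap
      (@listed (horn n i) mb_flat
        (fun t => on_vertices [:: i.-1; i; i.+1] (val t)) mb_flat)
      (@listed (simplex n) mb_flat (on_vertices [:: i.-1; i; i.+1]) mb_flat)) :
    2 <= n -> 0 < i < n -> smap_eq f (horn_incl n i) -> mb_generator f
| gen_A2
    (f : mbmap
      (@listed (simplex 4) mb_flat
        (on_any [:: [:: 0; 2; 4]; [:: 1; 2; 3]; [:: 0; 1; 3]; [:: 1; 3; 4];
                    [:: 0; 1; 2]]) mb_flat)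
      (@listed (simplex 4) mb_flat
        (on_any [:: [:: 0; 2; 4]; [:: 1; 2; 3]; [:: 0; 1; 3]; [:: 1; 3; 4];
                    [:: 0; 1; 2]; [:: 0; 3; 4]; [:: 0; 1; 4]]) mb_flat)) :
    smap_eq f (smap_id (simplex 4)) -> mb_generator f
| gen_A3 n
    (f : mbmap
      (@listed (horn_c01 n 0) mb_flat mb_flat
        (image_of (horn_quot01 n 0)
          (fun t : horn n 0 2 => on_vertices [:: 0; 1; n] (val t))))
      (@listed (simplex_c01 n) mb_flat mb_flat
        (image_of (quot01 n)
          (fun t : simplex n 2 => on_vertices [:: 0; 1; n] t)))) :
    2 <= n -> smap_eq f (horn_incl_c01 n 0) -> mb_generator f
| gen_A4 n
    (f : mbmap
      (@listed (horn n n) (fun e => on_vertices [:: n.-1; n] (val e)) mb_flat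
        (fun t => on_vertices [:: 0; n.-1; n] (val t)))
      (@listed (simplex n) (on_vertices [:: n.-1; n]) mb_flat
        (on_vertices [:: 0; n.-1; n]))) :
    2 <= n -> smap_eq f (horn_incl n n) -> mb_generator f
| gen_A5
    (f : mbmap (@listed (simplex 0) mb_sharp mb_sharp mb_sharp)
               (@listed (simplex 1) mb_sharp mb_sharp mb_sharp)) :
    (forall n (x : simplex 0 n) k, val ((f n x : mono n 1) k) = 1) ->
    mb_generator f
| gen_S1
    (f : mbmap
      (@listed (simplex 2) (on_any [:: [:: 0; 1]; [:: 1; 2]]) mb_sharp mb_sharp)
      (@listed (simplex 2) mb_sharp mb_sharp mb_sharp)) :
    smap_eq f (smap_id (simplex 2)) -> mb_generator f
| gen_S2
    (f : mbmap (@listed (simplex 2) mb_flat mb_flat mb_sharp)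
               (@listed (simplex 2) mb_flat mb_sharp mb_sharp)) :
    smap_eq f (smap_id (simplex 2)) -> mb_generator f
| gen_S3 i
    (f : mbmap
      (@listed (simplex 3) mb_flat (on_vertices [:: i.-1; i; i.+1])
        (faces_but i))
      (@listed (simplex 3) mb_flat (on_vertices [:: i.-1; i; i.+1]) mb_sharp)) :
    0 < i < 3 -> smap_eq f (smap_id (simplex 3)) -> mb_generator f
| gen_S4
    (f : mbmap
      (@listed (simplex_c01 3) mb_flat mb_flat
        (image_of (quot01 3) (fun t : simplex 3 2 => faces_but 0 t)))
      (@listed (simplex_c01 3) mb_flat mb_flat mb_sharp)) :
    smap_eq f (smap_id (simplex_c01 3)) -> mb_generator f
| gen_S5
    (f : mbmap
      (@listed (simplex 3) (on_vertices [:: 2; 3]) mb_flat (faces_but 3))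
      (@listed (simplex 3) (on_vertices [:: 2; 3]) mb_flat mb_sharp)) :
    smap_eq f (smap_id (simplex 3)) -> mb_generator f
| gen_E (K : sset)
    (f : mbmap (@listed K mb_flat mb_sharp mb_sharp)
               (@listed K mb_sharp mb_sharp mb_sharp)) :
    kan K -> smap_eq f (smap_id K) -> mb_generator f.

Definition mb_anodyne : mb_class := saturation mb_generator.

Definition mb_rlp {A B X Y : mbsset} (i : mbmap A B) (p : mbmap X Y) : Prop :=
  forall (f : mbmap A X) (g : mbmap B Y),
    smap_eq (mbmap_comp p f) (mbmap_comp g i) ->
    exists h : mbmap B X,
      smap_eq (mbmap_comp h i) f /\ smap_eq (mbmap_comp p h) g.

Definition two_cartesian_fibration {X : mbsset} {S : scaled}
    (p : mbmap X (mb_of_scaled S)) : Prop :=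
  forall (A B : mbsset) (i : mbmap A B), mb_anodyne i -> mb_rlp i p.

(** * The scaled nerve of a 2-category *)

(* An n-simplex of the Duskin nerve is a normal oplax functor [n] -> B. *)
Record duskin (B : two_cat) (n : nat) := Duskin {
  dv : 'I_n.+1 -> B;
  de : forall i j : 'I_n.+1, i <= j -> hom (dv i) (dv j);
  dt : forall (i j k : 'I_n.+1) (ij : i <= j) (jk : j <= k) (ik : i <= k),
    c_hom (de ik) (comp1 (de jk) (de ij));
  de_id : forall (i : 'I_n.+1) (ii : i <= i), de ii = id1 (dv i);
  dt_idl : forall (i j : 'I_n.+1) (ii : i <= i) (ij ij' : i <= j),
    arr_eq (dt ii ij ij') (c_id (de ij));
  dt_idr : forall (i j : 'I_n.+1) (ij ij' : i <= j) (jj : j <= j),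
    arr_eq (dt ij jj ij') (c_id (de ij));
  dtA : forall (i j k l : 'I_n.+1) (ij : i <= j) (jk : j <= k) (kl : k <= l)
      (ik : i <= k) (jl : j <= l) (il : i <= l),
    arr_eq (c_comp (hcomp (c_id (de kl)) (dt ij jk ik)) (dt ik kl il))
           (c_comp (hcomp (dt jk kl jl) (c_id (de ij))) (dt ij jl il)) }.

Arguments dv {B n} d i.
Arguments de {B n} d {i j} ij : rename.
Arguments dt {B n} d {i j k} ij jk ik.

Definition duskin_act (B : two_cat) m n (a : mono m n) (s : duskin B n) :
    duskin B m :=
  @Duskin B m (fun i => dv s (a i)) (fun i j ij => de s (moP a ij))
    (fun i j k ij jk ik => dt s (moP a ij) (moP a jk) (moP a ik))
    (fun i ii => de_id s (moP a ii))
    (fun i j ii ij ij' => dt_idl s (moP a ii) (moP a ij) (moP a ij'))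
    (fun i j ij ij' jj => dt_idr s (moP a ij) (moP a ij') (moP a jj))
    (fun i j k l ij jk kl ik jl il =>
      dtA s (moP a ij) (moP a jk) (moP a kl) (moP a ik) (moP a jl) (moP a il)).

Definition nerve (B : two_cat) : sset.
Proof.
refine (@SSet (duskin B) (@duskin_act B) _ _).
- by move=> n [].
- by [].
Defined.

Definition o20 : 'I_3 := @Ordinal 3 0 isT.
Definition o21 : 'I_3 := @Ordinal 3 1 isT.
Definition o22 : 'I_3 := @Ordinal 3 2 isT.

Definition nerve_thin (B : two_cat) (s : nerve B 2) : Prop :=
  is_iso (@dt B 2 s o20 o21 o22 isT isT isT).

Lemma arr_eq_sym (C : cat) (a b a' b' : C) (u : c_hom a b) (u' : c_hom a' b') :
  arr_eq u u' -> arr_eq u' u.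
Proof. by case: a' b' u' /. Qed.

Lemma arr_eq_trans (C : cat) (a b a' b' a'' b'' : C) (u : c_hom a b)
    (u' : c_hom a' b') (u'' : c_hom a'' b'') :
  arr_eq u u' -> arr_eq u' u'' -> arr_eq u u''.
Proof. by move=> h; case: a' b' u' / h. Qed.

Lemma arr_eqP (C : cat) (a b a' b' : C) (u : c_hom a b) (u' : c_hom a' b') :
  arr_eq u u' -> exists (ea : a = a') (eb : b = b'),
    u' = eq_rect _ (c_hom a') (eq_rect _ (fun x => c_hom x b) u _ ea) _ eb.
Proof. by move=> h; case: a' b' u' / h; exists erefl, erefl. Qed.

Lemma arr_eq_comp (C : cat) (a b c a' b' c' : C)
    (u : c_hom a b) (v : c_hom b c) (u' : c_hom a' b') (v' : c_hom b' c') :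
  arr_eq u u' -> arr_eq v v' -> arr_eq (c_comp v u) (c_comp v' u').
Proof.
move=> h /arr_eqP[eb [ec ->]]; case: _ / ec => /=.
case: _ / eb u' h => u' /arr_eqP[ea [eb ->]].
by rewrite (proof_irrelevance _ eb erefl) /=; case: _ / ea.
Qed.

Lemma arr_eq_hcomp (B : two_cat) (x y z : B) (g g' k k' : hom y z)
    (f f' l l' : hom x y) (b : c_hom g g') (d : c_hom k k')
    (a : c_hom f f') (c : c_hom l l') :
  arr_eq b d -> arr_eq a c -> arr_eq (hcomp b a) (hcomp d c).
Proof. by move=> h1 h2; case: k k' d / h1; case: l l' c / h2. Qed.

Lemma arr_eq_f (C D : cat) (P : functor C D) (a b a' b' : C)
    (u : c_hom a b) (u' : c_hom a' b') :
  arr_eq u u' -> arr_eq (f_hom P u) (f_hom P u').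
Proof. by move=> h; case: a' b' u' / h. Qed.

Lemma arr_eq_iso (C : cat) (a b a' b' : C) (u : c_hom a b) (u' : c_hom a' b') :
  arr_eq u u' -> is_iso u' -> is_iso u.
Proof. by move=> h; case: a' b' u' / h. Qed.

Lemma is_iso_id (C : cat) (a : C) : is_iso (c_id a).
Proof. by exists (c_id a); rewrite c_comp1l. Qed.

Definition castr {C : cat} {a b b' : C} (e : b = b') (u : c_hom a b) :
  c_hom a b' := eq_rect b (c_hom a) u b' e.

Lemma castr_eq (C : cat) (a b b' : C) (e : b = b') (u : c_hom a b) :
  arr_eq (castr e u) u.
Proof. by case: _ / e. Qed.

Lemma dt_iso_l (B : two_cat) n (s : duskin B n) (i j k : 'I_n.+1)
    (ij : i <= j) (jk : j <= k) (ik : i <= k) : i = j -> is_iso (dt s ij jk ik).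
Proof.
by move=> e; case: _ / e ij jk => ij jk; apply: arr_eq_iso (dt_idl _ _ _ _) _;
  apply: is_iso_id.
Qed.

Lemma dt_iso_r (B : two_cat) n (s : duskin B n) (i j k : 'I_n.+1)
    (ij : i <= j) (jk : j <= k) (ik : i <= k) : j = k -> is_iso (dt s ij jk ik).
Proof.
by move=> e; case: _ / e jk ik => jk ik; apply: arr_eq_iso (dt_idr _ _ _ _) _;
  apply: is_iso_id.
Qed.

Lemma nerve_thin_deg (B : two_cat) (s : nerve B 2) :
  degenerate s -> nerve_thin s.
Proof.
case=> m [a [t [lt ->]]]; rewrite /nerve_thin /=.
have [e|ne] := eqVneq (a o20) (a o21); first exact: dt_iso_l.
apply: dt_iso_r; apply/val_inj/eqP; rewrite eqn_leq moP //=.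
have h : a o20 < a o21 by rewrite ltn_neqAle ne moP.
have h2 : a o22 <= 1 by rewrite -ltnS (leq_trans (ltn_ord _)).
by rewrite (leq_trans h2) // (leq_ltn_trans _ h).
Qed.

Definition Nsc (B : two_cat) : scaled := Scaled (@nerve_thin_deg B).

Section NerveMap.

Context {B C : two_cat} (F : two_functor B C).

Definition nerve_dt n (s : duskin B n) (i j k : 'I_n.+1)
    (ij : i <= j) (jk : j <= k) (ik : i <= k) :
    c_hom (F1 F (de s ik)) (comp1 (F1 F (de s jk)) (F1 F (de s ij))) :=
  castr (F1_comp F (de s jk) (de s ij)) (f_hom (F1 F) (dt s ij jk ik)).

Lemma nerve_dtE n (s : duskin B n) (i j k : 'I_n.+1)
    (ij : i <= j) (jk : j <= k) (ik : i <= k) :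
  arr_eq (nerve_dt s ij jk ik) (f_hom (F1 F) (dt s ij jk ik)).
Proof. exact: castr_eq. Qed.

Definition nerve_fun n (s : duskin B n) : duskin C n.
Proof.
refine (@Duskin C n (fun i => F (dv s i)) (fun i j ij => F1 F (de s ij))
  (@nerve_dt n s) _ _ _ _).
- by move=> i ii; rewrite de_id F1_id.
- move=> i j ii ij ij'; apply: arr_eq_trans (nerve_dtE _ _ _ _) _.
  by rewrite -f_id; apply/arr_eq_f/dt_idl.
- move=> i j ij ij' jj; apply: arr_eq_trans (nerve_dtE _ _ _ _) _.
  by rewrite -f_id; apply/arr_eq_f/dt_idr.
- move=> i j k l ij jk kl ik jl il; rewrite -!f_id.
  have hl : arr_eq (c_comp (hcomp (f_hom (F1 F) (c_id (de s kl)))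
      (nerve_dt s ij jk ik)) (nerve_dt s ik kl il))
    (f_hom (F1 F) (c_comp (hcomp (c_id (de s kl)) (dt s ij jk ik))
      (dt s ik kl il))).
    rewrite f_comp; apply: arr_eq_comp; first exact: nerve_dtE.
    apply: arr_eq_trans (arr_eq_sym (F2_hcomp F _ _)).
    by apply: arr_eq_hcomp; [exact: arr_eq_refl | exact: nerve_dtE].
  have hr : arr_eq (c_comp (hcomp (nerve_dt s jk kl jl)
      (f_hom (F1 F) (c_id (de s ij)))) (nerve_dt s ij jl il))
    (f_hom (F1 F) (c_comp (hcomp (dt s jk kl jl) (c_id (de s ij)))
      (dt s ij jl il))).
    rewrite f_comp; apply: arr_eq_comp; first exact: nerve_dtE.
    apply: arr_eq_trans (arr_eq_sym (F2_hcomp F _ _)).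
    by apply: arr_eq_hcomp; [exact: nerve_dtE | exact: arr_eq_refl].
  apply: arr_eq_trans hl _; apply: arr_eq_trans (arr_eq_sym hr).
  by apply: arr_eq_f; apply: dtA.
Defined.

Definition nerve_map : smap (Nsc B) (Nsc C).
Proof.
refine (@SMap (Nsc B) (Nsc C) nerve_fun _).
move=> m n a s; rewrite /= /duskin_act /nerve_fun /=.
by congr Duskin; apply: proof_irrelevance.
Defined.

End NerveMap.

(* Main.v *)
(* Lean triangles turn out to be those whose 2-morphism is coCartesian for the
   opfibration of hom-categories, and marked edges the 1-morphisms that are
   Cartesian up to equivalence.  The Duskin nerve is 3-coskeletal, so a horn
   lifting problem is settled in dimension 2 by the existence of composites,
   coCartesian lifts and Cartesian lifts, in dimension 3 by solving one
   associativity equation for the missing 2-morphism, and in dimension 4 by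
   deducing one associativity equation from the other four; above that it is
   trivial.  Conversely, lifting against horns of dimensions 3 and 4 yields the
   existence and the uniqueness parts of the universal properties, which
   identifies the two decorations.  Each generating anodyne map is then a
   statement about 2-morphisms of the 2-fibration, and right lifting properties
   pass to the saturation, transfinite composites being handled by choosing
   lifts by recursion along the well-order. *)

From Stdlib Require Import ProofIrrelevance FunctionalExtensionality Eqdep.
From Stdlib Require Import ClassicalEpsilon.
From mathcomp Require Import all_boot.
Require Import Defs.

Set Implicit Arguments.
Unset Strict Implicit.
Unset Printing Implicit Defensive.

(** Strict Cartesian 1-morphisms would be the wrong marking: in general they are not stable under
    invertible 2-morphisms and do not contain the equivalences, while S1 closes marked edges under
    thin triangles and E marks every edge of a Kan complex. Hence [acart], whose lifts commute up to
    an invertible 2-morphism in B but lie strictly over C. This strictness comes from the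
    opfibrations: a solution over an isomorphic 1-morphism is moved to the prescribed one by lifting
    the isomorphism. For outer horns of dimension 4 the missing equation is obtained only after
    whiskering with an edge and composing with a triangle; the degenerate or marked edge removes the
    whiskering, the lean triangle removes the composite. Conversely, uniqueness of factorizations
    comes from a 4-dimensional horn glued from two competing solutions. Composition is associative,
    and simplices of a horn share faces, only up to propositional equality. So equations are stated
    heterogeneously, and a map out of a horn is replaced by a fixed skeleton with one 2-morphism per
    triangle. *)

Ltac fext x := apply: functional_extensionality_dep => x.

Lemma dep_choice (A : Type) (T : A -> Type) (R : forall a, T a -> Prop) :
  (forall a, exists t, R a t) -> exists f : forall a, T a, forall a, R a (f a).
Proof.
move=> h; exists (fun a => proj1_sig (constructive_indefinite_description _ (h a))).
by move=> a; apply: (proj2_sig (constructive_indefinite_description _ (h a))).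
Qed.

Lemma mono_ext m n (x y : mono m n) : (forall i, x i = y i) -> x = y.
Proof.
case: x y => [x hx] [y hy] /= h.
have e : x = y by apply: functional_extensionality.
by case: _ / e hy h => hy _; congr Mono; apply: proof_irrelevance.
Qed.

(** * Lifting against a saturated class *)

Section Saturation.

Context {X Y : mbsset} (p : mbmap X Y).

Lemma rlp_pushout A B A' B' (f : mbmap A B) (g : mbmap A A') (g' : mbmap B B')
    (f' : mbmap A' B') : mb_pushout f g g' f' -> mb_rlp f p -> mb_rlp f' p.
Proof.
case=> sq univ rlp u v uv.
have [h [h1 h2]] : exists h : mbmap B X,
    smap_eq (mbmap_comp h f) (mbmap_comp u g) /\
    smap_eq (mbmap_comp p h) (mbmap_comp v g').
  apply: rlp => n x /=; have /= -> := uv n (g n x).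
  by have /= -> := sq n x.
have [k [k1 k2 _]] := univ X h u h1.
exists k; split=> //.
have sq' : smap_eq (mbmap_comp (mbmap_comp v g') f)
    (mbmap_comp (mbmap_comp v f') g).
  by move=> n x /=; have /= -> := sq n x.
(* Both [p k] and [v] are maps from the pushout to [Y] with the same restrictions, so uniqueness
   identifies them. *)
have [w [w1 w2 wu]] := univ Y _ _ sq'.
move=> n x; rewrite (wu (mbmap_comp p k)) ?(wu v) // => m z /=.
- by have /= -> := k1 m z; have /= -> := h2 m z.
- by have /= -> := k2 m z; exact: uv.
Qed.

Lemma rlp_retract A B A' B' (f : mbmap A B) (f' : mbmap A' B') :
  mb_retract f' f -> mb_rlp f p -> mb_rlp f' p.
Proof.
case=> [i [r [j [s [ri sj fi fr]]]]] rlp u v uv.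
have [h [h1 h2]] : exists h : mbmap B X,
    smap_eq (mbmap_comp h f) (mbmap_comp u r) /\
    smap_eq (mbmap_comp p h) (mbmap_comp v s).
  by apply: rlp => n x /=; have /= -> := uv n (r n x); have /= -> := fr n x.
exists (mbmap_comp h j); split=> n x /=.
- have /= <- := fi n x; have /= -> := h1 n (i n x).
  by have /= -> := ri n x.
- by have /= -> := h2 n (j n x); have /= -> := sj n x.
Qed.

Section Transfinite.

Context {W : Type} {lt : W -> W -> Prop} {A : mbsset} (D : mb_system lt A).
Context (L : W -> mbsset) (a : forall i, mbmap A (L i)).
Context (c : forall i j, lt j i -> mbmap (D j) (L i)).
Context (l : forall i, mbmap (L i) (D i)).
Context (Z : mbsset) (aZ : mbmap A Z) (cZ : forall i, True -> mbmap (D i) Z).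
Hypothesis wo : well_order lt.
Hypothesis colL : forall i,
  @mb_colimit _ _ _ D (fun j => lt j i) (L i) (a i) (@c i).
Hypothesis la : forall i, smap_eq (mbmap_comp (l i) (a i)) (sys_in D i).
Hypothesis lc : forall i j (h : lt j i),
  smap_eq (mbmap_comp (l i) (@c i j h)) (sys_tr D h).
Hypothesis rlpl : forall i, mb_rlp (l i) p.
Hypothesis colZ : @mb_colimit _ _ _ D (fun _ => True) Z aZ cZ.
Context (f : mbmap A X) (g : mbmap Z Y).
Hypothesis fg : smap_eq (mbmap_comp p f) (mbmap_comp g aZ).

Let over i (h : mbmap (D i) X) :=
  smap_eq (mbmap_comp h (sys_in D i)) f /\
  smap_eq (mbmap_comp p h) (mbmap_comp g (cZ i I)).

Let coherent i (H : forall j, lt j i -> mbmap (D j) X) :=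
  (forall j h, over (H j h)) /\
  forall j k (hj : lt j i) (hk : lt k i) (h : lt j k),
    smap_eq (mbmap_comp (H k hk) (sys_tr D h)) (H j hj).

(** A coherent family of lifts below [i] glues to a map out of the colimit [L i], which is then
    extended along [l i]. *)
Lemma transfinite_step i (H : {H | @coherent i H}) :
  exists h : mbmap (D i) X, over h /\
    forall j (hj : lt j i), smap_eq (mbmap_comp h (sys_tr D hj)) (sval H j hj).
Proof.
case: H => H [ov co] /=.
have [_ univ] := colL i.
have cocH : @mb_cocone _ _ _ D (fun j => lt j i) X f H.
  by split=> [j h|j k hj hk h]; [have [] := ov j h | exact: co].
have [u [u1 u2 _]] := univ X f H cocH.
(* The square for [l i] commutes because both composites are maps out of the colimit [L i] with the
   same restrictions. *)
have pu : smap_eq (mbmap_comp p u) (mbmap_comp (mbmap_comp g (cZ i I)) (l i)).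
  have [[z1 z2] _] := colZ.
  have cocZ : @mb_cocone _ _ _ D (fun j => lt j i) Y (mbmap_comp g aZ)
      (fun j h => mbmap_comp g (cZ j I)).
    split=> [j h n x|j k hj hk h n x] /=; first by have /= -> := z1 j I n x.
    by have /= -> := z2 j k I I h n x.
  have [w [_ _ wu]] := univ Y _ _ cocZ.
  move=> n x; rewrite (wu (mbmap_comp p u)) ?(wu (mbmap_comp (mbmap_comp g (cZ i I)) (l i))) //.
  - move=> m y /=; have /= -> := @la i m y; by have /= -> := z1 i I m y.
  - move=> j h m y /=; have /= -> := @lc i j h m y.
    by have /= -> := z2 j i I I h m y.
  - by move=> m y /=; have /= -> := u1 m y; exact: fg.
  - move=> j h m y /=; have /= -> := u2 j h m y.
    by have [_ /(_ m y)] := ov j h.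
have [h [h1 h2]] := rlpl pu.
exists h; split; first split=> // n x /=.
- by have /= <- := @la i n x; have /= -> := h1 n (a i n x); exact: u1.
- move=> j hj n x /=; have /= <- := @lc i j hj n x.
  have /= -> := h1 n (@c i j hj n x); exact: u2.
Qed.

Lemma rlp_transfinite : exists h : mbmap Z X,
  smap_eq (mbmap_comp h aZ) f /\ smap_eq (mbmap_comp p h) g.
Proof.
have [wf tr _] := wo.
have [step stepP] := dep_choice (fun i => dep_choice (@transfinite_step i)).
(* The value at [i] needs a proof that the earlier values are coherent, so plain recursion does not
   produce it. [Good i h] is the graph of the recursion instead: [h] is [step i] of a coherent
   family of good values. It is shown functional, then total. *)
pose Good' := fix Good' (i : W) (ai : Acc lt i) {struct ai} : mbmap (D i) X -> Prop :=
  fun h => exists H, (forall j (hj : lt j i),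
     Good' j (Acc_inv ai hj) (sval H j hj)) /\ h = step i H.
pose Good i := Good' i (wf i).
have GoodE i h : Good i h <-> exists H, (forall j (hj : lt j i),
    Good j (sval H j hj)) /\ h = step i H.
  rewrite /Good; case: (wf i) => acc /=.
  split=> [[H [h1 h2]]|[H [h1 h2]]]; exists H; split=> // j hj.
    by rewrite (proof_irrelevance _ (wf j) (acc j hj)); exact: h1.
  by rewrite (proof_irrelevance _ (acc j hj) (wf j)); exact: h1.
have uniq i h h' : Good i h -> Good i h' -> h = h'.
  elim/(well_founded_ind wf): i h h' => i IH h h' /GoodE[H [gH ->]] /GoodE[H' [gH' ->]].
  suff -> : H = H' by [].
  apply: eq_sig_hprop => [? ? ?|]; first exact: proof_irrelevance.
  fext j; fext hj.
  by apply: IH => //.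
have goodover i h : Good i h -> over h.
  by move=> /GoodE[H [_ ->]]; have [] := stepP i H.
have goodtr i j (hj : lt j i) h h' : Good i h -> Good j h' ->
    smap_eq (mbmap_comp h (sys_tr D hj)) h'.
  move=> /GoodE[H [gH ->]] g'; have [_ /(_ j hj)] := stepP i H.
  by rewrite (uniq _ _ _ (gH j hj) g').
have ex i : exists h, Good i h.
  elim/(well_founded_ind wf): i => i IH.
  have [H HP] : exists H : forall jj : {j | lt j i}, mbmap (D (sval jj)) X,
      forall jj, Good (sval jj) (H jj).
    exact: (@dep_choice _ _ (fun jj => @Good (sval jj)) (fun jj => IH _ (proj2_sig jj))).
  pose H' j hj := H (exist _ j hj).
  have hH' : @coherent i H'.
    split=> [j h|j k hj hk h]; first exact: goodover (HP (exist _ j h)).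
    exact: goodtr (HP (exist _ k hk)) (HP (exist _ j hj)).
  exists (step i (exist _ H' hH')); apply/GoodE; exists (exist _ H' hH'); split=> // j hj.
  exact: (HP (exist _ j hj)).
have [H HP] := dep_choice ex.
have [_ univ] := colZ.
have cocH : @mb_cocone _ _ _ D (fun _ => True) X f (fun i _ => H i).
  by split=> [i _|j k _ _ h]; [have [] := goodover _ _ (HP i) | exact: goodtr].
have [u [u1 u2 _]] := univ X _ _ cocH.
exists u; split=> //.
have [[z1 z2] _] := colZ.
have cocZ : @mb_cocone _ _ _ D (fun _ => True) Y (mbmap_comp g aZ)
    (fun j h => mbmap_comp g (cZ j h)).
  split=> [j h n x|j k hj hk h n x] /=; first by have /= -> := z1 j h n x.
  by have /= -> := z2 j k hj hk h n x.
have [w [_ _ wu]] := univ Y _ _ cocZ.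
move=> n x; rewrite (wu (mbmap_comp p u)) ?(wu g) //.
- by move=> m y /=; have /= -> := u1 m y; exact: fg.
- move=> i [] m y /=; have /= -> := u2 i I m y.
  by have [_ /(_ m y)] := goodover _ _ (HP i).
Qed.

End Transfinite.

Lemma rlp_saturation (G : mb_class) :
  (forall A B (i : mbmap A B), G A B i -> mb_rlp i p) ->
  forall A B (i : mbmap A B), saturation G i -> mb_rlp i p.
Proof.
move=> rlpG A B i; elim=> {A B i}.
- exact: rlpG.
- by move=> A B A' B' f g g' f' po _; apply: rlp_pushout po.
- by move=> A B A' B' f f' re _; apply: rlp_retract re.
- move=> W lt A D L a c l Z aZ cZ wo colL la lc _ rlpl colZ f g fg.
  exact: (rlp_transfinite wo colL la lc rlpl colZ fg).
Qed.

End Saturation.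

(** * Arrows up to equality of their endpoints *)

Section ArrEq.

Context {C : cat}.
Implicit Types a b c d : C.

Lemma arr_eq_eq a b (u u' : c_hom a b) : arr_eq u u' -> u = u'.
Proof.
move=> /arr_eqP[ea [eb ->]].
by rewrite (proof_irrelevance _ ea erefl) (proof_irrelevance _ eb erefl).
Qed.

Lemma arr_eq_tgt a b a' b' (u : c_hom a b) (u' : c_hom a' b') :
  arr_eq u u' -> b = b'.
Proof. by case: a' b' u' /. Qed.

Lemma arr_eq_id a a' : a = a' -> arr_eq (c_id a) (c_id a').
Proof. by move=> <-; exact: arr_eq_refl. Qed.

Lemma eq_arr_eq a b (u u' : c_hom a b) : u = u' -> arr_eq u u'.
Proof. by move=> ->; exact: arr_eq_refl. Qed.

Lemma arr_eq_compl a b c c' (u : c_hom a b) (v : c_hom b c) (v' : c_hom b c') :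
  arr_eq v v' -> arr_eq (c_comp v u) (c_comp v' u).
Proof. by move=> h; apply: arr_eq_comp h; exact: arr_eq_refl. Qed.

Lemma is_iso_comp a b c (v : c_hom b c) (u : c_hom a b) :
  is_iso v -> is_iso u -> is_iso (c_comp v u).
Proof.
case=> v' [v1 v2] [u' [u1 u2]]; exists (c_comp u' v'); split.
  by rewrite -c_compA (c_compA v' v u) v1 c_comp1l.
by rewrite -c_compA (c_compA u u' v') u2 c_comp1l.
Qed.

Lemma iso_monic a b c (v : c_hom b c) (u u' : c_hom a b) :
  is_iso v -> c_comp v u = c_comp v u' -> u = u'.
Proof.
case=> v' [v1 _] e.
by rewrite -(c_comp1l u) -(c_comp1l u') -v1 -!c_compA e.
Qed.

Lemma iso_epic a b c (u : c_hom a b) (v v' : c_hom b c) :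
  is_iso u -> c_comp v u = c_comp v' u -> v = v'.
Proof.
case=> u' [_ u2] e.
by rewrite -(c_comp1r v) -(c_comp1r v') -u2 !c_compA e.
Qed.

(** [v] has a left inverse built from [w] and a right inverse built from [u], so the two
    coincide. *)
Lemma two_of_six a b c d (w : c_hom c d) (v : c_hom b c) (u : c_hom a b) :
  is_iso (c_comp w v) -> is_iso (c_comp v u) -> is_iso v.
Proof.
case=> x [x1 _] [y [_ y2]].
have y2' : c_comp v (c_comp u y) = c_id c by rewrite c_compA.
exists (c_comp u y); split=> //.
rewrite -(c_comp1l (c_comp _ v)) -x1 -c_compA -(c_compA w) (c_compA v _ v) y2'.
by rewrite c_comp1l.
Qed.

Lemma iso_cancel_l a b c (v : c_hom b c) (u : c_hom a b) :
  is_iso v -> is_iso (c_comp v u) -> is_iso u.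
Proof.
case=> v' [v1 v2] ivu.
have -> : u = c_comp v' (c_comp v u) by rewrite c_compA v1 c_comp1l.
by apply: is_iso_comp => //; exists v.
Qed.

Lemma castr_iso a b b' (e : b = b') (u : c_hom a b) : is_iso u -> is_iso (castr e u).
Proof. by case: _ / e. Qed.

Lemma arr_eq_cancel_iso a b c b' c' (w : c_hom b c) (w' : c_hom b' c')
    (u : c_hom a b) (u' : c_hom a b') :
  arr_eq w w' -> is_iso w ->
  arr_eq (c_comp w u) (c_comp w' u') -> arr_eq u u'.
Proof.
move=> h; case: b' c' w' / h u' => u' iw /arr_eq_eq /(iso_monic iw) ->.
exact: arr_eq_refl.
Qed.

Lemma iso_solve a b c c' (w : c_hom b c) (r : c_hom a c') :
  is_iso w -> c = c' -> exists u : c_hom a b, arr_eq (c_comp w u) r.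
Proof.
case=> w' [_ w2] e; case: _ / e r => r.
by exists (c_comp w' r); rewrite c_compA w2 c_comp1l; exact: arr_eq_refl.
Qed.

End ArrEq.

Lemma is_iso_f (C D : cat) (P : functor C D) (a b : C) (u : c_hom a b) :
  is_iso u -> is_iso (f_hom P u).
Proof.
by case=> v [v1 v2]; exists (f_hom P v); rewrite -!f_comp v1 v2 !f_id.
Qed.

Lemma is_iso_hcomp (B : two_cat) (x y z : B) (g g' : hom y z) (f f' : hom x y)
    (b : c_hom g g') (a : c_hom f f') : is_iso b -> is_iso a -> is_iso (hcomp b a).
Proof.
case=> b' [b1 b2] [a' [a1 a2]]; exists (hcomp b' a').
by rewrite -!hcomp_comp b1 b2 a1 a2 !hcomp_id.
Qed.

(** * Opfibrations *)

Section Cocartesian.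

Context {C D : cat} (P : functor C D).

Lemma cocartesian_arr_eq (a b a' b' : C) (u : c_hom a b) (u' : c_hom a' b') :
  arr_eq u u' -> cocartesian P u -> cocartesian P u'.
Proof. by case: a' b' u' /. Qed.

Lemma cocartesian_iso (a b : C) (u : c_hom a b) : is_iso u -> cocartesian P u.
Proof.
move=> iu; case: (iu) => u' [u1 u2] c v w e.
exists (c_comp v u'); split; first split.
- by apply: (iso_epic (is_iso_f P iu)); rewrite e -f_comp -c_compA u1 c_comp1r.
- by rewrite -c_compA u1 c_comp1r.
- by move=> t [_ <-]; rewrite -c_compA u2 c_comp1r.
Qed.

Lemma cocartesian_comp (a b c : C) (v : c_hom b c) (u : c_hom a b) :
  cocartesian P v -> cocartesian P u -> cocartesian P (c_comp v u).
Proof.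
move=> hv hu d t w e.
have e1 : c_comp (c_comp w (f_hom P v)) (f_hom P u) = f_hom P t.
  by rewrite -c_compA -f_comp.
have [t1 [[p1 q1] un1]] := hu _ _ _ e1.
have [t2 [[p2 q2] un2]] := hv _ _ _ (esym p1).
exists t2; split; first by split=> //; rewrite c_compA q2.
move=> t' [p' q']; apply: un2; split=> //.
by symmetry; apply: un1; split; [rewrite f_comp p' | rewrite -c_compA].
Qed.

Lemma cocartesian_cancel (a b c : C) (v : c_hom b c) (u : c_hom a b) :
  cocartesian P u -> cocartesian P (c_comp v u) -> cocartesian P v.
Proof.
move=> hu hvu d t w e.
have e1 : c_comp w (f_hom P (c_comp v u)) = f_hom P (c_comp t u).
  by rewrite !f_comp c_compA e.
have [t1 [[p1 q1] un1]] := hvu _ _ _ e1.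
exists t1; split; first split=> //.
- have e2 : c_comp (f_hom P t) (f_hom P u) = f_hom P (c_comp t u) by rewrite f_comp.
  have [t2 [_ un2]] := hu _ _ _ e2.
  rewrite -(un2 t) // -(un2 (c_comp t1 v)) //; split; last by rewrite -c_compA.
  by rewrite f_comp p1.
- by move=> t' [p' q']; apply: un1; split=> //; rewrite c_compA q'.
Qed.

Lemma cocartesian_iso_cancel (a b c : C) (v : c_hom b c) (u : c_hom a b) :
  is_iso v -> cocartesian P (c_comp v u) -> cocartesian P u.
Proof.
case=> v' [v1 v2] h.
have -> : u = c_comp v' (c_comp v u) by rewrite c_compA v1 c_comp1l.
by apply: cocartesian_comp => //; apply: cocartesian_iso; exists v.
Qed.

Lemma cocartesian_unique (a b c : C) (u : c_hom a b) (v v' : c_hom b c) :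
  cocartesian P u -> f_hom P v = f_hom P v' -> c_comp v u = c_comp v' u -> v = v'.
Proof.
move=> hu e1 e2.
have e : c_comp (f_hom P v) (f_hom P u) = f_hom P (c_comp v u) by rewrite f_comp.
have [t [_ un]] := hu _ _ _ e.
by rewrite -(un v) // -(un v').
Qed.

Lemma cocartesian_unique_het (a b c c' : C) (u : c_hom a b) (v : c_hom b c)
    (v' : c_hom b c') : cocartesian P u -> arr_eq (f_hom P v) (f_hom P v') ->
  arr_eq (c_comp v u) (c_comp v' u) -> arr_eq v v'.
Proof.
move=> hu e1 e2; have e := arr_eq_tgt e2.
case: _ / e v' e1 e2 => v' /arr_eq_eq e1 /arr_eq_eq e2.
by rewrite (cocartesian_unique hu e1 e2); exact: arr_eq_refl.
Qed.

Lemma cocartesian_over_iso (a b : C) (u : c_hom a b) :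
  cocartesian P u -> is_iso (f_hom P u) -> is_iso u.
Proof.
move=> hu [w [w1 w2]].
have e : c_comp w (f_hom P u) = f_hom P (c_id a) by rewrite w1 f_id.
have [t [[p q] _]] := hu _ _ _ e.
exists t; split=> //; apply: (cocartesian_unique hu).
  by rewrite f_comp p w2 f_id.
by rewrite -c_compA q c_comp1r c_comp1l.
Qed.

(** Turns solutions up to isomorphism in the base into solutions strictly over the base. *)
Lemma opfibration_iso (a : C) (d : D) (w : c_hom (P a) d) :
  opfibration P -> is_iso w ->
  exists (b : C) (u : c_hom a b), arr_eq (f_hom P u) w /\ is_iso u.
Proof.
move=> op iw; have [b [u [e hu]]] := op _ _ w.
by exists b, u; split=> //; apply: cocartesian_over_iso => //; apply: arr_eq_iso e iw.
Qed.

(** The target of [r] is only propositionally equal to [c], because the associativity condition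
    compares two bracketings of a composite. *)
Lemma cocartesian_fill (a b c : C) (c' : C) (u : c_hom a b) (r : c_hom a c')
    (w : c_hom (P b) (P c)) :
  cocartesian P u -> c = c' -> arr_eq (c_comp w (f_hom P u)) (f_hom P r) ->
  exists t : c_hom b c, f_hom P t = w /\ arr_eq (c_comp t u) r.
Proof.
move=> hu e; case: _ / e r => r /arr_eq_eq e.
have [t [[p q] _]] := hu _ _ _ e.
by exists t; split=> //; rewrite q; exact: arr_eq_refl.
Qed.

End Cocartesian.

(** * Whiskering *)

Definition wl {B : two_cat} {x y z : B} (h : hom y z) {f f' : hom x y}
  (a : c_hom f f') : c_hom (comp1 h f) (comp1 h f') := hcomp (c_id h) a.

Definition wr {B : two_cat} {x y z : B} {g g' : hom y z} (b : c_hom g g')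
  (f : hom x y) : c_hom (comp1 g f) (comp1 g' f) := hcomp b (c_id f).

Section Whisker.

Context {B : two_cat}.
Implicit Types x y z t : B.

Lemma wl_comp x y z (h : hom y z) (f f' f'' : hom x y) (a' : c_hom f' f'')
    (a : c_hom f f') : wl h (c_comp a' a) = c_comp (wl h a') (wl h a).
Proof. by rewrite /wl -hcomp_comp c_comp1l. Qed.

Lemma wr_comp x y z (f : hom x y) (g g' g'' : hom y z) (b' : c_hom g' g'')
    (b : c_hom g g') : wr (c_comp b' b) f = c_comp (wr b' f) (wr b f).
Proof. by rewrite /wr -hcomp_comp c_comp1l. Qed.

Lemma wl_id x y z (h : hom y z) (f : hom x y) : wl h (c_id f) = c_id (comp1 h f).
Proof. exact: hcomp_id. Qed.

Lemma wr_id x y z (g : hom y z) (f : hom x y) : wr (c_id g) f = c_id (comp1 g f).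
Proof. exact: hcomp_id. Qed.

Lemma wl_arr_eq x y z (h h' : hom y z) (f f' k k' : hom x y) (a : c_hom f f')
    (b : c_hom k k') : h = h' -> arr_eq a b -> arr_eq (wl h a) (wl h' b).
Proof. by move=> <- e; apply: arr_eq_hcomp => //; exact: arr_eq_refl. Qed.

Lemma wr_arr_eq x y z (h h' : hom x y) (f f' k k' : hom y z) (a : c_hom f f')
    (b : c_hom k k') : h = h' -> arr_eq a b -> arr_eq (wr a h) (wr b h').
Proof. by move=> <- e; apply: arr_eq_hcomp => //; exact: arr_eq_refl. Qed.

Lemma wl_iso x y z (h : hom y z) (f f' : hom x y) (a : c_hom f f') :
  is_iso a -> is_iso (wl h a).
Proof. by move=> ia; apply: is_iso_hcomp => //; exact: is_iso_id. Qed.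

Lemma wr_iso x y z (h : hom x y) (f f' : hom y z) (a : c_hom f f') :
  is_iso a -> is_iso (wr a h).
Proof. by move=> ia; apply: is_iso_hcomp => //; exact: is_iso_id. Qed.

Lemma wl_wl x y z t (k : hom z t) (h : hom y z) (f f' : hom x y) (a : c_hom f f') :
  arr_eq (wl k (wl h a)) (wl (comp1 k h) a).
Proof. by rewrite /wl -hcomp_id; exact: hcompA. Qed.

Lemma wr_wr x y z t (k : hom x y) (h : hom y z) (f f' : hom z t) (a : c_hom f f') :
  arr_eq (wr a (comp1 h k)) (wr (wr a h) k).
Proof. by rewrite /wr -hcomp_id; exact: hcompA. Qed.

Lemma wl_wr x y z t (h : hom z t) (k : hom x y) (f f' : hom y z) (a : c_hom f f') :
  arr_eq (wl h (wr a k)) (wr (wl h a) k).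
Proof. exact: hcompA. Qed.

Lemma interchange x y z (g g' : hom y z) (f f' : hom x y) (b : c_hom g g')
    (a : c_hom f f') : c_comp (wl g' a) (wr b f) = c_comp (wr b f') (wl g a).
Proof. by rewrite /wl /wr -!hcomp_comp !c_comp1l !c_comp1r. Qed.

Lemma wl_1 x y (f f' : hom x y) (a : c_hom f f') : arr_eq (wl (id1 y) a) a.
Proof. exact: hcomp_1l. Qed.

Lemma wr_1 x y (f f' : hom x y) (a : c_hom f f') : arr_eq (wr a (id1 x)) a.
Proof. exact: hcomp_1r. Qed.

(** The two pastings of the faces of a 3-simplex 0123, through [f02] here and through [f13] in
    [assocR]; up to unfolding [wl] and [wr], [dtA] is their equality. *)
Definition assocL x0 x1 x2 x3 (f01 : hom x0 x1) (f12 : hom x1 x2)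
    (f23 : hom x2 x3) (f02 : hom x0 x2) (f03 : hom x0 x3)
    (t012 : c_hom f02 (comp1 f12 f01)) (t023 : c_hom f03 (comp1 f23 f02)) :=
  c_comp (wl f23 t012) t023.

Definition assocR x0 x1 x2 x3 (f01 : hom x0 x1) (f12 : hom x1 x2)
    (f23 : hom x2 x3) (f13 : hom x1 x3) (f03 : hom x0 x3)
    (t013 : c_hom f03 (comp1 f13 f01)) (t123 : c_hom f13 (comp1 f23 f12)) :=
  c_comp (wr t123 f01) t013.

(** * Associativity conditions in a 4-simplex *)

Section Pentagon.

Context {x0 x1 x2 x3 x4 : B} {f01 : hom x0 x1} {f02 : hom x0 x2}
  {f03 : hom x0 x3} {f04 : hom x0 x4} {f12 : hom x1 x2} {f13 : hom x1 x3}
  {f14 : hom x1 x4} {f23 : hom x2 x3} {f24 : hom x2 x4} {f34 : hom x3 x4}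
  (t012 : c_hom f02 (comp1 f12 f01)) (t013 : c_hom f03 (comp1 f13 f01))
  (t014 : c_hom f04 (comp1 f14 f01)) (t023 : c_hom f03 (comp1 f23 f02))
  (t024 : c_hom f04 (comp1 f24 f02)) (t034 : c_hom f04 (comp1 f34 f03))
  (t123 : c_hom f13 (comp1 f23 f12)) (t124 : c_hom f14 (comp1 f24 f12))
  (t134 : c_hom f14 (comp1 f34 f13)) (t234 : c_hom f24 (comp1 f34 f23)).

Let e0123 := arr_eq (assocL t012 t023) (assocR t013 t123).
Let e0124 := arr_eq (assocL t012 t024) (assocR t014 t124).
Let e0134 := arr_eq (assocL t013 t034) (assocR t014 t134).
Let e0234 := arr_eq (assocL t023 t034) (assocR t024 t234).
Let e1234 := arr_eq (assocL t123 t134) (assocR t124 t234).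

(* The hexagon whose vertices are composites f04 => f34 f23 f12 f01: five edges
   are whiskerings of the associativity conditions of the faces, and the sixth
   is the interchange law. *)
Let N1 := c_comp (wl f34 (wl f23 t012)) (assocL t023 t034).
Let N2 := c_comp (wl (comp1 f34 f23) t012) (assocR t024 t234).
Let N3 := c_comp (wr t234 (comp1 f12 f01)) (assocL t012 t024).
Let N4 := c_comp (wr (wr t234 f12) f01) (assocR t014 t124).
Let N5 := c_comp (wr (wl f34 t123) f01) (assocR t014 t134).
Let N6 := c_comp (wl f34 (wr t123 f01)) (assocL t013 t034).

Let N1E : N1 = c_comp (wl f34 (assocL t012 t023)) t034.
Proof. by rewrite /N1 /assocL wl_comp c_compA. Qed.
Let N4E : N4 = c_comp (wr (assocR t124 t234) f01) t014.
Proof. by rewrite /N4 /assocR wr_comp c_compA. Qed.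
Let N5E : N5 = c_comp (wr (assocL t123 t134) f01) t014.
Proof. by rewrite /N5 /assocL /assocR wr_comp c_compA. Qed.
Let N6E : N6 = c_comp (wl f34 (assocR t013 t123)) t034.
Proof. by rewrite /N6 /assocL /assocR wl_comp c_compA. Qed.
Let N23 : arr_eq N2 N3.
Proof. by apply: eq_arr_eq; rewrite /N2 /N3 /assocL /assocR !c_compA interchange. Qed.
Let N12 : e0234 -> arr_eq N1 N2.
Proof. by move=> h; apply: arr_eq_comp h (wl_wl _ _ _). Qed.
Let N34 : e0124 -> arr_eq N3 N4.
Proof. by move=> h; apply: arr_eq_comp h (wr_wr _ _ _). Qed.
Let N45 : e1234 -> arr_eq N4 N5.
Proof.
move=> h; rewrite N4E N5E; apply: arr_eq_compl; apply: wr_arr_eq => //.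
exact: arr_eq_sym.
Qed.
Let N56 : e0134 -> arr_eq N5 N6.
Proof.
move=> h; apply: arr_eq_comp; first exact: arr_eq_sym.
by apply: arr_eq_sym; exact: wl_wr.
Qed.
Let N61 : e0123 -> arr_eq N6 N1.
Proof.
move=> h; rewrite N6E N1E; apply: arr_eq_compl; apply: wl_arr_eq => //.
exact: arr_eq_sym.
Qed.

(** The remaining edge [N1] = [N2] of the hexagon is the wanted condition followed by a whiskering
    of [t012], which is cancelled. The faces opposite to the vertices 2 and 3 are treated likewise
    with [t123] and [t234]. *)
Lemma pentagon_0234 : is_iso t012 ->
  e0123 -> e0124 -> e0134 -> e1234 -> e0234.
Proof.
move=> i012 h1 h2 h3 h5.
apply: (arr_eq_cancel_iso (wl_wl f34 f23 t012)); first by do 2 apply: wl_iso.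
change (arr_eq N1 N2).
apply: arr_eq_trans (arr_eq_sym (N61 h1)) _.
apply: arr_eq_trans (arr_eq_sym (N56 h3)) _.
apply: arr_eq_trans (arr_eq_sym (N45 h5)) _.
by apply: arr_eq_trans (arr_eq_sym (N34 h2)) _; exact: arr_eq_sym N23.
Qed.

Lemma pentagon_0134 : is_iso t123 ->
  e0123 -> e0124 -> e0234 -> e1234 -> e0134.
Proof.
move=> i123 h1 h2 h4 h5.
apply: (arr_eq_cancel_iso (wl_wr f34 f01 t123)); first by apply: wl_iso; apply: wr_iso.
change (arr_eq N6 N5).
apply: arr_eq_trans (N61 h1) _.
apply: arr_eq_trans (N12 h4) _; apply: arr_eq_trans N23 _.
by apply: arr_eq_trans (N34 h2) (N45 h5).
Qed.

Lemma pentagon_0124 : is_iso t234 ->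
  e0123 -> e0134 -> e0234 -> e1234 -> e0124.
Proof.
move=> i234 h1 h3 h4 h5.
apply: (arr_eq_cancel_iso (wr_wr f01 f12 t234)); first exact: wr_iso.
change (arr_eq N3 N4).
apply: arr_eq_trans (arr_eq_sym N23) _.
apply: arr_eq_trans (arr_eq_sym (N12 h4)) _.
apply: arr_eq_trans (arr_eq_sym (N61 h1)) _.
by apply: arr_eq_trans (arr_eq_sym (N56 h3)) (arr_eq_sym (N45 h5)).
Qed.

(** For a face opposite to an outer vertex the hexagon leaves a whiskering, here with [f01], and a
    composite, here with [t014]; [unique_1234] and [unique_0123] remove them. *)
Lemma pentagon_1234 : e0123 -> e0124 -> e0134 -> e0234 ->
  arr_eq (c_comp (wr (assocL t123 t134) f01) t014)
         (c_comp (wr (assocR t124 t234) f01) t014).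
Proof.
move=> h1 h2 h3 h4; rewrite -N4E -N5E.
apply: arr_eq_trans (N56 h3) _; apply: arr_eq_trans (N61 h1) _.
apply: arr_eq_trans (N12 h4) _.
by apply: arr_eq_trans N23 (N34 h2).
Qed.

Lemma pentagon_0123 : e0124 -> e0134 -> e0234 -> e1234 ->
  arr_eq (c_comp (wl f34 (assocL t012 t023)) t034)
         (c_comp (wl f34 (assocR t013 t123)) t034).
Proof.
move=> h2 h3 h4 h5; rewrite -N1E -N6E.
apply: arr_eq_trans (N12 h4) _; apply: arr_eq_trans N23 _.
apply: arr_eq_trans (N34 h2) _.
by apply: arr_eq_trans (N45 h5) (N56 h3).
Qed.

(** By the faces 0124 and 1234, the whiskering of [t124] with [f01] becomes invertible when composed
    with [t014] on one side, and with a whiskering of [t234] on the other, so it is itself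
    invertible. Then [t014] and, by the face 0134, [t034] follow. *)
Lemma saturation_iso : e0123 -> e0124 -> e0134 -> e1234 ->
  is_iso t012 -> is_iso t123 -> is_iso t013 -> is_iso t134 -> is_iso t024 ->
  is_iso t034 /\ is_iso t014.
Proof.
move=> h1 h2 h3 h5 i012 i123 i013 i134 i024.
have i1 : is_iso (assocR t014 t124).
  by apply: arr_eq_iso (arr_eq_sym h2) _; apply: is_iso_comp => //; exact: wl_iso.
have i2 : is_iso (assocR t124 t234).
  by apply: arr_eq_iso (arr_eq_sym h5) _; apply: is_iso_comp => //; exact: wl_iso.
have i3 : is_iso (wr t124 f01).
  apply: (two_of_six (w := wr (wr t234 f12) f01)) i1.
  by rewrite -wr_comp; exact: wr_iso.
have i014 : is_iso t014 by apply: iso_cancel_l i3 _.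
split=> //; apply: (iso_cancel_l (wl_iso f34 i013)).
apply: arr_eq_iso h3 _; apply: is_iso_comp => //; exact: wr_iso.
Qed.

End Pentagon.

End Whisker.

Lemma arr_cast (C : cat) (a b a' b' : C) (u : c_hom a b) :
  a = a' -> b = b' -> exists u' : c_hom a' b', arr_eq u' u.
Proof. by move=> <- <-; exists u; exact: arr_eq_refl. Qed.

Lemma is_iso_arr_eq (C : cat) (a b a' b' : C) (u : c_hom a b) (u' : c_hom a' b') :
  arr_eq u u' -> is_iso u -> is_iso u'.
Proof. by move=> /arr_eq_sym; exact: arr_eq_iso. Qed.

(** * Equivalences in a 2-category *)

Section Equivalence.

Context {B : two_cat}.

(** Naturality of [p] makes [a] conjugate to [l h a], so [a] is determined by [h a]. *)
Lemma wl_faithful (x y z : B) (h : hom x y) (l : hom y x)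
    (p : c_hom (id1 x) (comp1 l h)) (f f' : hom z x) (a a' : c_hom f f') :
  is_iso p -> arr_eq (wl h a) (wl h a') -> a = a'.
Proof.
move=> ip /(wl_arr_eq (erefl l)) e; apply: arr_eq_eq.
apply: arr_eq_trans (arr_eq_sym (wl_1 a)) _; apply: arr_eq_trans (wl_1 a').
apply: eq_arr_eq; apply: (iso_monic (wr_iso f' ip)); rewrite -!interchange.
congr c_comp; apply: arr_eq_eq.
apply: arr_eq_trans (arr_eq_sym (wl_wl _ _ _)) _.
exact: arr_eq_trans e (wl_wl _ _ _).
Qed.

Context {x y : B} {h : hom x y} {l r : hom y x} {p : c_hom (id1 x) (comp1 l h)}
  {q : c_hom (id1 y) (comp1 h r)} (ip : is_iso p) (iq : is_iso q).

(** As for one-sided inverses in a monoid, [r] is isomorphic to [l h r] and hence to [l], so [l] can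
    replace [r] in [q]. *)
Lemma equiv_left_inverse : exists q' : c_hom (id1 y) (comp1 h l), is_iso q'.
Proof.
have [s [s1 s2]] := wl_iso l iq.
have [s' es'] : exists s' : c_hom (comp1 (comp1 l h) r) l, arr_eq s' s.
  by apply: arr_cast; rewrite ?comp1A ?comp1_1r.
have [p' ep'] : exists p' : c_hom r (comp1 (comp1 l h) r), arr_eq p' (wr p r).
  by apply: arr_cast; rewrite ?comp1_1l.
exists (c_comp (wl h (c_comp s' p')) q); apply: is_iso_comp => //.
apply: wl_iso; apply: is_iso_comp; apply: arr_eq_iso; try eassumption.
  by exists (wl l q).
exact: wr_iso.
Qed.

Lemma equiv_full (z : B) (f f' : hom z x) (b : c_hom (comp1 h f) (comp1 h f')) :
  exists a : c_hom f f', wl h a = b.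
Proof.
have [q' iq'] := equiv_left_inverse.
have [b' eb'] : exists b' : c_hom (comp1 (comp1 l h) f) (comp1 (comp1 l h) f'),
    arr_eq b' (wl l b) by apply: arr_cast; rewrite comp1A.
have [v [v1 v2]] := wr_iso f' ip.
have [a ea] : exists a : c_hom f f', arr_eq a (c_comp v (c_comp b' (wr p f))).
  by apply: arr_cast; rewrite comp1_1l.
(* [a] is [l b] conjugated by [p]. The equation is checked after whiskering with [l], which is
   faithful because [q'] makes [h] a left inverse of [l]. *)
exists a; apply: (wl_faithful iq'); apply: arr_eq_trans (wl_wl _ _ _) _.
apply: arr_eq_trans eb'; apply: eq_arr_eq.
apply: (iso_epic (wr_iso f ip)); rewrite interchange.
have -> : wl (id1 x) a = c_comp v (c_comp b' (wr p f)).
  by apply: arr_eq_eq; apply: arr_eq_trans (wl_1 a) ea.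
by rewrite c_compA v2 c_comp1l.
Qed.

Lemma equiv_full_iso (z : B) (f f' : hom z x)
    (b : c_hom (comp1 h f) (comp1 h f')) : is_iso b ->
  exists a : c_hom f f', wl h a = b /\ is_iso a.
Proof.
case=> b' [b1 b2]; have [a ea] := equiv_full b; have [a' ea'] := equiv_full b'.
exists a; split=> //; exists a'; split; apply: (wl_faithful ip);
  by apply: eq_arr_eq; rewrite wl_comp ea ea' ?b1 ?b2 wl_id.
Qed.

Lemma equiv_surj (z : B) (k : hom z y) :
  exists (f : hom z x) (u : c_hom k (comp1 h f)), is_iso u.
Proof.
exists (comp1 r k).
have [u eu] : exists u : c_hom k (comp1 h (comp1 r k)), arr_eq u (wr q k).
  by apply: arr_cast; rewrite ?comp1_1l ?comp1A.
by exists u; apply: arr_eq_iso eu _; exact: wr_iso.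
Qed.

End Equivalence.

(** An inductive family, since [f = id1 x] is not well typed when the target is another variable;
    matching on it replaces the target and the 1-morphism together. *)
Inductive is_id {B : two_cat} {x : B} : forall y : B, hom x y -> Prop :=
  is_id_refl : is_id (id1 x).

(** * Cartesian 1-morphisms and coCartesian 2-morphisms of a 2-functor *)

Section Functor.

Context {B C : two_cat} (F : two_functor B C).


Definition F2 {x y : B} {f g : hom x y} (a : c_hom f g) : c_hom (F1 F f) (F1 F g) :=
  f_hom (F1 F) a.

(** The 2-morphism of the image triangle, convertible with the one given by [nerve_dt]. *)
Definition Fc {x y z : B} {f : hom x y} {g : hom y z} {k : hom x z}
    (t : c_hom k (comp1 g f)) : c_hom (F1 F k) (comp1 (F1 F g) (F1 F f)) :=
  castr (F1_comp F g f) (F2 t).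

Lemma FcE x y z (f : hom x y) (g : hom y z) (k : hom x z)
    (t : c_hom k (comp1 g f)) : arr_eq (Fc t) (F2 t).
Proof. exact: castr_eq. Qed.

Lemma Fc_eq x y z (f : hom x y) (g : hom y z) (k : hom x z)
    (t : c_hom k (comp1 g f)) s : arr_eq (F2 t) s -> Fc t = s.
Proof. by move=> h; apply: arr_eq_eq; exact: arr_eq_trans (FcE t) h. Qed.

Lemma F2_wl x y z (h : hom y z) (f f' : hom x y) (a : c_hom f f') :
  arr_eq (F2 (wl h a)) (wl (F1 F h) (F2 a)).
Proof. by rewrite /wl -(f_id (F1 F)); exact: F2_hcomp. Qed.

Lemma F2_wr x y z (h : hom x y) (f f' : hom y z) (a : c_hom f f') :
  arr_eq (F2 (wr a h)) (wr (F2 a) (F1 F h)).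
Proof. by rewrite /wr -(f_id (F1 F)); exact: F2_hcomp. Qed.

Lemma F2_arr_eq x y (f g f' g' : hom x y) (a : c_hom f g) (a' : c_hom f' g') :
  arr_eq a a' -> arr_eq (F2 a) (F2 a').
Proof. exact: arr_eq_f. Qed.

Lemma F2_comp x y (f g k : hom x y) (b : c_hom g k) (a : c_hom f g) :
  F2 (c_comp b a) = c_comp (F2 b) (F2 a).
Proof. exact: f_comp. Qed.

Lemma F2_iso x y (f g : hom x y) (a : c_hom f g) : is_iso a -> is_iso (F2 a).
Proof. exact: is_iso_f. Qed.

Lemma Fc_iso x y z (f : hom x y) (g : hom y z) (k : hom x z)
    (t : c_hom k (comp1 g f)) : is_iso t -> is_iso (Fc t).
Proof. by move=> it; apply: castr_iso; exact: F2_iso. Qed.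

Section Triangles.

Context {x0 x1 x2 x3 : B} {f01 : hom x0 x1} {f02 : hom x0 x2} {f03 : hom x0 x3}
  {f12 : hom x1 x2} {f13 : hom x1 x3} {f23 : hom x2 x3}.

Lemma F2_assocL (t012 : c_hom f02 (comp1 f12 f01)) (t023 : c_hom f03 (comp1 f23 f02)) :
  arr_eq (F2 (assocL t012 t023)) (assocL (Fc t012) (Fc t023)).
Proof.
rewrite /assocL F2_comp; apply: arr_eq_comp; first exact: arr_eq_sym (FcE _).
apply: arr_eq_trans (F2_wl _ _) _; apply: wl_arr_eq => //.
exact: arr_eq_sym (FcE _).
Qed.

Lemma F2_assocR (t013 : c_hom f03 (comp1 f13 f01)) (t123 : c_hom f13 (comp1 f23 f12)) :
  arr_eq (F2 (assocR t013 t123)) (assocR (Fc t013) (Fc t123)).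
Proof.
rewrite /assocR F2_comp; apply: arr_eq_comp; first exact: arr_eq_sym (FcE _).
apply: arr_eq_trans (F2_wr _ _) _; apply: wr_arr_eq => //.
exact: arr_eq_sym (FcE _).
Qed.

Lemma assoc_F (t012 : c_hom f02 (comp1 f12 f01)) (t023 : c_hom f03 (comp1 f23 f02))
    (t013 : c_hom f03 (comp1 f13 f01)) (t123 : c_hom f13 (comp1 f23 f12)) :
  arr_eq (assocL t012 t023) (assocR t013 t123) ->
  arr_eq (assocL (Fc t012) (Fc t023)) (assocR (Fc t013) (Fc t123)).
Proof.
move=> h; apply: arr_eq_trans (arr_eq_sym (F2_assocL _ _)) _.
apply: arr_eq_trans (F2_assocR _ _); exact: F2_arr_eq.
Qed.

Lemma F_assoc (t012 : c_hom f02 (comp1 f12 f01)) (t023 : c_hom f03 (comp1 f23 f02))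
    (t013 : c_hom f03 (comp1 f13 f01)) (t123 : c_hom f13 (comp1 f23 f12)) :
  arr_eq (assocL (Fc t012) (Fc t023)) (assocR (Fc t013) (Fc t123)) ->
  arr_eq (F2 (assocL t012 t023)) (F2 (assocR t013 t123)).
Proof.
move=> h; apply: arr_eq_trans (F2_assocL _ _) _.
by apply: arr_eq_trans h _; exact: arr_eq_sym (F2_assocR _ _).
Qed.

End Triangles.

(* Cartesian 1-morphisms in the sense invariant under equivalence: for every z
   the square of hom-categories is a homotopy pullback. *)
Definition acart {x y : B} (h : hom x y) : Prop :=
  (forall (z : B) (f f' : hom z x) (b : c_hom (comp1 h f) (comp1 h f'))
      (c : c_hom (F1 F f) (F1 F f')),
    arr_eq (F2 b) (wl (F1 F h) c) ->
    exists! a : c_hom f f', wl h a = b /\ F2 a = c) /\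
  (forall (z : B) (k : hom z y) (g : hom (F z) (F x))
      (t : c_hom (F1 F k) (comp1 (F1 F h) g)), is_iso t ->
    exists (f : hom z x) (t' : c_hom k (comp1 h f)),
      [/\ F1 F f = g, is_iso t' & arr_eq (F2 t') t]).

Lemma acart_fill x y (h : hom x y) (z : B) (f f' : hom z x) p q (b : c_hom p q)
    r s (c : c_hom r s) : acart h -> p = comp1 h f -> q = comp1 h f' ->
  r = F1 F f -> s = F1 F f' -> arr_eq (F2 b) (wl (F1 F h) c) ->
  exists a : c_hom f f', arr_eq (wl h a) b /\ arr_eq (F2 a) c.
Proof.
case=> c1 _ ep eq er es; subst p q r s => e.
have [a [[e1 e2] _]] := c1 _ _ _ _ _ e.
by exists a; rewrite e1 e2; split; exact: arr_eq_refl.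
Qed.

Lemma acart_unique x y (h : hom x y) (z : B) (f f' f'' : hom z x)
    (a : c_hom f f') (a' : c_hom f f'') : acart h -> f' = f'' ->
  arr_eq (wl h a) (wl h a') -> arr_eq (F2 a) (F2 a') -> arr_eq a a'.
Proof.
case=> c1 _ e; case: _ / e a' => a' /arr_eq_eq e1 /arr_eq_eq e2.
have [a0 [_ un]] := c1 _ _ _ _ _ (F2_wl h a).
by rewrite -(un a) // -(un a') //; exact: arr_eq_refl.
Qed.

Hypothesis hF : buckley_2fibration F.

Let op x y : opfibration (@F1 _ _ F x y).
Proof. by case: hF. Qed.

Lemma cocart_wl x y z (h : hom y z) (f f' : hom x y) (a : c_hom f f') :
  cocartesian2 F a -> cocartesian2 F (wl h a).
Proof.
case: hF => _ hc _ ha; apply: hc => //; apply: cocartesian_iso; exact: is_iso_id.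
Qed.

Lemma cocart_wr x y z (h : hom x y) (f f' : hom y z) (a : c_hom f f') :
  cocartesian2 F a -> cocartesian2 F (wr a h).
Proof.
case: hF => _ hc _ ha; apply: hc => //; apply: cocartesian_iso; exact: is_iso_id.
Qed.

Lemma acart_cartesian1 x y (h : hom x y) : cartesian1 F h -> acart h.
Proof.
move=> ch; split=> [z f f' b c e|z k g t it].
  by have [_ _ _ /(_ f f' b c e)] := ch z.
(* The strict pullback applies only to a 1-morphism lying over [F h g] on the nose, so [k] is first
   replaced by an isomorphic [k'] over it. *)
have [k' [u [eu iu]]] := opfibration_iso (@op z y) it.
have ek : F1 F k' = comp1 (F1 F h) g by apply: arr_eq_tgt eu.
have [_ _ /(_ k' g ek) [f [[e1 e2] _]] _] := ch z.
by clear ek; subst g k'; exists f, u.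
Qed.

Lemma acart_iso x y (h k : hom x y) (t : c_hom k h) :
  is_iso t -> acart h -> acart k.
Proof.
move=> it ah; case: (ah) => c1 c2; split=> [z f f' b c e|z k' g s js].
(* [b'] is the conjugate of [b] by [t]; by [key] the same [a] solve both lifting problems. *)
- have [b' eb'] : exists b', c_comp b' (wr t f) = c_comp (wr t f') b.
    case: (wr_iso f it) => v [v1 v2]; exists (c_comp (c_comp (wr t f') b) v).
    by rewrite -c_compA v1 c_comp1r.
  have key (a : c_hom f f') : wl h a = b' <-> wl k a = b.
    split=> ea.
      by apply: (iso_monic (wr_iso f' it)); rewrite -interchange ea.
    by apply: (iso_epic (wr_iso f it)); rewrite eb' interchange ea.
  have Feb' : arr_eq (F2 b') (wl (F1 F h) c).
    have [b1 eb1] : exists b1 : c_hom (comp1 (F1 F h) (F1 F f)) (comp1 (F1 F h) (F1 F f')),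
        arr_eq b1 (F2 b') by apply: arr_cast; rewrite F1_comp.
    apply: arr_eq_trans (arr_eq_sym eb1) _; apply: eq_arr_eq.
    apply: (iso_epic (wr_iso (F1 F f) (F2_iso it))); rewrite interchange.
    apply: arr_eq_eq.
    apply: (arr_eq_trans (u' := F2 (c_comp b' (wr t f)))).
      rewrite F2_comp; apply: arr_eq_comp => //; exact: arr_eq_sym (F2_wr _ _).
    by rewrite eb' F2_comp; apply: arr_eq_comp => //; exact: F2_wr.
  have [a [[e1 e2] un]] := c1 _ _ _ _ _ Feb'.
  exists a; split; first by split=> //; apply/key.
  by move=> a' [e1' e2']; apply: un; split=> //; apply/key.
- have [f [t' [e1 it' e2]]] := c2 z k' g (c_comp (wr (F2 t) g) s)
    (is_iso_comp (wr_iso g (F2_iso it)) js).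
  case: (wr_iso f it) => v [v1 v2].
  exists f, (c_comp v t'); split=> //.
    by apply: is_iso_comp => //; exists (wr t f).
  have e3 : arr_eq (F2 (wr t f)) (wr (F2 t) g).
    by rewrite -e1; exact: F2_wr.
  apply: (arr_eq_cancel_iso e3); first by apply/F2_iso/wr_iso.
  by rewrite -F2_comp c_compA v2 c_comp1l.
Qed.

Lemma acart_comp x y w (h : hom x y) (k : hom y w) :
  acart h -> acart k -> acart (comp1 k h).
Proof.
move=> ah ak; split=> [z f f' b c e|z j g t it].
- have [c' ec'] : exists c' : c_hom (F1 F (comp1 h f)) (F1 F (comp1 h f')),
      arr_eq c' (wl (F1 F h) c) by apply: arr_cast; rewrite F1_comp.
  have eb : arr_eq (F2 b) (wl (F1 F k) c').
    apply: arr_eq_trans e _; rewrite F1_comp.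
    apply: arr_eq_trans (arr_eq_sym (wl_wl _ _ _)) _.
    by apply: wl_arr_eq => //; exact: arr_eq_sym.
  have [a1 [e1 e1']] := acart_fill ak (esym (comp1A k h f)) (esym (comp1A k h f'))
    erefl erefl eb.
  have [a [e2 e2']] := acart_fill ah erefl erefl erefl erefl (arr_eq_trans e1' ec').
  exists a; split=> [|a' [q1 q2]].
    split; last exact: arr_eq_eq.
    apply: arr_eq_eq; apply: arr_eq_trans (arr_eq_sym (wl_wl _ _ _)) _.
    by apply: arr_eq_trans e1; exact: wl_arr_eq.
  apply: arr_eq_eq.
  have eF : arr_eq (F2 a) (F2 a') by rewrite q2.
  apply: (acart_unique ah) => //; apply: (acart_unique ak) => //.
    apply: arr_eq_trans (wl_wl _ _ _) _; apply: arr_eq_trans (arr_eq_sym (wl_wl _ _ _)).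
    rewrite q1; apply: arr_eq_trans e1; apply: arr_eq_trans (arr_eq_sym (wl_wl _ _ _)) _.
    exact: wl_arr_eq.
  apply: arr_eq_trans (F2_wl _ _) _; apply: arr_eq_trans (arr_eq_sym (F2_wl _ _)).
  exact: wl_arr_eq.
- have [t1 et1] : exists t1 : c_hom (F1 F j) (comp1 (F1 F k) (comp1 (F1 F h) g)),
      arr_eq t1 t by apply: arr_cast => //; rewrite F1_comp comp1A.
  have [f1 [s1 [q1 js1 r1]]] := ak.2 z j _ t1 (arr_eq_iso et1 it).
  (* By [q1], [f1] lies strictly over [F h g], so the second lifting problem is posed against an
     identity, recast along [q1]. *)
  have [t2 et2] : exists t2 : c_hom (F1 F f1) (comp1 (F1 F h) g), arr_eq t2 (c_id (F1 F f1)).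
    exact: arr_cast.
  have [f2 [s2 [q2 js2 r2]]] := ah.2 z f1 _ t2 (arr_eq_iso et2 (is_iso_id _)).
  have [s es] : exists s : c_hom j (comp1 (comp1 k h) f2), arr_eq s (c_comp (wl k s2) s1).
    by apply: arr_cast => //; rewrite comp1A.
  exists f2, s; split=> //.
    by apply: arr_eq_iso es _; apply: is_iso_comp => //; exact: wl_iso.
  apply: arr_eq_trans (F2_arr_eq es) _; rewrite F2_comp.
  apply: arr_eq_trans et1; apply: arr_eq_trans r1.
  rewrite -[X in arr_eq _ X]c_comp1l; apply: arr_eq_comp; first exact: arr_eq_refl.
  apply: arr_eq_trans (F2_wl _ _) _; apply: arr_eq_trans (wl_arr_eq erefl r2) _.
  apply: arr_eq_trans (wl_arr_eq erefl et2) _; rewrite wl_id.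
  by apply: arr_eq_id; rewrite F1_comp.
Qed.

Lemma acart_equiv x y (h : hom x y) (l r : hom y x) (p : c_hom (id1 x) (comp1 l h))
    (q : c_hom (id1 y) (comp1 h r)) : is_iso p -> is_iso q -> acart h.
Proof.
move=> ip iq.
have [p' e_p] : exists p' : c_hom (id1 (F x)) (comp1 (F1 F l) (F1 F h)), arr_eq p' (F2 p).
  by apply: arr_cast; rewrite ?F1_id ?F1_comp.
have [q' e_q] : exists q' : c_hom (id1 (F y)) (comp1 (F1 F h) (F1 F r)), arr_eq q' (F2 q).
  by apply: arr_cast; rewrite ?F1_id ?F1_comp.
have i_p : is_iso p' by apply: arr_eq_iso e_p _; exact: F2_iso.
have i_q : is_iso q' by apply: arr_eq_iso e_q _; exact: F2_iso.
split=> [z f f' b c e|z k g t it].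
- have [a ea] := equiv_full ip iq b.
  exists a; split=> [|a' [e1 _]].
    split=> //; apply: (wl_faithful i_p); apply: arr_eq_trans (arr_eq_sym (F2_wl _ _)) _.
    by rewrite ea.
  by apply: (wl_faithful ip); rewrite ea e1; exact: arr_eq_refl.
- have [f0 [u iu]] := equiv_surj iq k.
  have [v [v1 v2]] := F2_iso iu.
  have [d ed] : exists d : c_hom (comp1 (F1 F h) (F1 F f0)) (comp1 (F1 F h) g),
      arr_eq d (c_comp t v) by apply: arr_cast; rewrite ?F1_comp.
  have id : is_iso d.
    by apply: arr_eq_iso ed _; apply: is_iso_comp => //; exists (F2 u).
  (* Fullness of whiskering with [F h] provides an isomorphism from [F f0] to [g]; lifting it out of
     [f0] replaces [f0] by an [f] strictly over [g]. *)
  have [c [ec ic]] := equiv_full_iso i_p i_q id.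
  have [f [w [ew iw]]] := opfibration_iso (@op z x) ic.
  exists f, (c_comp (wl h w) u); split.
  + exact: arr_eq_tgt ew.
  + by apply: is_iso_comp => //; exact: wl_iso.
  + rewrite F2_comp.
    have -> : t = c_comp (c_comp t v) (F2 u) by rewrite -c_compA v1 c_comp1r.
    apply: arr_eq_comp; first exact: arr_eq_refl.
    apply: arr_eq_trans (F2_wl _ _) _; apply: arr_eq_trans ed; rewrite -ec.
    exact: wl_arr_eq.
Qed.

Lemma acart_id x : acart (id1 x).
Proof.
have [p ep] : exists p : c_hom (id1 x) (comp1 (id1 x) (id1 x)), arr_eq p (c_id (id1 x)).
  by apply: arr_cast; rewrite ?comp1_1l.
have ip : is_iso p by apply: arr_eq_iso ep (is_iso_id _).
exact: (acart_equiv ip ip).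
Qed.

Lemma cocart_wr_id x y z (i : hom x y) (f f' : hom y z) (a : c_hom f f') :
  is_id i -> cocartesian2 F (wr a i) -> cocartesian2 F a.
Proof.
move=> h; case: y i / h f f' a => f f' a c.
exact: cocartesian_arr_eq (wr_1 _) c.
Qed.

(** Cancels what is left over in [pentagon_1234]: whiskering with an identity disappears by the unit
    law, and [t] is cancelled as a coCartesian arrow. *)
Lemma wr_id_unique x y z (i : hom x y) (j : hom x z) (f k k' : hom y z)
    (t : c_hom j (comp1 f i)) (u : c_hom f k) (v : c_hom f k') :
  is_id i -> cocartesian2 F t -> arr_eq (F2 u) (F2 v) ->
  arr_eq (c_comp (wr u i) t) (c_comp (wr v i) t) -> arr_eq u v.
Proof.
move=> h; case: y i / h f k k' t u v => f k k' t u v ct eF e.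
apply: (cocartesian_unique_het (u := castr (comp1_1r f) t) _ eF).
  by apply: cocartesian_arr_eq ct; apply: arr_eq_sym; exact: castr_eq.
have w m (a : c_hom f m) :
    arr_eq (c_comp a (castr (comp1_1r f) t)) (c_comp (wr a (id1 x)) t).
  by apply: arr_eq_comp; [exact: castr_eq | exact: arr_eq_sym (wr_1 _)].
by apply: arr_eq_trans (w _ u) _; apply: arr_eq_trans e _; exact: arr_eq_sym (w _ v).
Qed.

Section Fill.

Context {x0 x1 x2 x3 : B} {f01 : hom x0 x1} {f02 : hom x0 x2} {f03 : hom x0 x3}
  {f12 : hom x1 x2} {f13 : hom x1 x3} {f23 : hom x2 x3}.

(** The face missing from a 3-dimensional horn. The equation determines it because the whiskered
    [t012] is invertible, and the same cancellation in [C] shows that it lies over [s023]. *)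
Lemma fill_023 (t012 : c_hom f02 (comp1 f12 f01)) (t013 : c_hom f03 (comp1 f13 f01))
    (t123 : c_hom f13 (comp1 f23 f12))
    (s023 : c_hom (F1 F f03) (comp1 (F1 F f23) (F1 F f02))) :
  is_iso t012 -> arr_eq (assocL (Fc t012) s023) (assocR (Fc t013) (Fc t123)) ->
  exists t023, Fc t023 = s023 /\ arr_eq (assocL t012 t023) (assocR t013 t123).
Proof.
move=> it e.
have [t et] := iso_solve (assocR t013 t123) (wl_iso f23 it) (comp1A _ _ _).
exists t; split=> //; apply: arr_eq_eq.
apply: (arr_eq_cancel_iso (arr_eq_refl (wl (F1 F f23) (Fc t012)))).
  by apply: wl_iso; exact: Fc_iso.
by apply: arr_eq_trans (assoc_F et) _; exact: arr_eq_sym.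
Qed.

Lemma fill_013 (t012 : c_hom f02 (comp1 f12 f01)) (t023 : c_hom f03 (comp1 f23 f02))
    (t123 : c_hom f13 (comp1 f23 f12))
    (s013 : c_hom (F1 F f03) (comp1 (F1 F f13) (F1 F f01))) :
  is_iso t123 -> arr_eq (assocL (Fc t012) (Fc t023)) (assocR s013 (Fc t123)) ->
  exists t013, Fc t013 = s013 /\ arr_eq (assocL t012 t023) (assocR t013 t123).
Proof.
move=> it e.
have [t et] := iso_solve (assocL t012 t023) (wr_iso f01 it) (esym (comp1A _ _ _)).
exists t; split; last exact: arr_eq_sym; apply: arr_eq_eq.
apply: (arr_eq_cancel_iso (arr_eq_refl (wr (Fc t123) (F1 F f01)))).
  by apply: wr_iso; exact: Fc_iso.
by apply: arr_eq_trans (arr_eq_sym (assoc_F (arr_eq_sym et))) _.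
Qed.

(** With [f01] an identity, the associativity condition becomes a factorization of
    [assocL t012 t023] through the coCartesian [t013], over a prescribed 2-morphism. *)
Lemma fill_123 (t012 : c_hom f02 (comp1 f12 f01)) (t013 : c_hom f03 (comp1 f13 f01))
    (t023 : c_hom f03 (comp1 f23 f02))
    (s123 : c_hom (F1 F f13) (comp1 (F1 F f23) (F1 F f12))) : is_id f01 -> cocartesian2 F t013 ->
  arr_eq (assocL (Fc t012) (Fc t023)) (assocR (Fc t013) s123) ->
  exists t123, Fc t123 = s123 /\ arr_eq (assocL t012 t023) (assocR t013 t123).
Proof.
move=> h; case: x1 f01 / h f12 f13 t012 t013 s123 => k k' t012 t013 s123 ct e.
pose u := castr (comp1_1r k') t013; have eu : arr_eq u t013 by exact: castr_eq.
have cu : cocartesian2 F u by apply: cocartesian_arr_eq ct; exact: arr_eq_sym.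
have [w ew] : exists w : c_hom (F1 F k') (F1 F (comp1 f23 k)), arr_eq w s123.
  by apply: arr_cast; rewrite ?F1_comp.
have ek : comp1 f23 k = comp1 f23 (comp1 k (id1 x0)) by rewrite comp1_1r.
have [t [et1 et2]] : exists t, F2 t = w /\ arr_eq (c_comp t u) (assocL t012 t023).
  apply: cocartesian_fill => //.
  apply: arr_eq_trans (arr_eq_sym (F2_assocL t012 t023)).
  apply: arr_eq_trans (arr_eq_sym e); apply: arr_eq_comp.
    by apply: arr_eq_trans (arr_eq_sym (FcE _)); exact: F2_arr_eq.
  apply: arr_eq_trans ew _; rewrite F1_id; exact: arr_eq_sym (wr_1 _).
exists t; split; first by apply: Fc_eq; rewrite et1.
apply: arr_eq_trans (arr_eq_sym et2) _; apply: arr_eq_comp => //.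
exact: arr_eq_sym (wr_1 _).
Qed.

(** The unknown occurs whiskered with [f23]: coCartesianness of [t023] solves for the whiskered
    2-morphism, and [acart] for [f23] descends the solution. *)
Lemma fill_012 (t013 : c_hom f03 (comp1 f13 f01)) (t023 : c_hom f03 (comp1 f23 f02))
    (t123 : c_hom f13 (comp1 f23 f12))
    (s012 : c_hom (F1 F f02) (comp1 (F1 F f12) (F1 F f01))) : acart f23 -> cocartesian2 F t023 ->
  arr_eq (assocL s012 (Fc t023)) (assocR (Fc t013) (Fc t123)) ->
  exists t012, Fc t012 = s012 /\ arr_eq (assocL t012 t023) (assocR t013 t123).
Proof.
move=> ah ct e.
have [w ew] : exists w : c_hom (F1 F (comp1 f23 f02)) (F1 F (comp1 f23 (comp1 f12 f01))),
    arr_eq w (wl (F1 F f23) s012) by apply: arr_cast; rewrite !F1_comp.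
have [b [eb1 eb2]] : exists b : c_hom (comp1 f23 f02) (comp1 f23 (comp1 f12 f01)),
    F2 b = w /\ arr_eq (c_comp b t023) (assocR t013 t123).
  apply: cocartesian_fill => //; first exact: comp1A.
  apply: arr_eq_trans (arr_eq_sym (F2_assocR t013 t123)).
  apply: arr_eq_trans e; apply: arr_eq_comp => //; exact: arr_eq_sym (FcE _).
have [a [ea1 ea2]] := acart_fill ah erefl erefl erefl (esym (F1_comp F _ _))
  (eq_ind_r (fun X => arr_eq X _) ew eb1).
exists a; split; first exact: Fc_eq.
by apply: arr_eq_trans eb2; exact: arr_eq_compl.
Qed.

Context (t012 : c_hom f02 (comp1 f12 f01)) (t013 : c_hom f03 (comp1 f13 f01))
  (t023 : c_hom f03 (comp1 f23 f02)) (t123 : c_hom f13 (comp1 f23 f12)).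
Hypothesis as0123 : arr_eq (assocL t012 t023) (assocR t013 t123).

(** In this and the next two lemmas the associativity equation relates the remaining face to
    coCartesian ones, and closure under composition, whiskering and cancellation applies. *)
Lemma lean_023 : is_iso t012 -> cocartesian2 F t013 -> cocartesian2 F t123 ->
  cocartesian2 F t023.
Proof.
move=> i c1 c2; apply: (cocartesian_iso_cancel (wl_iso f23 i)).
apply: cocartesian_arr_eq (arr_eq_sym as0123) _.
by apply: cocartesian_comp => //; exact: cocart_wr.
Qed.

Lemma lean_013 : is_iso t123 -> cocartesian2 F t012 -> cocartesian2 F t023 ->
  cocartesian2 F t013.
Proof.
move=> i c1 c2; apply: (cocartesian_iso_cancel (wr_iso f01 i)).
apply: cocartesian_arr_eq as0123 _.
by apply: cocartesian_comp => //; exact: cocart_wl.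
Qed.

Lemma lean_123 : is_id f01 -> cocartesian2 F t012 -> cocartesian2 F t013 ->
  cocartesian2 F t023 -> cocartesian2 F t123.
Proof.
move=> hid c1 c2 c3.
apply: (cocart_wr_id hid); apply: cocartesian_cancel c2 _.
apply: cocartesian_arr_eq as0123 _.
by apply: cocartesian_comp => //; exact: cocart_wl.
Qed.

(** Cancelling [t023] only shows that the whiskering of [t012] with [f23] is coCartesian. A
    factorization problem for [t012] is therefore whiskered, solved there, and the solution is
    descended by [acart] for [f23]. *)
Lemma lean_012 : acart f23 -> cocartesian2 F t013 -> cocartesian2 F t023 ->
  cocartesian2 F t123 -> cocartesian2 F t012.
Proof.
move=> ah c1 c2 c3.
have c4 : cocartesian2 F (wl f23 t012).
  apply: cocartesian_cancel c2 _; apply: cocartesian_arr_eq (arr_eq_sym as0123) _.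
  by apply: cocartesian_comp => //; exact: cocart_wr.
move=> k v w e.
have [w' ew'] : exists w' : c_hom (F1 F (comp1 f23 (comp1 f12 f01))) (F1 F (comp1 f23 k)),
    arr_eq w' (wl (F1 F f23) w) by apply: arr_cast; rewrite !F1_comp.
have [b [[eb1 eb2] unb]] : exists! b : c_hom (comp1 f23 (comp1 f12 f01)) (comp1 f23 k),
    F2 b = w' /\ c_comp b (wl f23 t012) = wl f23 v.
  apply: c4; apply: arr_eq_eq.
  apply: arr_eq_trans (arr_eq_comp (F2_wl _ _) ew') _.
  by rewrite -wl_comp e; exact: arr_eq_sym (F2_wl _ _).
have [a [[ea1 ea2] una]] := ah.1 _ _ _ _ _ (eq_ind_r (fun X => arr_eq X _) ew' eb1).
have ua : c_comp a t012 = v.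
  apply: arr_eq_eq; apply: (acart_unique ah) => //.
    by rewrite wl_comp ea1 eb2; exact: arr_eq_refl.
  by rewrite F2_comp ea2 e; exact: arr_eq_refl.
exists a; split=> // a' [p1 p2]; apply: una; split=> //; symmetry.
apply: unb; split; last by rewrite -wl_comp p2.
apply: arr_eq_eq; apply: arr_eq_trans (F2_wl _ _) _; apply: arr_eq_sym.
by rewrite /F2 p1.
Qed.

End Fill.

Section Unique.

Context {x0 x1 x2 x3 x4 : B} {f01 : hom x0 x1} {f02 : hom x0 x2}
  {f03 : hom x0 x3} {f04 : hom x0 x4} {f12 : hom x1 x2} {f13 : hom x1 x3}
  {f14 : hom x1 x4} {f23 : hom x2 x3} {f24 : hom x2 x4} {f34 : hom x3 x4}
  (t012 : c_hom f02 (comp1 f12 f01)) (t013 : c_hom f03 (comp1 f13 f01))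
  (t014 : c_hom f04 (comp1 f14 f01)) (t023 : c_hom f03 (comp1 f23 f02))
  (t024 : c_hom f04 (comp1 f24 f02)) (t034 : c_hom f04 (comp1 f34 f03))
  (t123 : c_hom f13 (comp1 f23 f12)) (t124 : c_hom f14 (comp1 f24 f12))
  (t134 : c_hom f14 (comp1 f34 f13)) (t234 : c_hom f24 (comp1 f34 f23)).

Let e0123 := arr_eq (assocL t012 t023) (assocR t013 t123).
Let e0124 := arr_eq (assocL t012 t024) (assocR t014 t124).
Let e0134 := arr_eq (assocL t013 t034) (assocR t014 t134).
Let e0234 := arr_eq (assocL t023 t034) (assocR t024 t234).
Let e1234 := arr_eq (assocL t123 t134) (assocR t124 t234).

(** The images of the two sides agree because the simplex in [C] is complete; this and the residual
    equation of [pentagon_1234] are what the uniqueness of coCartesian factorizations asks for. *)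
Lemma unique_1234 : is_id f01 -> cocartesian2 F t014 ->
  arr_eq (F2 (assocL t123 t134)) (F2 (assocR t124 t234)) ->
  e0123 -> e0124 -> e0134 -> e0234 -> e1234.
Proof.
move=> hid ct eF h1 h2 h3 h4; apply: (wr_id_unique hid ct eF).
exact: pentagon_1234 h1 h2 h3 h4.
Qed.

Lemma unique_0123 : acart f34 -> cocartesian2 F t034 ->
  arr_eq (F2 (assocL t012 t023)) (F2 (assocR t013 t123)) ->
  e0124 -> e0134 -> e0234 -> e1234 -> e0123.
Proof.
move=> ah ct eF h2 h3 h4 h5; apply: (acart_unique ah) => //; first exact: comp1A.
apply: (cocartesian_unique_het ct); last exact: pentagon_0123 h2 h3 h4 h5.
apply: arr_eq_trans (F2_wl _ _) _; apply: arr_eq_trans (arr_eq_sym (F2_wl _ _)).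
exact: wl_arr_eq.
Qed.

End Unique.

End Functor.

(** * Simplices of the Duskin nerve *)

(* o_nk is the vertex k of the n-simplex. *)
Notation o10 := (@Ordinal 2 0 isT) (only parsing).
Notation o11 := (@Ordinal 2 1 isT) (only parsing).
Notation o30 := (@Ordinal 4 0 isT) (only parsing).
Notation o31 := (@Ordinal 4 1 isT) (only parsing).
Notation o32 := (@Ordinal 4 2 isT) (only parsing).
Notation o33 := (@Ordinal 4 3 isT) (only parsing).
Notation o40 := (@Ordinal 5 0 isT) (only parsing).
Notation o41 := (@Ordinal 5 1 isT) (only parsing).
Notation o42 := (@Ordinal 5 2 isT) (only parsing).
Notation o43 := (@Ordinal 5 3 isT) (only parsing).
Notation o44 := (@Ordinal 5 4 isT) (only parsing).

Tactic Notation "irr" constr(h) := rewrite (bool_irrelevance h isT).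

(** Replacing the bound proof by [isT] makes each vertex literally the one of the notations, so that
    dependent data indexed by it typechecks. *)
Lemma ord2_ind (P : 'I_2 -> Prop) : P o10 -> P o11 -> forall i, P i.
Proof.
by move=> h0 h1 [[|[|//]] hi]; irr hi.
Qed.

Lemma ord3_ind (P : 'I_3 -> Prop) : P o20 -> P o21 -> P o22 -> forall i, P i.
Proof.
by move=> h0 h1 h2 [[|[|[|//]]] hi]; irr hi.
Qed.

Lemma ord4_ind (P : 'I_4 -> Prop) :
  P o30 -> P o31 -> P o32 -> P o33 -> forall i, P i.
Proof.
by move=> h0 h1 h2 h3 [[|[|[|[|//]]]] hi]; irr hi.
Qed.

Lemma ord5_ind (P : 'I_5 -> Prop) :
  P o40 -> P o41 -> P o42 -> P o43 -> P o44 ->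
  forall i, P i.
Proof.
by move=> h0 h1 h2 h3 h4 [[|[|[|[|[|//]]]]] hi]; irr hi.
Qed.

Definition pt {n} (i : 'I_n.+1) : mono 0 n := @Mono 0 n (fun _ => i) (fun _ _ _ => leqnn i).

Section Monos.

Context {n : nat}.
Implicit Types i j k l : 'I_n.+1.

Definition edg_fun i j (a : 'I_2) : 'I_n.+1 := if val a is 0 then i else j.

Definition tri_fun i j k (a : 'I_3) : 'I_n.+1 :=
  match val a with 0 => i | 1 => j | _ => k end.

Definition quad_fun i j k l (a : 'I_4) : 'I_n.+1 :=
  match val a with 0 => i | 1 => j | 2 => k | _ => l end.

Lemma edg_mono i j (ij : i <= j) (a b : 'I_2) : a <= b ->
  edg_fun i j a <= edg_fun i j b.
Proof. by elim/ord2_ind: a; elim/ord2_ind: b. Qed.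

Definition edg i j (ij : i <= j) : mono 1 n := Mono (edg_mono ij).

Lemma tri_mono i j k (ij : i <= j) (jk : j <= k) (a b : 'I_3) : a <= b ->
  tri_fun i j k a <= tri_fun i j k b.
Proof.
by have ik := leq_trans ij jk; elim/ord3_ind: a; elim/ord3_ind: b.
Qed.

Definition tri i j k (ij : i <= j) (jk : j <= k) : mono 2 n := Mono (tri_mono ij jk).

Lemma quad_mono i j k l (ij : i <= j) (jk : j <= k) (kl : k <= l) (a b : 'I_4) : a <= b ->
  quad_fun i j k l a <= quad_fun i j k l b.
Proof.
have ik := leq_trans ij jk; have jl := leq_trans jk kl; have il := leq_trans ik kl.
by elim/ord4_ind: a; elim/ord4_ind: b.
Qed.

Definition quad i j k l (ij : i <= j) (jk : j <= k) (kl : k <= l) : mono 3 n :=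
  Mono (quad_mono ij jk kl).

End Monos.

Lemma comp_tri n m (x : mono n m) (i j k : 'I_n.+1) (ij : i <= j) (jk : j <= k) :
  mono_comp x (tri ij jk) = tri (moP x ij) (moP x jk).
Proof. by apply: mono_ext; elim/ord3_ind. Qed.

Lemma comp_quad n m (x : mono n m) (i j k l : 'I_n.+1) (ij : i <= j) (jk : j <= k) (kl : k <= l) :
  mono_comp x (quad ij jk kl) = quad (moP x ij) (moP x jk) (moP x kl).
Proof. by apply: mono_ext; elim/ord4_ind. Qed.

Notation tri3 a b c := (@tri _ a b c isT isT) (only parsing).
Notation de2 s a b := (@de _ _ s a b isT) (only parsing).
Notation dt3 s a b c := (@dt _ _ s a b c isT isT isT) (only parsing).

Section HetEq.

Context {B : two_cat}.

(* Equality of 1-morphisms, and of the 2-morphisms filling a triangle, whose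
   boundaries are only propositionally equal. *)
Inductive hom_eq {x y : B} (f : hom x y) : forall x' y' : B, hom x' y' -> Prop :=
  hom_eq_refl : hom_eq f f.

Inductive tri_eq {x y z : B} {f : hom x y} {g : hom y z} {h : hom x z}
    (t : c_hom h (comp1 g f)) :
  forall (x' y' z' : B) (f' : hom x' y') (g' : hom y' z') (h' : hom x' z'),
    c_hom h' (comp1 g' f') -> Prop :=
  tri_eq_refl : tri_eq t t.

Lemma hom_eq_sym (x y x' y' : B) (f : hom x y) (f' : hom x' y') :
  hom_eq f f' -> hom_eq f' f.
Proof. by case: x' y' f' /; exact: hom_eq_refl. Qed.

Lemma hom_eq_trans (x y x' y' x'' y'' : B) (f : hom x y) (f' : hom x' y')
    (f'' : hom x'' y'') : hom_eq f f' -> hom_eq f' f'' -> hom_eq f f''.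
Proof. by move=> h; case: x' y' f' / h. Qed.

(** Packing a 1-morphism with its endpoints turns the heterogeneous equality into an equality of
    pairs, from which uniqueness of identity proofs extracts the component. *)
Lemma hom_eq_eq (x y : B) (f f' : hom x y) : hom_eq f f' -> f = f'.
Proof.
pose tot (x y : B) (k : hom x y) := existT (fun a => {b & c_ob (hom a b)}) x
  (existT (fun b => c_ob (hom x b)) y k).
have h x' y' (k : hom x' y') : hom_eq f k -> tot x y f = tot x' y' k by case.
by move=> e; exact: (inj_pair2 _ _ _ _ _ (inj_pair2 _ _ _ _ _ (h _ _ _ e))).
Qed.

Lemma eq_hom_eq (x y : B) (f f' : hom x y) : f = f' -> hom_eq f f'.
Proof. by move=> ->; exact: hom_eq_refl. Qed.

Lemma hom_eq_src (x y x' y' : B) (f : hom x y) (f' : hom x' y') : hom_eq f f' -> x = x'.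
Proof. by case: x' y' f' /. Qed.

Lemma hom_eq_tgt (x y x' y' : B) (f : hom x y) (f' : hom x' y') : hom_eq f f' -> y = y'.
Proof. by case: x' y' f' /. Qed.

Lemma hom_transport (x y x' y' : B) (f : hom x y) : x = x' -> y = y' ->
  exists f' : hom x' y', hom_eq f' f.
Proof. by move=> <- <-; exists f; exact: hom_eq_refl. Qed.

Section Tri.

Context {x y z x' y' z' x'' y'' z'' : B} {f : hom x y} {g : hom y z} {h : hom x z}
  {f' : hom x' y'} {g' : hom y' z'} {h' : hom x' z'}
  {f'' : hom x'' y''} {g'' : hom y'' z''} {h'' : hom x'' z''}
  {t : c_hom h (comp1 g f)} {t' : c_hom h' (comp1 g' f')}
  {t'' : c_hom h'' (comp1 g'' f'')}.

Lemma tri_eq_sym : tri_eq t t' -> tri_eq t' t.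
Proof. by case; exact: tri_eq_refl. Qed.

Lemma tri_eq_trans : tri_eq t t' -> tri_eq t' t'' -> tri_eq t t''.
Proof. by move=> e; case: _ _ _ _ _ _ _ / e. Qed.

Lemma tri_eq_iso : tri_eq t t' -> is_iso t -> is_iso t'.
Proof. by case. Qed.

Lemma tri_eq_01 : tri_eq t t' -> hom_eq f f'.
Proof. by case; exact: hom_eq_refl. Qed.

Lemma tri_eq_12 : tri_eq t t' -> hom_eq g g'.
Proof. by case; exact: hom_eq_refl. Qed.

Lemma tri_eq_02 : tri_eq t t' -> hom_eq h h'.
Proof. by case; exact: hom_eq_refl. Qed.

Lemma tri_transport : hom_eq f f' -> hom_eq g g' -> hom_eq h h' ->
  exists s : c_hom h' (comp1 g' f'), tri_eq s t.
Proof.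
move=> h1 h2 h3.
have e1 := hom_eq_src h1; have e2 := hom_eq_tgt h1; have e3 := hom_eq_tgt h2.
clear t' t''; subst x' y' z'.
have e1 := hom_eq_eq h1; have e2 := hom_eq_eq h2; have e3 := hom_eq_eq h3.
by clear h1 h2 h3; subst f' g' h'; exists t; exact: tri_eq_refl.
Qed.

End Tri.

Let tot := {x : B & {y : B & {z : B & {f : hom x y & {g : hom y z & {h : hom x z &
  c_hom h (comp1 g f)}}}}}}.

Let mktot x y z (f : hom x y) (g : hom y z) (h : hom x z) (t : c_hom h (comp1 g f)) : tot :=
  existT _ x (existT _ y (existT _ z (existT _ f (existT _ g (existT _ h t))))).

Lemma tri_eq_eq (x y z : B) (f : hom x y) (g : hom y z) (h : hom x z)
    (t t' : c_hom h (comp1 g f)) : tri_eq t t' -> t = t'.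
Proof.
have H x' y' z' (f' : hom x' y') (g' : hom y' z') (h' : hom x' z')
  (s : c_hom h' (comp1 g' f')) : tri_eq t s -> mktot t = mktot s by case.
move=> e; have := H _ _ _ _ _ _ _ e; rewrite /mktot => {}e.
by do 6! (apply inj_pair2 in e).
Qed.

Lemma arr_tri_eq (x y z : B) (f : hom x y) (g : hom y z) (h : hom x z)
    (t t' : c_hom h (comp1 g f)) : arr_eq t t' -> tri_eq t t'.
Proof. by move=> /arr_eq_eq ->; exact: tri_eq_refl. Qed.

Lemma de_eq n (s s' : duskin B n) (i j i' j' : 'I_n.+1) (ij : i <= j) (ij' : i' <= j') :
  s = s' -> i = i' -> j = j' -> hom_eq (de s ij) (de s' ij').
Proof.
move=> <- ei ej; subst i' j'; rewrite (bool_irrelevance ij' ij); exact: hom_eq_refl.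
Qed.

Lemma dt_eq n (s s' : duskin B n) (i j k i' j' k' : 'I_n.+1) (ij : i <= j) (jk : j <= k)
    (ik : i <= k) (ij' : i' <= j') (jk' : j' <= k') (ik' : i' <= k') :
  s = s' -> i = i' -> j = j' -> k = k' -> tri_eq (dt s ij jk ik) (dt s' ij' jk' ik').
Proof.
move=> <- ei ej ek; subst i' j' k'.
rewrite (bool_irrelevance ij' ij) (bool_irrelevance jk' jk) (bool_irrelevance ik' ik).
exact: tri_eq_refl.
Qed.

Lemma duskin_ext n (s s' : duskin B n) :
  (forall x : mono 2 n, duskin_act x s = duskin_act x s') -> s = s'.
Proof.
case: s s' => [v e t a1 a2 a3 a4] [v' e' t' b1 b2 b3 b4] H.
(* Vertices and edges are read off the degenerate triangles [iii] and [ijj]. *)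
have ev : v = v'.
  fext i.
  exact: (congr1 (fun d => dv d o20) (H (tri (leqnn i) (leqnn i)))).
subst v'.
have ee : e = e'.
  fext i; fext j.
  fext ij; apply: hom_eq_eq.
  pose q : i <= j := @moP _ _ (tri ij (leqnn j)) o20 o21 isT.
  rewrite (bool_irrelevance ij q).
  exact: (@de_eq 2 _ _ o20 o21 o20 o21 isT isT (H (tri ij (leqnn j))) erefl erefl).
subst e'.
have et : t = t'.
  fext i; fext j.
  fext k.
  fext ij; fext jk.
  fext ik; apply: tri_eq_eq.
  pose q1 : i <= j := @moP _ _ (tri ij jk) o20 o21 isT.
  pose q2 : j <= k := @moP _ _ (tri ij jk) o21 o22 isT.
  pose q3 : i <= k := @moP _ _ (tri ij jk) o20 o22 isT.
  rewrite (bool_irrelevance ij q1) (bool_irrelevance jk q2) (bool_irrelevance ik q3).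
  exact: (@dt_eq 2 _ _ o20 o21 o22 o20 o21 o22 isT isT isT isT isT isT (H (tri ij jk))
    erefl erefl erefl).
subst t'; congr Duskin; exact: proof_irrelevance.
Qed.

(** The unit conditions force the values at repeated vertices. *)
Lemma duskin_strict_ext n (v : 'I_n.+1 -> B)
    (e e' : forall i j : 'I_n.+1, i <= j -> hom (v i) (v j)) t t' a1 a2 a3 a4 b1 b2 b3 b4 :
  (forall (i j : 'I_n.+1) (ij : i <= j), i < j -> e i j ij = e' i j ij) ->
  (forall (i j k : 'I_n.+1) (ij : i <= j) (jk : j <= k) (ik : i <= k), i < j -> j < k ->
    tri_eq (t i j k ij jk ik) (t' i j k ij jk ik)) ->
  @Duskin B n v e t a1 a2 a3 a4 = @Duskin B n v e' t' b1 b2 b3 b4.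
Proof.
move=> he ht; have ee : e = e'.
  fext i; fext j.
  fext ij.
  have [eij|nij] := eqVneq i j; first by subst j; rewrite a1 b1.
  by apply: he; rewrite ltn_neqAle nij.
subst e'; have et : t = t'.
  fext i; fext j.
  fext k.
  fext ij; fext jk.
  fext ik.
  have [eij|nij] := eqVneq i j.
    subst j; apply: arr_eq_eq; apply: arr_eq_trans (a2 _ _ _ _ _) _.
    exact: arr_eq_sym (b2 _ _ _ _ _).
  have [ejk|njk] := eqVneq j k.
    subst k; apply: arr_eq_eq; apply: arr_eq_trans (a3 _ _ _ _ _) _.
    exact: arr_eq_sym (b3 _ _ _ _ _).
  by apply: tri_eq_eq; apply: ht; rewrite ltn_neqAle ?nij ?njk.
by subst t'; congr Duskin; exact: proof_irrelevance.
Qed.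

Lemma duskin2_ext (s s' : duskin B 2) :
  tri_eq (dt3 s o20 o21 o22) (dt3 s' o20 o21 o22) ->
  s = s'.
Proof.
case: s s' => [v e t a1 a2 a3 a4] [v' e' t' b1 b2 b3 b4] /= H.
have ev : v = v'.
  apply: functional_extensionality_dep; elim/ord3_ind.
  - exact: hom_eq_src (tri_eq_01 H).
  - exact: hom_eq_tgt (tri_eq_01 H).
  - exact: hom_eq_tgt (tri_eq_12 H).
subst v'; apply: duskin_strict_ext => [i j ij|i j k ij jk ik].
  elim/ord3_ind: i ij; elim/ord3_ind: j => // ij _;
    irr ij; apply: hom_eq_eq.
  - exact: tri_eq_01 H.
  - exact: tri_eq_02 H.
  - exact: tri_eq_12 H.
elim/ord3_ind: i ij ik; elim/ord3_ind: j jk => //; elim/ord3_ind: k => // jk ij ik _ _.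
by irr ij; irr jk; irr ik.
Qed.

Lemma duskin1_ext (s s' : duskin B 1) :
  hom_eq (de2 s o10 o11) (de2 s' o10 o11) ->
  s = s'.
Proof.
case: s s' => [v e t a1 a2 a3 a4] [v' e' t' b1 b2 b3 b4] /= H.
have ev : v = v'.
  apply: functional_extensionality_dep; elim/ord2_ind; [exact: hom_eq_src H | exact: hom_eq_tgt H].
subst v'; apply: duskin_strict_ext => [i j ij|i j k ij jk ik].
  elim/ord2_ind: i ij; elim/ord2_ind: j => // ij _; irr ij.
  exact: hom_eq_eq.
by elim/ord2_ind: i ij ik; elim/ord2_ind: j jk => //; elim/ord2_ind: k.
Qed.

Lemma duskin0_ext (s s' : duskin B 0) : dv s ord0 = dv s' ord0 -> s = s'.
Proof.
case: s s' => [v e t a1 a2 a3 a4] [v' e' t' b1 b2 b3 b4] /= h.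
have ev : v = v' by fext i; rewrite ord1.
subst v'; apply: duskin_strict_ext => [i j ij|i j k ij jk ik] lij;
  by have := ltn_ord j; rewrite ltnS leqNgt (leq_ltn_trans (leq0n i) lij).
Qed.

End HetEq.

(** * Maps from subcomplexes of a simplex to the nerve *)

(** Vertices and edges are total, because a horn of dimension at least 3 contains all edges: its
    lifting problems concern 2-morphisms alone. *)
Record skel (B : two_cat) (n : nat) := Skel {
  sv :> 'I_n.+1 -> B;
  se : forall i j : 'I_n.+1, i <= j -> hom (sv i) (sv j);
  se_id : forall (i : 'I_n.+1) (ii : i <= i), se ii = id1 (sv i) }.

Arguments se {B n} s {i j} ij : rename.

Definition subpred (n : nat) := forall m, simplex n m -> bool.

(** Bundles the index of a triangle so that [dep_choice] can choose all 2-morphisms at once. *)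
Record triple n (P : subpred n) := Triple {
  t_i : 'I_n.+1; t_j : 'I_n.+1; t_k : 'I_n.+1;
  t_ij : t_i <= t_j; t_jk : t_j <= t_k; t_ik : t_i <= t_k;
  t_in : P 2 (tri t_ij t_jk) }.

(** Associativity is kept apart, in [cells_assoc], so that a missing triangle can be added before it
    is checked. *)
Record cells (B : two_cat) n (S : skel B n) (P : subpred n) := Cells {
  ct : forall (i j k : 'I_n.+1) (ij : i <= j) (jk : j <= k) (ik : i <= k),
    P 2 (tri ij jk) -> c_hom (se S ik) (comp1 (se S jk) (se S ij));
  ct_idl : forall (i j : 'I_n.+1) (ii : i <= i) (ij ij' : i <= j) q,
    arr_eq (@ct i i j ii ij ij' q) (c_id (se S ij));
  ct_idr : forall (i j : 'I_n.+1) (ij ij' : i <= j) (jj : j <= j) q,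
    arr_eq (@ct i j j ij jj ij' q) (c_id (se S ij)) }.

Arguments ct {B n S P} c {i j k} ij jk ik q : rename.

Notation ct3 T a b c := (@ct _ _ _ _ T a b c isT isT isT) (only parsing).

Lemma ct_irr (B : two_cat) n (S : skel B n) (P : subpred n) (T : cells S P)
    (i j k : 'I_n.+1) (ij : i <= j) (jk : j <= k) (ik : i <= k) q q' :
  ct T ij jk ik q = ct T ij jk ik q'.
Proof. by rewrite (bool_irrelevance q q'). Qed.

Definition cells_assoc (B : two_cat) n (S : skel B n) (P : subpred n) (T : cells S P) :=
  forall (i j k l : 'I_n.+1) (ij : i <= j) (jk : j <= k) (kl : k <= l)
    (ik : i <= k) (jl : j <= l) (il : i <= l) q1 q2 q3 q4,
  P 3 (quad ij jk kl) ->
  arr_eq (assocL (ct T ij jk ik q1) (ct T ik kl il q2))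
         (assocR (ct T ij jl il q3) (ct T jk kl jl q4)).

Lemma se_irr (B : two_cat) n (S : skel B n) (i j : 'I_n.+1) (ij ij' : i <= j) :
  se S ij = se S ij'.
Proof. by rewrite (bool_irrelevance ij ij'). Qed.

Definition predT_sub n : subpred n := fun _ _ => true.

Section Restriction.

Context {n : nat} {P : subpred n} (hP : sub_closed P).

Lemma in_tri m (x : sub_sset hP m) (i j k : 'I_m.+1) (ij : i <= j) (jk : j <= k) :
  P (tri (moP (val x : mono m n) ij) (moP (val x : mono m n) jk)).
Proof. by have := hP (tri ij jk) (valP x); rewrite /= comp_tri. Qed.

Lemma in_quad m (x : sub_sset hP m) (i j k l : 'I_m.+1) (ij : i <= j) (jk : j <= k)
    (kl : k <= l) :
  P (quad (moP (val x : mono m n) ij) (moP (val x : mono m n) jk)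
          (moP (val x : mono m n) kl)).
Proof. by have := hP (quad ij jk kl) (valP x); rewrite /= comp_quad. Qed.

Context {B : two_cat} {S : skel B n} (T : cells S P) (AT : cells_assoc T).

Definition cells_fun m (x : sub_sset hP m) : duskin B m.
Proof.
pose y : mono m n := val x.
refine (@Duskin B m (fun i => S (y i)) (fun i j ij => se S (moP y ij))
  (fun i j k ij jk ik => ct T (moP y ij) (moP y jk) (moP y ik) (in_tri x ij jk))
  (fun i ii => se_id S (moP y ii))
  (fun i j ii ij ij' => ct_idl T _ _)
  (fun i j ij ij' jj => ct_idr T _ _)
  _).
move=> i j k l ij jk kl ik jl il; apply: AT; exact: in_quad.
Defined.

Lemma duskin_eq (X : two_cat) m (v : 'I_m.+1 -> X)
    (e : forall i j : 'I_m.+1, i <= j -> hom (v i) (v j))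
    (t t' : forall (i j k : 'I_m.+1) (ij : i <= j) (jk : j <= k) (ik : i <= k),
      c_hom (e i k ik) (comp1 (e j k jk) (e i j ij))) a1 a2 a3 a4 b1 b2 b3 b4 :
  (forall (i j k : 'I_m.+1) (ij : i <= j) (jk : j <= k) (ik : i <= k),
    t i j k ij jk ik = t' i j k ij jk ik) ->
  @Duskin X m v e t a1 a2 a3 a4 = @Duskin X m v e t' b1 b2 b3 b4.
Proof.
move=> h.
have et : t = t' by do 6! apply: functional_extensionality_dep => ?; exact: h.
by subst t'; congr Duskin; exact: proof_irrelevance.
Qed.

Lemma cells_fun_nat m k (a : mono m k) (x : sub_sset hP k) :
  cells_fun (act a x) = act a (cells_fun x : nerve B k) :> nerve B m.
Proof.
by apply: duskin_eq => i j l ij jl il /=; exact: ct_irr.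
Qed.

Definition cells_map : smap (sub_sset hP) (nerve B) := SMap cells_fun_nat.

End Restriction.

Section Full.

Context {B : two_cat} {n : nat} {S : skel B n} (T : cells S (@predT_sub n))
  (AT : cells_assoc T).

Definition cells_simplex : duskin B n.
Proof.
refine (@Duskin B n S (@se _ _ S) (fun i j k ij jk ik => ct T ij jk ik isT)
  (@se_id _ _ S) (fun i j ii ij ij' => ct_idl T _ _)
  (fun i j ij ij' jj => ct_idr T _ _) _).
by move=> i j k l ij jk kl ik jl il; exact: AT.
Defined.

End Full.

Lemma comp_het_idl (C : cat) (a b c x : C) (w : c_hom b c) (t : c_hom a b) :
  arr_eq w (c_id x) -> arr_eq (c_comp w t) t.
Proof.
move=> h; have [e _] := arr_eqP h; subst x.
by rewrite -[X in arr_eq _ X]c_comp1l; exact: arr_eq_compl.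
Qed.

Lemma comp_het_idr (C : cat) (a b c x : C) (w : c_hom b c) (t : c_hom a b) :
  arr_eq t (c_id x) -> arr_eq (c_comp w t) w.
Proof.
move=> h; have e := arr_eq_tgt h; subst x.
rewrite -[X in arr_eq _ X]c_comp1r; apply: arr_eq_comp h _; exact: arr_eq_refl.
Qed.

(** At a repeated vertex one triangle on each side is a unit, and both sides reduce to the same
    remaining 2-morphism; so only strictly increasing quadruples have to be checked. *)
Lemma cells_assoc_degenerate (B : two_cat) n (S : skel B n) P (T : cells S P)
    (i j k l : 'I_n.+1) (ij : i <= j) (jk : j <= k) (kl : k <= l)
    (ik : i <= k) (jl : j <= l) (il : i <= l) q1 q2 q3 q4 :
  [|| i == j, j == k | k == l] ->
  arr_eq (assocL (ct T ij jk ik q1) (ct T ik kl il q2))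
         (assocR (ct T ij jl il q3) (ct T jk kl jl q4)).
Proof.
rewrite /assocL /assocR; case/or3P => /eqP e.
- subst j; rewrite (bool_irrelevance jk ik) (bool_irrelevance jl il) in q1 q2 q3 q4 *.
  apply: (arr_eq_trans (u' := ct T ik kl il q2)).
    apply: (comp_het_idl (x := comp1 (se S kl) (se S ik))); rewrite -wl_id.
    by apply: wl_arr_eq => //; exact: ct_idl.
  apply: arr_eq_sym; apply: arr_eq_trans (comp_het_idr _ (ct_idl _ _ _)) _.
  rewrite se_id (bool_irrelevance q4 q2); exact: wr_1.
- subst k; rewrite (bool_irrelevance ik ij) (bool_irrelevance kl jl) in q1 q2 q3 q4 *.
  apply: (arr_eq_trans (u' := ct T ij jl il q2)).
    apply: (comp_het_idl (x := comp1 (se S jl) (se S ij))); rewrite -wl_id.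
    by apply: wl_arr_eq => //; exact: ct_idr.
  rewrite (bool_irrelevance q3 q2); apply: arr_eq_sym.
  apply: (comp_het_idl (x := comp1 (se S jl) (se S ij))); rewrite -wr_id.
  by apply: wr_arr_eq => //; exact: ct_idl.
- subst l; rewrite (bool_irrelevance il ik) (bool_irrelevance jl jk) in q1 q2 q3 q4 *.
  apply: (arr_eq_trans (u' := ct T ij jk ik q1)).
    apply: arr_eq_trans (comp_het_idr _ (ct_idr _ _ _)) _.
    rewrite se_id; exact: wl_1.
  rewrite (bool_irrelevance q3 q1); apply: arr_eq_sym.
  apply: (comp_het_idl (x := comp1 (se S jk) (se S ij))); rewrite -wr_id.
  by apply: wr_arr_eq => //; exact: ct_idr.
Qed.

Lemma tri_eq_id (B : two_cat) (x y z x' y' z' : B) (f : hom x y) (g : hom y z)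
    (h : hom x z) (f' : hom x' y') (g' : hom y' z') (h' : hom x' z')
    (t : c_hom h (comp1 g f)) (t' : c_hom h' (comp1 g' f')) :
  tri_eq t t' -> arr_eq t' (c_id h') -> arr_eq t (c_id h).
Proof. by case. Qed.

Lemma assoc_tri_eq (B : two_cat) (x0 x1 x2 x3 y0 y1 y2 y3 : B)
    (f01 : hom x0 x1) (f02 : hom x0 x2) (f03 : hom x0 x3) (f12 : hom x1 x2)
    (f13 : hom x1 x3) (f23 : hom x2 x3)
    (g01 : hom y0 y1) (g02 : hom y0 y2) (g03 : hom y0 y3) (g12 : hom y1 y2)
    (g13 : hom y1 y3) (g23 : hom y2 y3)
    (t012 : c_hom f02 (comp1 f12 f01)) (t013 : c_hom f03 (comp1 f13 f01))
    (t023 : c_hom f03 (comp1 f23 f02)) (t123 : c_hom f13 (comp1 f23 f12))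
    (s012 : c_hom g02 (comp1 g12 g01)) (s013 : c_hom g03 (comp1 g13 g01))
    (s023 : c_hom g03 (comp1 g23 g02)) (s123 : c_hom g13 (comp1 g23 g12)) :
  tri_eq t012 s012 -> tri_eq t013 s013 -> tri_eq t023 s023 -> tri_eq t123 s123 ->
  arr_eq (assocL s012 s023) (assocR s013 s123) ->
  arr_eq (assocL t012 t023) (assocR t013 t123).
Proof.
move=> e1 e2 e3 e4.
have h01 := tri_eq_01 e1; have h12 := tri_eq_12 e1; have h02 := tri_eq_02 e1.
have h13 := tri_eq_12 e2; have h03 := tri_eq_02 e2; have h23 := tri_eq_12 e3.
have v0 := hom_eq_src h01; have v1 := hom_eq_tgt h01; have v2 := hom_eq_tgt h02.
have v3 := hom_eq_tgt h03; subst y0 y1 y2 y3.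
have k01 := hom_eq_eq h01; have k12 := hom_eq_eq h12; have k02 := hom_eq_eq h02.
have k13 := hom_eq_eq h13; have k03 := hom_eq_eq h03; have k23 := hom_eq_eq h23.
clear h01 h12 h02 h13 h03 h23; subst g01 g12 g02 g13 g03 g23.
by rewrite (tri_eq_eq e1) (tri_eq_eq e2) (tri_eq_eq e3) (tri_eq_eq e4).
Qed.

Section Present.

Context {B : two_cat} {n : nat} {P : subpred n} (hP : sub_closed P).
Hypothesis P1 : forall (i j : 'I_n.+1) (ij : i <= j), P (edg ij).
Context (f : smap (sub_sset hP) (nerve B)).

Lemma P_pt i : P (pt i).
Proof.
have := hP (pt o10) (P1 (leqnn i)); congr (is_true (P _)).
exact: mono_ext.
Qed.

Let vtx (i : 'I_n.+1) : B := dv (f 0 (exist _ (pt i) (P_pt i))) ord0.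

Lemma present_vtx m (x : sub_sset hP m) (a : 'I_m.+1) :
  dv (f m x) a = vtx ((val x : mono m n) a).
Proof.
have e : act (pt a) x = exist _ (pt ((val x : mono m n) a)) (P_pt _) :> sub_sset hP 0.
  by apply: val_inj; apply: mono_ext.
by rewrite /vtx -e (sm_act f).
Qed.

Lemma present_edge : exists e : forall ij : {ij : 'I_n.+1 * 'I_n.+1 | ij.1 <= ij.2},
    hom (vtx (sval ij).1) (vtx (sval ij).2),
  forall ij, hom_eq (e ij) (@de _ _ (f 1 (exist _ (edg (svalP ij)) (P1 (svalP ij))))
    o10 o11 isT).
Proof.
apply: (@dep_choice _ _ (fun (ij : {ij : 'I_n.+1 * 'I_n.+1 | ij.1 <= ij.2}) e =>
  hom_eq e (@de _ _ (f 1 (exist _ (edg (svalP ij)) (P1 (svalP ij))))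
    o10 o11 isT))) => -[[i j] /= ij]; apply: hom_transport; exact: present_vtx.
Qed.

Lemma present_skel : exists S : skel B n,
  (forall i, S i = vtx i) /\ forall m (x : sub_sset hP m) (a b : 'I_m.+1) (ab : a <= b),
    hom_eq (se S (moP (val x : mono m n) ab)) (de (f m x) ab).
Proof.
have [e he] := present_edge.
pose e' (i j : 'I_n.+1) (ij : i <= j) : hom (vtx i) (vtx j) := e (exist _ (i, j) ij).
have he' m (x : sub_sset hP m) (a b : 'I_m.+1) (ab : a <= b) :
    hom_eq (e' _ _ (moP (val x : mono m n) ab)) (de (f m x) ab).
  apply: hom_eq_trans (he (exist _ (_, _) (moP (val x : mono m n) ab))) _ => /=.
  have ex : exist _ (edg (moP (val x : mono m n) ab)) (P1 _) = act (edg ab) x :> sub_sset hP 1.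
    by apply: val_inj; apply: mono_ext; elim/ord2_ind.
  rewrite /=; apply: (hom_eq_trans (f' := @de _ _ (act (edg ab) (f m x) : nerve B 1) o10 o11 isT)).
    apply: de_eq => //; rewrite -(sm_act f) -ex; congr (f 1 _); apply: val_inj.
    by apply: mono_ext; elim/ord2_ind.
  by rewrite /=; exact: (de_eq _ _ (erefl (f m x))).
have ide i ii : e' i i ii = id1 (vtx i).
  apply: hom_eq_eq.
  have := he' 0 (exist _ (pt i) (P_pt i)) ord0 ord0 isT.
  rewrite de_id /= => h.
  by rewrite (bool_irrelevance ii (@moP _ _ (pt i) ord0 ord0 isT)).
by exists (Skel ide); split.
Qed.

(** The values of [f] on simplices with a common face agree on it only propositionally. Transported
    copies of the edges and triangles are chosen with literally shared boundaries, and associativity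
    is inherited from the values of [f] on 3-simplices. *)
Lemma present : exists (S : skel B n) (T : cells S (@P)) (AT : cells_assoc T),
  smap_eq f (cells_map hP AT).
Proof.
have [S [Sv Se]] := present_skel.
pose xt (u : triple (@P)) : sub_sset hP 2 := exist _ (tri (t_ij u) (t_jk u)) (t_in u).
have [t ht] : exists t : forall u : triple (@P),
    c_hom (se S (t_ik u)) (comp1 (se S (t_jk u)) (se S (t_ij u))),
    forall u, tri_eq (t u) (@dt _ _ (f 2 (xt u)) o20 o21 o22 isT isT isT).
  apply: (@dep_choice _ _ (fun (u : triple (@P)) t => tri_eq t
    (@dt _ _ (f 2 (xt u)) o20 o21 o22 isT isT isT))) => -[i j k ij jk ik /= q].
  apply: tri_transport; apply: hom_eq_sym;
    apply: hom_eq_trans _ (Se 2 (exist _ (tri ij jk) q) _ _ _) => /=;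
    exact: eq_hom_eq (se_irr _ _ _).
pose t' i j k ij jk ik q := t (@Triple n (@P) i j k ij jk ik q).
have ht' m (x : sub_sset hP m) (a b c : 'I_m.+1) (ab : a <= b) (bc : b <= c)
    (ac : a <= c) ij jk ik q :
    tri_eq (t' ((val x : mono m n) a) ((val x : mono m n) b) ((val x : mono m n) c) ij jk ik q)
      (dt (f m x) ab bc ac).
  apply: tri_eq_trans (ht _) _ => /=.
  apply: (tri_eq_trans
    (t' := @dt _ _ (act (tri ab bc) (f m x) : nerve B 2) o20 o21 o22 isT isT isT)).
    apply: dt_eq => //; rewrite -(sm_act f); congr (f 2 _); apply: val_inj.
    by apply: mono_ext; elim/ord3_ind.
  exact: (dt_eq _ _ _ _ _ _ (erefl (f m x))).
have idl (i j : 'I_n.+1) (ii : i <= i) (ij ij' : i <= j) q :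
    arr_eq (t' i i j ii ij ij' q) (c_id (se S ij)).
  rewrite (bool_irrelevance ij' ij) in q *.
  have h := ht' 1 (exist _ (edg ij) (P1 ij)) o10 o10 o11 isT isT isT ii ij ij q.
  apply: (tri_eq_id h).
  exact: dt_idl.
have idr (i j : 'I_n.+1) (ij ij' : i <= j) (jj : j <= j) q :
    arr_eq (t' i j j ij jj ij' q) (c_id (se S ij)).
  rewrite (bool_irrelevance ij' ij) in q *.
  apply: (tri_eq_id (ht' 1 (exist _ (edg ij) (P1 ij)) o10 o11 o11 isT isT isT ij jj ij q)).
  exact: dt_idr.
have assoc : cells_assoc (@Cells _ _ S (@P) t' idl idr).
  move=> i j k l ij jk kl ik jl il q1 q2 q3 q4 q.
  pose x : sub_sset hP 3 := exist _ (quad ij jk kl) q.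
  apply: (assoc_tri_eq (ht' 3 x o30 o31 o32 isT isT isT ij jk ik q1)
    (ht' 3 x o30 o31 o33 isT isT isT ij jl il q3)
    (ht' 3 x o30 o32 o33 isT isT isT ik kl il q2)
    (ht' 3 x o31 o32 o33 isT isT isT jk kl jl q4)).
  exact: dtA.
exists S, (Cells idl idr), assoc => m x; apply: duskin_ext => y.
apply: duskin2_ext; apply: tri_eq_sym => /=; exact: ht'.
Qed.

End Present.

Lemma ct_eq (B : two_cat) n (S : skel B n) (P : subpred n) (T : cells S P)
    (i j k : 'I_n.+1) (ij ij' : i <= j) (jk jk' : j <= k) (ik ik' : i <= k) q q' :
  tri_eq (ct T ij jk ik q) (ct T ij' jk' ik' q').
Proof.
rewrite (bool_irrelevance ij' ij) (bool_irrelevance jk' jk) (bool_irrelevance ik' ik) in q' *.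
rewrite (bool_irrelevance q q'); exact: tri_eq_refl.
Qed.

(** * Lifting problems in terms of cells *)

Section ExtendCells.

Context {B : two_cat} {n : nat} {P : subpred n} (hP : sub_closed P).
Hypothesis P1 : forall (i j : 'I_n.+1) (ij : i <= j), P (edg ij).

Definition extends {S : skel B n} (T' : cells S (@predT_sub n)) (T : cells S (@P)) :=
  forall (i j k : 'I_n.+1) (ij : i <= j) (jk : j <= k) (ik : i <= k) q,
    ct T' ij jk ik isT = ct T ij jk ik q.

Lemma simplex_extends (S : skel B n) (T : cells S (@P)) (AT : cells_assoc T)
    (T' : cells S (@predT_sub n)) (AT' : cells_assoc T') :
  extends T' T ->
  forall m (x : sub_sset hP m), duskin_act (val x) (cells_simplex AT') = cells_fun AT x.
Proof.
by move=> ex m x; apply: duskin_eq => i j k ij jk ik; exact: ex.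
Qed.

(** The restriction condition at vertices and edges identifies the skeleton of [D] with [S], after
    which only 2-morphisms remain to be compared. *)
Lemma extends_simplex (S : skel B n) (T : cells S (@P)) (AT : cells_assoc T)
    (D : duskin B n) :
  (forall m (x : sub_sset hP m), duskin_act (val x) D = cells_fun AT x) ->
  exists (T' : cells S (@predT_sub n)) (AT' : cells_assoc T'),
    D = cells_simplex AT' /\ extends T' T.
Proof.
case: S T AT => [v e a0] T AT; case: D => [v' e' t' b1 b2 b3 b4] H.
have ev : v' = v.
  fext i.
  exact: (congr1 (fun d => dv d ord0) (H 0 (exist _ (pt i) (P_pt hP P1 i)))).
subst v'.
have ee : e' = e.
  fext i; fext j.
  fext ij; apply: hom_eq_eq.
  pose q : i <= j := @moP _ _ (edg ij) o10 o11 isT.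
  rewrite (bool_irrelevance ij q).
  exact: (@de_eq _ 1 _ _ o10 o11 o10 o11 isT isT
    (H 1 (exist _ (edg ij) (P1 ij))) erefl erefl).
subst e'.
pose T' := @Cells B n (Skel a0) (@predT_sub n) (fun i j k ij jk ik _ => t' i j k ij jk ik)
  (fun i j ii ij ij' _ => b2 i j ii ij ij') (fun i j ij ij' jj _ => b3 i j ij ij' jj).
have AT' : cells_assoc T' by move=> i j k l ij jk kl ik jl il *; exact: b4.
have DE : Duskin b1 b2 b3 b4 = cells_simplex AT' by exact: duskin_eq.
exists T', AT'; split=> // i j k ij jk ik q; apply: tri_eq_eq.
pose y : mono 2 n := tri ij jk; pose x : sub_sset hP 2 := exist _ y q.
have h : tri_eq
    (ct T' (@moP _ _ y o20 o21 isT) (@moP _ _ y o21 o22 isT) (@moP _ _ y o20 o22 isT) isT)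
    (ct T (@moP _ _ y o20 o21 isT) (@moP _ _ y o21 o22 isT) (@moP _ _ y o20 o22 isT)
      (@in_tri _ _ hP _ x o20 o21 o22 isT isT)).
  exact: (@dt_eq _ 2 _ _ o20 o21 o22 o20 o21 o22 isT isT isT isT isT isT (H 2 x)).
apply: (tri_eq_trans _ (tri_eq_trans h _)); exact: ct_eq.
Qed.

End ExtendCells.

Section LiftCells.

Context {B C : two_cat} (F : two_functor B C) {n : nat} {P : subpred n}
  (hP : sub_closed P).
Hypothesis P1 : forall (i j : 'I_n.+1) (ij : i <= j), P (edg ij).

Definition skelF (S : skel B n) : skel C n.
Proof.
refine (@Skel C n (fun i => F (S i)) (fun i j ij => F1 F (se S ij)) _).
by move=> i ii; rewrite se_id F1_id.
Defined.

Definition cellsF (Q : subpred n) (S : skel B n) (T : cells S Q) : cells (skelF S) Q.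
Proof.
refine (@Cells C n (skelF S) Q (fun i j k ij jk ik q => Fc F (ct T ij jk ik q)) _ _).
- move=> i j ii ij ij' q; apply: arr_eq_trans (FcE _ _) _ => /=.
  by rewrite -f_id; apply: F2_arr_eq; exact: ct_idl.
- move=> i j ij ij' jj q; apply: arr_eq_trans (FcE _ _) _ => /=.
  by rewrite -f_id; apply: F2_arr_eq; exact: ct_idr.
Defined.

Lemma cellsF_assoc (Q : subpred n) (S : skel B n) (T : cells S Q) :
  cells_assoc T -> cells_assoc (cellsF T).
Proof. by move=> AT i j k l *; apply: assoc_F; exact: AT. Qed.

Lemma nerve_fun_cells (S : skel B n) (T : cells S (@P)) (AT : cells_assoc T) m
    (x : sub_sset hP m) :
  nerve_fun F (cells_fun AT x) = cells_fun (cellsF_assoc AT) x.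
Proof. exact: duskin_eq. Qed.

Lemma smap_simplex (X : sset) (g : smap (simplex n) X) m (x : simplex n m) :
  g m x = act x (g n (mono_id n)).
Proof. by rewrite -sm_act; congr (g m _); apply: mono_ext. Qed.

Lemma present_problem (f : smap (sub_sset hP) (Nsc B)) (g : smap (simplex n) (Nsc C)) :
  lift_problem (sub_incl hP) (nerve_map F) f g ->
  exists (S : skel B n) (T : cells S (@P)) (AT : cells_assoc T)
    (T' : cells (skelF S) (@predT_sub n)) (AT' : cells_assoc T'),
  [/\ smap_eq f (cells_map hP AT), g n (mono_id n) = cells_simplex AT'
    & extends T' (cellsF T)].
Proof.
move=> lp; have [S [T [AT fE]]] := present P1 f.
have [T' [AT' [gE ex]]] : exists (T' : cells (skelF S) (@predT_sub n)) (AT' : cells_assoc T'),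
    g n (mono_id n) = cells_simplex AT' /\ extends T' (cellsF T).
  apply: (extends_simplex P1 (AT := cellsF_assoc AT)) => m x.
  rewrite -nerve_fun_cells -[cells_fun AT x]/(cells_map hP AT m x) -fE.
  by rewrite -[LHS](smap_simplex g (val x)) -[LHS]lp.
by exists S, T, AT, T', AT'.
Qed.

Context {S : skel B n} {T : cells S (@P)} (AT : cells_assoc T)
  {T' : cells (skelF S) (@predT_sub n)} (AT' : cells_assoc T').
Context (f : smap (sub_sset hP) (Nsc B)) (g : smap (simplex n) (Nsc C)).
Hypothesis fE : smap_eq f (cells_map hP AT).
Hypothesis gE : g n (mono_id n) = cells_simplex AT'.

Definition lift_cells := exists T'' : cells S (@predT_sub n),
  [/\ cells_assoc T'', extends T'' T
    & forall (i j k : 'I_n.+1) (ij : i <= j) (jk : j <= k) (ik : i <= k),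
        Fc F (ct T'' ij jk ik isT) = ct T' ij jk ik isT].

Lemma has_lift_cells : lift_cells -> has_lift (sub_incl hP) (nerve_map F) f g.
Proof.
case=> T'' [AT'' ex eF].
exists (@SMap (simplex n) (Nsc B) (fun m x => duskin_act x (cells_simplex AT''))
  (fun m k a x => erefl)); split=> m x.
  rewrite (fE x); exact: simplex_extends.
rewrite (smap_simplex g x) gE; apply: duskin_eq => i j k ij jk ik.
exact: eF.
Qed.

Lemma cells_has_lift : has_lift (sub_incl hP) (nerve_map F) f g -> lift_cells.
Proof.
case=> h [h1 h2].
have [T'' [AT'' [hE ex]]] : exists (T'' : cells S (@predT_sub n)) (AT'' : cells_assoc T''),
    h n (mono_id n) = cells_simplex AT'' /\ extends T'' T.
  apply: (extends_simplex P1 (AT := AT)) => m x.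
  by rewrite -[RHS]/(cells_map hP AT m x) -(fE x) -(h1 m x) /= -[LHS](smap_simplex h (val x)).
exists T''; split=> // i j k ij jk ik; apply: tri_eq_eq.
have e : nerve_fun F (cells_simplex AT'') = cells_simplex AT'.
  by rewrite -hE -gE -(h2 n (mono_id n)).
exact: (dt_eq ij jk ik ij jk ik e).
Qed.

End LiftCells.

Arguments lift_cells {B C} F {n P S} T T'.

(** * Horns *)

Lemma horn_intro n h m (x : mono m n) (a : 'I_n.+1) :
  a != h :> nat -> (forall k, x k != a) -> @horn_pred n h m x.
Proof. by move=> ah hx; apply/existsP; exists a; rewrite ah; apply/forallP. Qed.

Lemma horn_surj n h m (x : mono m n) (a : 'I_n.+1) :
  ~~ @horn_pred n h m x -> a != h :> nat -> exists k, x k = a.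
Proof.
move=> hx ah; have [/forallP hk|] := boolP [forall k, x k != a].
  by case/negP: hx; exact: horn_intro hk.
by rewrite negb_forall => /existsP[k]; rewrite negbK => /eqP; exists k.
Qed.

Lemma horn_tri n h (i j k a : 'I_n.+1) (ij : i <= j) (jk : j <= k) :
  ~~ @horn_pred n h 2 (tri ij jk) -> a != h :> nat -> [|| i == a, j == a | k == a].
Proof.
move=> hx ah; have [b <-] := horn_surj hx ah.
by elim/ord3_ind: b; rewrite /= eqxx ?orbT.
Qed.

Lemma horn_quad n h (i j k l a : 'I_n.+1) (ij : i <= j) (jk : j <= k) (kl : k <= l) :
  ~~ @horn_pred n h 3 (quad ij jk kl) -> a != h :> nat ->
  [|| i == a, j == a, k == a | l == a].
Proof.
move=> hx ah; have [b <-] := horn_surj hx ah.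
by elim/ord4_ind: b; rewrite /= eqxx ?orbT.
Qed.

(** A simplex outside the horn hits every vertex other than [h], which makes at least [n] vertices,
    but it has only [m + 1]. *)
Lemma horn_small n h m (x : mono m n) : m.+2 <= n -> @horn_pred n h m x.
Proof.
move=> mn; apply: contraTT isT => hx.
pose A := [set a : 'I_n.+1 | a != h :> nat].
have sA : A \subset x @: setT.
  apply/subsetP => a; rewrite inE => ah; have [k <-] := horn_surj hx ah.
  exact: imset_f.
have cA : n <= #|A|.
  have : #|~: A| <= 1.
    apply/card_le1_eqP => a b; rewrite !inE !negbK => /eqP ea /eqP eb.
    by apply: val_inj; rewrite /= ea.
  have := cardsC A; rewrite card_ord; case: #|~: A| => [|[|]] //.
    by rewrite addn0 => -> _; exact: leqnSn.
  by rewrite addn1 => -[->].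
have := leq_trans cA (leq_trans (subset_leq_card sA) (leq_imset_card _ _)).
by rewrite cardsT card_ord leqNgt (leq_trans _ mn).
Qed.

Lemma horn_edg n h : 3 <= n -> forall (i j : 'I_n.+1) (ij : i <= j),
  @horn_pred n h 1 (edg ij).
Proof. by move=> n3 i j ij; exact: horn_small. Qed.

Lemma enum_ord0 : enum 'I_0 = [::].
Proof. by apply: size0nil; rewrite size_enum_ord. Qed.

Lemma on_vertices_edg n (i j : 'I_n.+1) (ij : i <= j) a b :
  i = a :> nat -> j = b :> nat -> on_vertices [:: a; b] (edg ij).
Proof. by move=> <- <-; rewrite /on_vertices !enum_ordSl enum_ord0. Qed.

Lemma on_vertices_tri n (i j k : 'I_n.+1) (ij : i <= j) (jk : j <= k) a b c :
  i = a :> nat -> j = b :> nat -> k = c :> nat -> on_vertices [:: a; b; c] (tri ij jk).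
Proof. by move=> <- <- <-; rewrite /on_vertices !enum_ordSl enum_ord0. Qed.

Lemma on_vertices_val m n (x : mono m n) s (k : 'I_m.+1) :
  on_vertices s x -> val (x k) = nth 0 s k.
Proof.
by move=> <-; rewrite (nth_map k) ?size_enum_ord ?nth_ord_enum.
Qed.

Section AddCell.

Context {B : two_cat} {n : nat} {S : skel B n} {P : subpred n} (T : cells S (@P)).
Context {a b c : 'I_n.+1} (ab : a <= b) (bc : b <= c) (ac : a <= c)
  (t : c_hom (se S ac) (comp1 (se S bc) (se S ab))).
Hypothesis neab : a != b.
Hypothesis nebc : b != c.
Hypothesis missing : forall (i j k : 'I_n.+1) (ij : i <= j) (jk : j <= k),
  ~~ P (tri ij jk) -> [/\ i = a, j = b & k = c].

Lemma add_cell : exists T' : cells S (@predT_sub n),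
  extends T' T /\ (~~ P (tri ab bc) -> ct T' ab bc ac isT = t).
Proof.
pose R (u : triple (@predT_sub n))
    (s : c_hom (se S (t_ik u)) (comp1 (se S (t_jk u)) (se S (t_ij u)))) :=
  (forall q, s = ct T (t_ij u) (t_jk u) (t_ik u) q) /\
  (~~ P (tri (t_ij u) (t_jk u)) -> tri_eq s t).
have [f hf] : exists f : forall u : triple (@predT_sub n),
    c_hom (se S (t_ik u)) (comp1 (se S (t_jk u)) (se S (t_ij u))), forall u, R u (f u).
  apply: dep_choice => -[i j k ij jk ik q]; rewrite /R /=.
  have [p|np] := orP (orbN (P (tri ij jk))).
    by exists (ct T ij jk ik p); split=> [p'|]; [exact: ct_irr | rewrite p].
  have [ei ej ek] := missing np; subst i j k.
  rewrite (bool_irrelevance ij ab) (bool_irrelevance jk bc) (bool_irrelevance ik ac) in np *.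
  by exists t; split=> [p|_]; [rewrite p in np | exact: tri_eq_refl].
pose f' i j k ij jk ik q := f (@Triple n (@predT_sub n) i j k ij jk ik q).
have fE i j k ij jk ik q p : f' i j k ij jk ik q = ct T ij jk ik p.
  by have [h _] := hf (@Triple n (@predT_sub n) i j k ij jk ik q); exact: h.
have idl (i j : 'I_n.+1) (ii : i <= i) (ij ij' : i <= j) q :
    arr_eq (f' i i j ii ij ij' q) (c_id (se S ij)).
  have p : P (tri ii ij).
    by apply: contraT => /missing [e1 e2 _]; move: neab; rewrite -e1 -e2 eqxx.
  rewrite (fE _ _ _ _ _ _ _ p); exact: ct_idl.
have idr (i j : 'I_n.+1) (ij ij' : i <= j) (jj : j <= j) q :
    arr_eq (f' i j j ij jj ij' q) (c_id (se S ij)).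
  have p : P (tri ij jj).
    by apply: contraT => /missing [_ e1 e2]; move: nebc; rewrite -e1 -e2 eqxx.
  rewrite (fE _ _ _ _ _ _ _ p); exact: ct_idr.
exists (Cells idl idr); split=> [i j k ij jk ik q|np] /=; first exact: fE.
have [_ /(_ np)] := hf (@Triple n (@predT_sub n) a b c ab bc ac isT).
exact: tri_eq_eq.
Qed.

End AddCell.

Section Assoc3.

Context {B : two_cat} {S : skel B 3}.

Lemma cells_assoc3 (P : subpred 3) (T : cells S P) :
  (forall q1 q2 q3 q4, P 3 (@quad 3 o30 o31 o32 o33 isT isT isT) ->
    arr_eq (assocL (ct3 T o30 o31 o32 q1)
                 (ct3 T o30 o32 o33 q2))
         (assocR (ct3 T o30 o31 o33 q3)
                 (ct3 T o31 o32 o33 q4))) ->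
  cells_assoc T.
Proof.
move=> h i j k l ij jk kl ik jl il q1 q2 q3 q4 q.
have [dg|/norP[nij /norP[njk nkl]]] := boolP [|| i == j, j == k | k == l].
  exact: cells_assoc_degenerate.
elim/ord4_ind: i nij ij ik il q1 q2 q3 q => //;
elim/ord4_ind: j njk jk jl q4 => //; elim/ord4_ind: k nkl kl => //;
elim/ord4_ind: l => //.
move=> _ kl _ jk jl q4 _ ij ik il q1 q2 q3 q.
move: q1 q2 q3 q4 q; irr ij; irr jk; irr kl; irr ik; irr jl; irr il; exact: h.
Qed.

End Assoc3.

Section Missing.

(** A boolean condition over all four vertices, so that it evaluates once the vertices are literals
    and the impossible cases are discharged by computation. *)
Lemma missing3 h (i j k : 'I_4) (ij : i <= j) (jk : j <= k) :
  ~~ @horn_pred 3 h 2 (tri ij jk) ->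
  [&& (h == 0) || [|| i == o30, j == o30 | k == o30],
      (h == 1) || [|| i == o31, j == o31 | k == o31],
      (h == 2) || [|| i == o32, j == o32 | k == o32]
    & (h == 3) || [|| i == o33, j == o33 | k == o33]].
Proof.
by move=> hx; apply/and4P; split; apply/orP; (case: eqP => [_|/eqP nh]; [by left | right]);
  apply: (horn_tri hx); rewrite eq_sym.
Qed.

Ltac solve_missing3 i j k ij jk :=
  move=> /missing3; elim/ord4_ind: i ij; elim/ord4_ind: j jk => //;
  by elim/ord4_ind: k.

Lemma missing3_0 (i j k : 'I_4) (ij : i <= j) (jk : j <= k) :
  ~~ @horn_pred 3 0 2 (tri ij jk) -> [/\ i = o31, j = o32 & k = o33].
Proof. solve_missing3 i j k ij jk. Qed.

Lemma missing3_1 (i j k : 'I_4) (ij : i <= j) (jk : j <= k) :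
  ~~ @horn_pred 3 1 2 (tri ij jk) -> [/\ i = o30, j = o32 & k = o33].
Proof. solve_missing3 i j k ij jk. Qed.

Lemma missing3_2 (i j k : 'I_4) (ij : i <= j) (jk : j <= k) :
  ~~ @horn_pred 3 2 2 (tri ij jk) -> [/\ i = o30, j = o31 & k = o33].
Proof. solve_missing3 i j k ij jk. Qed.

Lemma missing3_3 (i j k : 'I_4) (ij : i <= j) (jk : j <= k) :
  ~~ @horn_pred 3 3 2 (tri ij jk) -> [/\ i = o30, j = o31 & k = o32].
Proof. solve_missing3 i j k ij jk. Qed.

Lemma missing4 h (i j k l : 'I_5) (ij : i <= j) (jk : j <= k) (kl : k <= l) :
  ~~ @horn_pred 4 h 3 (quad ij jk kl) ->
  [&& (h == 0) || [|| i == o40, j == o40, k == o40 | l == o40],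
      (h == 1) || [|| i == o41, j == o41, k == o41 | l == o41],
      (h == 2) || [|| i == o42, j == o42, k == o42 | l == o42],
      (h == 3) || [|| i == o43, j == o43, k == o43 | l == o43]
    & (h == 4) || [|| i == o44, j == o44, k == o44 | l == o44]].
Proof.
by move=> hx; apply/and5P; split; apply/orP; (case: eqP => [_|/eqP nh]; [by left | right]);
  apply: (horn_quad hx); rewrite eq_sym.
Qed.

Ltac solve_missing4 i j k l ij jk kl :=
  move=> /missing4; elim/ord5_ind: i ij; elim/ord5_ind: j jk => //;
  elim/ord5_ind: k kl => //; by elim/ord5_ind: l.

Lemma missing4_0 (i j k l : 'I_5) (ij : i <= j) (jk : j <= k) (kl : k <= l) :
  ~~ @horn_pred 4 0 3 (quad ij jk kl) ->
  [/\ i = o41, j = o42, k = o43 & l = o44].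
Proof. solve_missing4 i j k l ij jk kl. Qed.

Lemma missing4_1 (i j k l : 'I_5) (ij : i <= j) (jk : j <= k) (kl : k <= l) :
  ~~ @horn_pred 4 1 3 (quad ij jk kl) ->
  [/\ i = o40, j = o42, k = o43 & l = o44].
Proof. solve_missing4 i j k l ij jk kl. Qed.

Lemma missing4_2 (i j k l : 'I_5) (ij : i <= j) (jk : j <= k) (kl : k <= l) :
  ~~ @horn_pred 4 2 3 (quad ij jk kl) ->
  [/\ i = o40, j = o41, k = o43 & l = o44].
Proof. solve_missing4 i j k l ij jk kl. Qed.

Lemma missing4_3 (i j k l : 'I_5) (ij : i <= j) (jk : j <= k) (kl : k <= l) :
  ~~ @horn_pred 4 3 3 (quad ij jk kl) ->
  [/\ i = o40, j = o41, k = o42 & l = o44].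
Proof. solve_missing4 i j k l ij jk kl. Qed.

Lemma missing4_4 (i j k l : 'I_5) (ij : i <= j) (jk : j <= k) (kl : k <= l) :
  ~~ @horn_pred 4 4 3 (quad ij jk kl) ->
  [/\ i = o40, j = o41, k = o42 & l = o43].
Proof. solve_missing4 i j k l ij jk kl. Qed.

End Missing.

Tactic Notation "in_horn" constr(a) :=
  apply: (horn_intro (a := a)) => //; elim/ord3_ind => //.

Lemma horn_tri_inv n h (i j k : 'I_n.+1) (ij : i <= j) (jk : j <= k) :
  @horn_pred n h 2 (tri ij jk) -> exists x : 'I_n.+1, [&& x != h :> nat, i != x, j != x & k != x].
Proof.
case/existsP=> x /andP[xh /forallP hx]; exists x.
by rewrite xh /=; apply/and3P; split; [apply: (hx o20) | apply: (hx o21) | apply: (hx o22)].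
Qed.

Lemma horn3_tri_0 : ~~ @horn_pred 3 0 2 (tri3 o31 o32 o33).
Proof. by apply/negP => /horn_tri_inv[x]; elim/ord4_ind: x. Qed.

Lemma horn3_tri_1 : ~~ @horn_pred 3 1 2 (tri3 o30 o32 o33).
Proof. by apply/negP => /horn_tri_inv[x]; elim/ord4_ind: x. Qed.

Lemma horn3_tri_2 : ~~ @horn_pred 3 2 2 (tri3 o30 o31 o33).
Proof. by apply/negP => /horn_tri_inv[x]; elim/ord4_ind: x. Qed.

Lemma horn3_tri_3 : ~~ @horn_pred 3 3 2 (tri3 o30 o31 o32).
Proof. by apply/negP => /horn_tri_inv[x]; elim/ord4_ind: x. Qed.

(** * Fillers of horns of dimension at least 3 *)

Section HornCells.

Context {B C : two_cat} (F : two_functor B C).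

Lemma lift_cells3 h (S : skel B 3) (T : cells S (@horn_pred 3 h))
    (T' : cells (skelF F S) (@predT_sub 3)) (a b c : 'I_4) (ab : a <= b) (bc : b <= c)
    (ac : a <= c) (t : c_hom (se S ac) (comp1 (se S bc) (se S ab))) :
  extends T' (cellsF F T) -> a != b -> b != c ->
  (forall (i j k : 'I_4) (ij : i <= j) (jk : j <= k),
    ~~ @horn_pred 3 h 2 (tri ij jk) -> [/\ i = a, j = b & k = c]) ->
  ~~ @horn_pred 3 h 2 (tri ab bc) ->
  Fc F t = ct T' ab bc ac isT ->
  (forall T'' : cells S (@predT_sub 3), extends T'' T -> ct T'' ab bc ac isT = t ->
    arr_eq (assocL (ct3 T'' o30 o31 o32 isT)
                 (ct3 T'' o30 o32 o33 isT))
         (assocR (ct3 T'' o30 o31 o33 isT)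
                 (ct3 T'' o31 o32 o33 isT))) ->
  lift_cells F T T'.
Proof.
move=> ex neab nebc mis nab tE asT.
have [T'' [ex' /(_ nab) tE']] := add_cell T t neab nebc mis.
exists T''; split=> //.
  apply: cells_assoc3 => q1 q2 q3 q4 _.
  irr q1; irr q2; irr q3; irr q4; exact: asT.
move=> i j k ij jk ik; have [p|np] := orP (orbN (@horn_pred 3 h 2 (tri ij jk))).
  by rewrite (ex' _ _ _ ij jk ik p) (ex _ _ _ ij jk ik p).
have [ei ej ek] := mis _ _ _ _ _ np; subst i j k.
by rewrite (bool_irrelevance ij ab) (bool_irrelevance jk bc) (bool_irrelevance ik ac) tE'.
Qed.

(** From dimension 4 on, the horn contains all triangles, so the filler has the 2-morphisms of [T]
    and only associativity outside the horn remains. *)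
Lemma lift_cells_ge4 n h (S : skel B n) (T : cells S (@horn_pred n h))
    (T' : cells (skelF F S) (@predT_sub n)) :
  4 <= n -> cells_assoc T -> extends T' (cellsF F T) ->
  (forall (i j k l : 'I_n.+1) (ij : i <= j) (jk : j <= k) (kl : k <= l)
      (ik : i <= k) (jl : j <= l) (il : i <= l) q1 q2 q3 q4,
    ~~ @horn_pred n h 3 (quad ij jk kl) ->
    arr_eq (assocL (ct T ij jk ik q1) (ct T ik kl il q2))
           (assocR (ct T ij jl il q3) (ct T jk kl jl q4))) ->
  lift_cells F T T'.
Proof.
move=> n4 AT ex asT.
pose q (i j k : 'I_n.+1) (ij : i <= j) (jk : j <= k) := horn_small h (tri ij jk) n4.
exists (Cells (P := @predT_sub n) (ct := fun i j k ij jk ik _ => ct T ij jk ik (q i j k ij jk))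
  (fun i j ii ij ij' _ => ct_idl T ij' (q i i j ii ij))
  (fun i j ij ij' jj _ => ct_idr T ij' (q i j j ij jj))); split.
- move=> i j k l ij jk kl ik jl il *.
  have [p|np] := orP (orbN (@horn_pred n h 3 (quad ij jk kl))); first exact: AT.
  exact: asT.
- by move=> i j k ij jk ik p /=; exact: ct_irr.
- by move=> i j k ij jk ik /=; rewrite (ex _ _ _ ij jk ik (q _ _ _ ij jk)).
Qed.

Lemma horn_assoc n h (S : skel B n) (T : cells S (@horn_pred n h)) (AT : cells_assoc T)
    (x i j k l : 'I_n.+1) (ij : i <= j) (jk : j <= k) (kl : k <= l) (ik : i <= k)
    (jl : j <= l) (il : i <= l) q1 q2 q3 q4 :
  [&& x != h :> nat, i != x, j != x, k != x & l != x] ->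
  arr_eq (assocL (ct T ij jk ik q1) (ct T ik kl il q2))
         (assocR (ct T ij jl il q3) (ct T jk kl jl q4)).
Proof.
case/and5P=> xh ix jx kx lx; apply: AT; apply: (horn_intro xh).
by elim/ord4_ind.
Qed.

Lemma lift_cells_ge5 n h (S : skel B n) (T : cells S (@horn_pred n h))
    (T' : cells (skelF F S) (@predT_sub n)) :
  5 <= n -> cells_assoc T -> extends T' (cellsF F T) -> lift_cells F T T'.
Proof.
move=> n5 AT ex; apply: lift_cells_ge4 => //; first exact: ltnW.
by move=> i j k l ij jk kl ? ? ? ? ? ? ? /negP[]; exact: horn_small.
Qed.

Hypothesis hF : buckley_2fibration F.

Notation ct4 T a b c := (ct3 T a b c (horn_small _ (tri3 a b c) isT)) (only parsing).

Lemma inner_horn_cells n i (S : skel B n) (T : cells S (@horn_pred n i))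
    (T' : cells (skelF F S) (@predT_sub n)) :
  3 <= n -> 0 < i < n -> cells_assoc T -> cells_assoc T' -> extends T' (cellsF F T) ->
  (forall (a b c : 'I_n.+1) (ab : a <= b) (bc : b <= c) (ac : a <= c) q,
    a = i.-1 :> nat -> b = i :> nat -> c = i.+1 :> nat -> is_iso (ct T ab bc ac q)) ->
  lift_cells F T T'.
Proof.
case: n S T T' => [|[|[|[|[|n]]]]] // S T T' n3 hi AT AT' ex iso; last first.
- exact: lift_cells_ge5.
- apply: lift_cells_ge4 => // a b c d ab bc cd ac bd ad q1 q2 q3 q4 np.
  (* The horn at [i] misses the face opposite to [i], and the thin triangle on [i - 1], [i], [i + 1]
     is the one cancelled in the hexagon. *)
  case: i => [|[|[|[|i]]]] // in hi S T T' AT AT' ex iso a b c d ab bc cd ac bd ad q1 q2 q3 q4 np *.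
  + have [ea eb ec ed] := missing4_1 np; subst a b c d.
    clear np; move: q1 q2 q3 q4; irr ab; irr bc; irr cd; irr ac; irr bd; irr ad => q1 q2 q3 q4.
    apply: (pentagon_0234
      (t012 := ct4 T o40 o41 o42) (t013 := ct4 T o40 o41 o43) (t014 := ct4 T o40 o41 o44)
      (t123 := ct4 T o41 o42 o43) (t124 := ct4 T o41 o42 o44) (t134 := ct4 T o41 o43 o44)).
    * exact: iso.
    * exact: (horn_assoc AT (x := o44)).
    * exact: (horn_assoc AT (x := o43)).
    * exact: (horn_assoc AT (x := o42)).
    * exact: (horn_assoc AT (x := o40)).
  + have [ea eb ec ed] := missing4_2 np; subst a b c d.
    clear np; move: q1 q2 q3 q4; irr ab; irr bc; irr cd; irr ac; irr bd; irr ad => q1 q2 q3 q4.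
    apply: (pentagon_0134
      (t012 := ct4 T o40 o41 o42) (t023 := ct4 T o40 o42 o43) (t024 := ct4 T o40 o42 o44)
      (t123 := ct4 T o41 o42 o43) (t124 := ct4 T o41 o42 o44) (t234 := ct4 T o42 o43 o44)).
    * exact: iso.
    * exact: (horn_assoc AT (x := o44)).
    * exact: (horn_assoc AT (x := o43)).
    * exact: (horn_assoc AT (x := o41)).
    * exact: (horn_assoc AT (x := o40)).
  + have [ea eb ec ed] := missing4_3 np; subst a b c d.
    clear np; move: q1 q2 q3 q4; irr ab; irr bc; irr cd; irr ac; irr bd; irr ad => q1 q2 q3 q4.
    apply: (pentagon_0124
      (t013 := ct4 T o40 o41 o43) (t023 := ct4 T o40 o42 o43) (t034 := ct4 T o40 o43 o44)
      (t123 := ct4 T o41 o42 o43) (t134 := ct4 T o41 o43 o44) (t234 := ct4 T o42 o43 o44)).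
    * exact: iso.
    * exact: (horn_assoc AT (x := o44)).
    * exact: (horn_assoc AT (x := o42)).
    * exact: (horn_assoc AT (x := o41)).
    * exact: (horn_assoc AT (x := o40)).
- case: i => [|[|[|i]]] // in hi S T T' AT AT' ex iso *.
  + have p012 : @horn_pred 3 1 2 (tri3 o30 o31 o32) by in_horn o33.
    have p013 : @horn_pred 3 1 2 (tri3 o30 o31 o33) by in_horn o32.
    have p123 : @horn_pred 3 1 2 (tri3 o31 o32 o33) by in_horn o30.
    have e := AT' o30 o31 o32 o33 isT isT isT isT isT isT isT isT isT isT isT.
    rewrite (ex _ _ _ _ _ _ p012) (ex _ _ _ _ _ _ p013) (ex _ _ _ _ _ _ p123) in e.
    have [t [t1 t2]] := fill_023 (iso _ _ _ _ _ _ p012 erefl erefl erefl) e.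
    apply: (lift_cells3 (t := t) ex) => //; first exact: missing3_1.
    exact: horn3_tri_1.
    move=> T'' ex' e'; rewrite e'.
    by rewrite (ex' _ _ _ _ _ _ p012) (ex' _ _ _ _ _ _ p013) (ex' _ _ _ _ _ _ p123).
  + have p012 : @horn_pred 3 2 2 (tri3 o30 o31 o32) by in_horn o33.
    have p023 : @horn_pred 3 2 2 (tri3 o30 o32 o33) by in_horn o31.
    have p123 : @horn_pred 3 2 2 (tri3 o31 o32 o33) by in_horn o30.
    have e := AT' o30 o31 o32 o33 isT isT isT isT isT isT isT isT isT isT isT.
    rewrite (ex _ _ _ _ _ _ p012) (ex _ _ _ _ _ _ p023) (ex _ _ _ _ _ _ p123) in e.
    have [t [t1 t2]] := fill_013 (iso _ _ _ _ _ _ p123 erefl erefl erefl) e.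
    apply: (lift_cells3 (t := t) ex) => //; first exact: missing3_2.
    exact: horn3_tri_2.
    move=> T'' ex' e'; rewrite e'.
    by rewrite (ex' _ _ _ _ _ _ p012) (ex' _ _ _ _ _ _ p023) (ex' _ _ _ _ _ _ p123).
Qed.

Lemma left_horn_cells n (S : skel B n) (T : cells S (@horn_pred n 0))
    (T' : cells (skelF F S) (@predT_sub n)) :
  3 <= n -> cells_assoc T -> cells_assoc T' -> extends T' (cellsF F T) ->
  (forall (a b : 'I_n.+1) (ab : a <= b), a = 0 :> nat -> b = 1 :> nat -> is_id (se S ab)) ->
  (forall (a b c : 'I_n.+1) (ab : a <= b) (bc : b <= c) (ac : a <= c) q,
    a = 0 :> nat -> b = 1 :> nat -> c = n :> nat -> cocartesian2 F (ct T ab bc ac q)) ->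
  lift_cells F T T'.
Proof.
case: n S T T' => [|[|[|[|[|n]]]]] // S T T' n3 AT AT' ex hid hcc; last first.
- exact: lift_cells_ge5.
- apply: lift_cells_ge4 => // a b c d ab bc cd ac bd ad q1 q2 q3 q4 np.
  have [ea eb ec ed] := missing4_0 np; subst a b c d.
  clear np; move: q1 q2 q3 q4; irr ab; irr bc; irr cd; irr ac; irr bd; irr ad => q1 q2 q3 q4.
  have e := AT' o41 o42 o43 o44 isT isT isT isT isT isT isT isT isT isT isT.
  rewrite (ex _ _ _ _ _ _ q1) (ex _ _ _ _ _ _ q2) (ex _ _ _ _ _ _ q3) (ex _ _ _ _ _ _ q4) in e.
  apply: (unique_1234
    (t012 := ct4 T o40 o41 o42) (t013 := ct4 T o40 o41 o43) (t014 := ct4 T o40 o41 o44)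
    (t023 := ct4 T o40 o42 o43) (t024 := ct4 T o40 o42 o44) (t034 := ct4 T o40 o43 o44)).
  + exact: hid.
  + exact: hcc.
  + exact: F_assoc e.
  + exact: (horn_assoc AT (x := o44)).
  + exact: (horn_assoc AT (x := o43)).
  + exact: (horn_assoc AT (x := o42)).
  + exact: (horn_assoc AT (x := o41)).
- have p012 : @horn_pred 3 0 2 (tri3 o30 o31 o32) by in_horn o33.
  have p013 : @horn_pred 3 0 2 (tri3 o30 o31 o33) by in_horn o32.
  have p023 : @horn_pred 3 0 2 (tri3 o30 o32 o33) by in_horn o31.
  have e := AT' o30 o31 o32 o33 isT isT isT isT isT isT isT isT isT isT isT.
  rewrite (ex _ _ _ _ _ _ p012) (ex _ _ _ _ _ _ p013) (ex _ _ _ _ _ _ p023) in e.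
  have [t [t1 t2]] :=
      fill_123 (hid o30 o31 isT erefl erefl)
        (hcc _ _ _ _ _ _ p013 erefl erefl erefl) e.
  apply: (lift_cells3 (t := t) ex) => //; first exact: missing3_0.
    exact: horn3_tri_0.
  move=> T'' ex' e'; rewrite e'.
  by rewrite (ex' _ _ _ _ _ _ p012) (ex' _ _ _ _ _ _ p013) (ex' _ _ _ _ _ _ p023).
Qed.

Lemma right_horn_cells n (S : skel B n) (T : cells S (@horn_pred n n))
    (T' : cells (skelF F S) (@predT_sub n)) :
  3 <= n -> cells_assoc T -> cells_assoc T' -> extends T' (cellsF F T) ->
  (forall (a b : 'I_n.+1) (ab : a <= b), a = n.-1 :> nat -> b = n :> nat ->
    acart F (se S ab)) ->
  (forall (a b c : 'I_n.+1) (ab : a <= b) (bc : b <= c) (ac : a <= c) q,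
    a = 0 :> nat -> b = n.-1 :> nat -> c = n :> nat -> cocartesian2 F (ct T ab bc ac q)) ->
  lift_cells F T T'.
Proof.
case: n S T T' => [|[|[|[|[|n]]]]] // S T T' n3 AT AT' ex hid hcc; last first.
- exact: lift_cells_ge5.
- apply: lift_cells_ge4 => // a b c d ab bc cd ac bd ad q1 q2 q3 q4 np.
  have [ea eb ec ed] := missing4_4 np; subst a b c d.
  clear np; move: q1 q2 q3 q4; irr ab; irr bc; irr cd; irr ac; irr bd; irr ad => q1 q2 q3 q4.
  have e := AT' o40 o41 o42 o43 isT isT isT isT isT isT isT isT isT isT isT.
  rewrite (ex _ _ _ _ _ _ q1) (ex _ _ _ _ _ _ q2) (ex _ _ _ _ _ _ q3) (ex _ _ _ _ _ _ q4) in e.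
  apply: (unique_0123
    (t014 := ct4 T o40 o41 o44) (t024 := ct4 T o40 o42 o44) (t034 := ct4 T o40 o43 o44)
    (t124 := ct4 T o41 o42 o44) (t134 := ct4 T o41 o43 o44) (t234 := ct4 T o42 o43 o44)).
  + exact: hid.
  + exact: hcc.
  + exact: F_assoc e.
  + exact: (horn_assoc AT (x := o43)).
  + exact: (horn_assoc AT (x := o42)).
  + exact: (horn_assoc AT (x := o41)).
  + exact: (horn_assoc AT (x := o40)).
- have p013 : @horn_pred 3 3 2 (tri3 o30 o31 o33) by in_horn o32.
  have p023 : @horn_pred 3 3 2 (tri3 o30 o32 o33) by in_horn o31.
  have p123 : @horn_pred 3 3 2 (tri3 o31 o32 o33) by in_horn o30.
  have e := AT' o30 o31 o32 o33 isT isT isT isT isT isT isT isT isT isT isT.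
  rewrite (ex _ _ _ _ _ _ p013) (ex _ _ _ _ _ _ p023) (ex _ _ _ _ _ _ p123) in e.
  have [t [t1 t2]] :=
      fill_012 (hid o32 o33 isT erefl erefl)
        (hcc _ _ _ _ _ _ p023 erefl erefl erefl) e.
  apply: (lift_cells3 (t := t) ex) => //; first exact: missing3_3.
    exact: horn3_tri_3.
  move=> T'' ex' e'; rewrite e'.
  by rewrite (ex' _ _ _ _ _ _ p013) (ex' _ _ _ _ _ _ p023) (ex' _ _ _ _ _ _ p123).
Qed.

End HornCells.

Definition dt012 {B : two_cat} (s : nerve B 2) := @dt B 2 s o20 o21 o22 isT isT isT.

Definition de01 {B : two_cat} (e : nerve B 1) : hom (dv e o10) (dv e o11) :=
  @de B 1 e o10 o11 isT.

Lemma hom_eq_is_id (B : two_cat) (x y x' y' : B) (f : hom x y) (f' : hom x' y') :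
  hom_eq f f' -> is_id f' -> is_id f.
Proof. by case: x' y' f' /. Qed.

Lemma degenerate_is_id (B : two_cat) (e : nerve B 1) : degenerate e -> is_id (de01 e).
Proof.
case=> m [a [y [m1 ->]]]; case: m m1 a y => // _ a y; rewrite /de01 /=.
move: (moP _ _); have -> : a o10 = a o11 by rewrite [LHS]ord1 [RHS]ord1.
by move=> i; rewrite de_id; exact: is_id_refl.
Qed.

Section HornLift.

Context {B C : two_cat} (F : two_functor B C).

Lemma tri_eq_cocart (x y z x' y' z' : B) (f : hom x y) (g : hom y z) (h : hom x z)
    (f' : hom x' y') (g' : hom y' z') (h' : hom x' z')
    (t : c_hom h (comp1 g f)) (t' : c_hom h' (comp1 g' f')) :
  tri_eq t t' -> cocartesian2 F t -> cocartesian2 F t'.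
Proof. by case. Qed.

Lemma hom_eq_acart (x y x' y' : B) (f : hom x y) (f' : hom x' y') :
  hom_eq f f' -> acart F f -> acart F f'.
Proof. by case. Qed.

Lemma inner_horn_lift n i (f : smap (horn n i) (Nsc B)) (g : smap (simplex n) (Nsc C)) :
  3 <= n -> 0 < i < n -> lift_problem (horn_incl n i) (nerve_map F) f g ->
  (forall t : horn n i 2, on_vertices [:: i.-1; i; i.+1] (val t : mono 2 n) ->
    nerve_thin (f 2 t)) ->
  has_lift (horn_incl n i) (nerve_map F) f g.
Proof.
move=> n3 hi lp thinf.
have [S [T [AT [T' [AT' [fE gE ex]]]]]] := present_problem (horn_edg i n3) lp.
apply: (has_lift_cells fE gE).
apply: inner_horn_cells => // a b c ab bc ac q ea eb ec.
pose t : horn n i 2 := exist _ (tri ab bc) q.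
have := thinf t (on_vertices_tri _ _ ea eb ec); rewrite (fE 2 t).
by apply: tri_eq_iso; exact: ct_eq.
Qed.

Lemma left_horn_lift n (f : smap (horn n 0) (Nsc B)) (g : smap (simplex n) (Nsc C)) :
  3 <= n -> lift_problem (horn_incl n 0) (nerve_map F) f g ->
  (forall t : horn n 0 1, on_vertices [:: 0; 1] (val t : mono 1 n) -> is_id (de01 (f 1 t))) ->
  (forall t : horn n 0 2, on_vertices [:: 0; 1; n] (val t : mono 2 n) ->
    cocartesian2 F (dt012 (f 2 t))) ->
  has_lift (horn_incl n 0) (nerve_map F) f g.
Proof.
move=> n3 lp hid hcc.
have [S [T [AT [T' [AT' [fE gE ex]]]]]] := present_problem (horn_edg 0 n3) lp.
apply: (has_lift_cells fE gE).
apply: left_horn_cells => // [a b ab ea eb|a b c ab bc ac q ea eb ec].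
- pose t : horn n 0 1 := exist _ (edg ab) (horn_edg 0 n3 ab).
  have := hid t (on_vertices_edg _ ea eb); rewrite (fE 1 t).
  apply: hom_eq_is_id; exact: eq_hom_eq (se_irr _ _ _).
- pose t : horn n 0 2 := exist _ (tri ab bc) q.
  have := hcc t (on_vertices_tri _ _ ea eb ec); rewrite (fE 2 t).
  by apply: tri_eq_cocart; exact: ct_eq.
Qed.

Lemma right_horn_lift n (f : smap (horn n n) (Nsc B)) (g : smap (simplex n) (Nsc C)) :
  3 <= n -> lift_problem (horn_incl n n) (nerve_map F) f g ->
  (forall t : horn n n 1, on_vertices [:: n.-1; n] (val t : mono 1 n) ->
    acart F (de01 (f 1 t))) ->
  (forall t : horn n n 2, on_vertices [:: 0; n.-1; n] (val t : mono 2 n) ->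
    cocartesian2 F (dt012 (f 2 t))) ->
  has_lift (horn_incl n n) (nerve_map F) f g.
Proof.
move=> n3 lp hac hcc.
have [S [T [AT [T' [AT' [fE gE ex]]]]]] := present_problem (horn_edg n n3) lp.
apply: (has_lift_cells fE gE).
apply: right_horn_cells => // [a b ab ea eb|a b c ab bc ac q ea eb ec].
- pose t : horn n n 1 := exist _ (edg ab) (horn_edg n n3 ab).
  have := hac t (on_vertices_edg _ ea eb); rewrite (fE 1 t).
  apply: hom_eq_acart; exact: eq_hom_eq (se_irr _ _ _).
- pose t : horn n n 2 := exist _ (tri ab bc) q.
  have := hcc t (on_vertices_tri _ _ ea eb ec); rewrite (fE 2 t).
  by apply: tri_eq_cocart; exact: ct_eq.
Qed.

End HornLift.

(** * Constructing cells *)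

Section Complete.

Context {B : two_cat} {n : nat} (S : skel B n) (P : subpred n).

(** At a repeated vertex a unit is inserted, cast along the unit law of [comp1]; only strictly
    increasing triples need a choice. *)
Lemma complete_cells (R : forall u : triple (@P),
    c_hom (se S (t_ik u)) (comp1 (se S (t_jk u)) (se S (t_ij u))) -> Prop) :
  (forall u : triple (@P), t_i u < t_j u -> t_j u < t_k u -> exists t, R u t) ->
  exists T : cells S (@P), forall u : triple (@P), t_i u < t_j u -> t_j u < t_k u ->
    R u (ct T (t_ij u) (t_jk u) (t_ik u) (t_in u)).
Proof.
move=> hR.
pose Q (u : triple (@P)) t := (t_i u = t_j u \/ t_j u = t_k u ->
    arr_eq t (c_id (se S (t_ik u)))) /\
  (t_i u < t_j u -> t_j u < t_k u -> R u t).
have [f hf] : exists f : forall u : triple (@P),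
    c_hom (se S (t_ik u)) (comp1 (se S (t_jk u)) (se S (t_ij u))), forall u, Q u (f u).
  apply: dep_choice => u; rewrite /Q.
  have [lij|nij] := ltnP (t_i u) (t_j u); last first.
    case: u nij => i j k ij jk ik q /= ji.
    have e : i = j by apply: val_inj; apply/eqP; rewrite eqn_leq ij.
    subst j; have [t et] : exists t : c_hom (se S ik) (comp1 (se S jk) (se S ij)),
        arr_eq t (c_id (se S ik)).
      by apply: arr_cast => //; rewrite se_id comp1_1r; exact: se_irr.
    by exists t; split.
  have [ljk|njk] := ltnP (t_j u) (t_k u); last first.
    case: u lij njk => i j k ij jk ik q /= lij kj.
    have e : j = k by apply: val_inj; apply/eqP; rewrite eqn_leq jk.
    subst k; have [t et] : exists t : c_hom (se S ik) (comp1 (se S jk) (se S ij)),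
        arr_eq t (c_id (se S ik)).
      by apply: arr_cast => //; rewrite se_id comp1_1l; exact: se_irr.
    by exists t; split.
  have [t ht] := hR u lij ljk; exists t; split=> // -[e|e].
    by rewrite e ltnn in lij.
  by rewrite e ltnn in ljk.
pose f' i j k ij jk ik q := f (@Triple n (@P) i j k ij jk ik q).
have idl (i j : 'I_n.+1) (ii : i <= i) (ij ij' : i <= j) q :
    arr_eq (f' i i j ii ij ij' q) (c_id (se S ij)).
  apply: arr_eq_trans (arr_eq_id (se_irr S ij' ij)).
  by have [/(_ (or_introl erefl))] := hf (@Triple n (@P) i i j ii ij ij' q).
have idr (i j : 'I_n.+1) (ij ij' : i <= j) (jj : j <= j) q :
    arr_eq (f' i j j ij jj ij' q) (c_id (se S ij)).
  apply: arr_eq_trans (arr_eq_id (se_irr S ij' ij)).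
  by have [/(_ (or_intror erefl))] := hf (@Triple n (@P) i j j ij jj ij' q).
exists (Cells idl idr) => -[i j k ij jk ik q] /=.
by have [_] := hf (@Triple n (@P) i j k ij jk ik q).
Qed.

End Complete.

Section Cells3.

Context {B : two_cat} (S : skel B 3) (P : subpred 3).

Let hom3 (a b c : 'I_4) (ab : a <= b) (bc : b <= c) (ac : a <= c) :=
  c_hom (se S ac) (comp1 (se S bc) (se S ab)).

(** Each face is specified by a predicate under the premise that it belongs to [P], so that one
    statement builds both complete simplices and horns. *)
Lemma cells3 (R012 : @hom3 o30 o31 o32 isT isT isT -> Prop)
    (R013 : @hom3 o30 o31 o33 isT isT isT -> Prop)
    (R023 : @hom3 o30 o32 o33 isT isT isT -> Prop)
    (R123 : @hom3 o31 o32 o33 isT isT isT -> Prop) :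
  (P (tri3 o30 o31 o32) -> exists t, R012 t) ->
  (P (tri3 o30 o31 o33) -> exists t, R013 t) ->
  (P (tri3 o30 o32 o33) -> exists t, R023 t) ->
  (P (tri3 o31 o32 o33) -> exists t, R123 t) ->
  exists T : cells S (@P),
    [/\ forall q, R012 (ct3 T o30 o31 o32 q),
        forall q, R013 (ct3 T o30 o31 o33 q),
        forall q, R023 (ct3 T o30 o32 o33 q)
      & forall q, R123 (ct3 T o31 o32 o33 q)].
Proof.
move=> h012 h013 h023 h123.
pose R (u : triple (@P)) (t : c_hom (se S (t_ik u)) (comp1 (se S (t_jk u)) (se S (t_ij u)))) :=
  [/\ t_i u = o30 -> t_j u = o31 -> t_k u = o32 -> exists2 s, R012 s & tri_eq s t,
      t_i u = o30 -> t_j u = o31 -> t_k u = o33 -> exists2 s, R013 s & tri_eq s t,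
      t_i u = o30 -> t_j u = o32 -> t_k u = o33 -> exists2 s, R023 s & tri_eq s t
    & t_i u = o31 -> t_j u = o32 -> t_k u = o33 -> exists2 s, R123 s & tri_eq s t].
have [u|T hT] := @complete_cells _ _ S (@P) R.
  case: u => i j k ij jk ik q /= lij ljk; move: ij jk ik q lij ljk; rewrite /R /=.
  elim/ord4_ind: i; elim/ord4_ind: j => //; elim/ord4_ind: k => // ij jk ik q _ _;
    move: q; irr ij; irr jk; irr ik => q.
  - have [t ht] := h012 q; exists t; split=> // _ _ _; exists t => //; exact: tri_eq_refl.
  - have [t ht] := h013 q; exists t; split=> // _ _ _; exists t => //; exact: tri_eq_refl.
  - have [t ht] := h023 q; exists t; split=> // _ _ _; exists t => //; exact: tri_eq_refl.
  - have [t ht] := h123 q; exists t; split=> // _ _ _; exists t => //; exact: tri_eq_refl.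
exists T; split=> q.
- have [/(_ erefl erefl erefl) [s hs /tri_eq_eq <-] _ _ _] :=
    hT (@Triple 3 (@P) o30 o31 o32 isT isT isT q) isT isT.
  exact: hs.
- have [_ /(_ erefl erefl erefl) [s hs /tri_eq_eq <-] _ _] :=
    hT (@Triple 3 (@P) o30 o31 o33 isT isT isT q) isT isT.
  exact: hs.
- have [_ _ /(_ erefl erefl erefl) [s hs /tri_eq_eq <-] _] :=
    hT (@Triple 3 (@P) o30 o32 o33 isT isT isT q) isT isT.
  exact: hs.
- have [_ _ _ /(_ erefl erefl erefl) [s hs /tri_eq_eq <-]] :=
    hT (@Triple 3 (@P) o31 o32 o33 isT isT isT q) isT isT.
  exact: hs.
Qed.

End Cells3.

Section Skeleta.

Context {B : two_cat} (x0 x1 x2 x3 : B) (f01 : hom x0 x1) (f02 : hom x0 x2)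
  (f03 : hom x0 x3) (f12 : hom x1 x2) (f13 : hom x1 x3) (f23 : hom x2 x3).

Let v (i : nat) : B := match i with 0 => x0 | 1 => x1 | 2 => x2 | _ => x3 end.

(** Indexed by natural numbers rather than ordinals, so that an edge between literal vertices
    reduces to the given 1-morphism. *)
Let e (i j : nat) : i <= j -> hom (v i) (v j) :=
  match i, j return i <= j -> hom (v i) (v j) with
  | 0, 0 => fun _ => id1 x0
  | 0, 1 => fun _ => f01
  | 0, 2 => fun _ => f02
  | 0, _ => fun _ => f03
  | 1, 1 => fun _ => id1 x1
  | 1, 2 => fun _ => f12
  | 1, j.+3 => fun _ => f13
  | 2, 2 => fun _ => id1 x2
  | 2, j.+3 => fun _ => f23
  | i.+3, j.+3 => fun _ => id1 x3
  | 1, 0 => fun h => False_rect _ (notF h)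
  | 2, 0 => fun h => False_rect _ (notF h)
  | 2, 1 => fun h => False_rect _ (notF h)
  | i.+3, 0 => fun h => False_rect _ (notF h)
  | i.+3, 1 => fun h => False_rect _ (notF h)
  | i.+3, 2 => fun h => False_rect _ (notF h)
  end.

Definition skel3 : skel B 3.
Proof.
refine (@Skel B 3 (fun i => v (val i)) (fun i j ij => e ij) _).
by move=> [[|[|[|i]]] hi].
Defined.

Definition skel2 : skel B 2.
Proof.
refine (@Skel B 2 (fun i => v (val i)) (fun i j ij => e ij) _).
by move=> [[|[|[|i]]] hi].
Defined.

Definition skel1 : skel B 1.
Proof.
refine (@Skel B 1 (fun i => v (val i)) (fun i j ij => e ij) _).
by move=> [[|[|[|i]]] hi].
Defined.

End Skeleta.

Lemma nerve1_of (B : two_cat) (x y : B) (f : hom x y) :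
  exists e : nerve B 1, hom_eq f (de01 e).
Proof.
pose S := skel1 f f f (id1 y) (id1 y) (id1 y).
have [u lij ljk|T _] := @complete_cells _ _ S (@predT_sub 1) (fun _ _ => True).
  case: u lij ljk => i j k ij jk ik q /=.
  by elim/ord2_ind: i ij ik q; elim/ord2_ind: j jk => //; elim/ord2_ind: k.
have AT : cells_assoc T.
  move=> i j k l ij jk kl ik jl il q1 q2 q3 q4 _; apply: cells_assoc_degenerate.
  by elim/ord2_ind: i ij ik il q1 q2 q3; elim/ord2_ind: j jk jl q4 => //;
    elim/ord2_ind: k kl => //; elim/ord2_ind: l.
by exists (cells_simplex AT); exact: hom_eq_refl.
Qed.

Lemma nerve2_of (B : two_cat) (x y z : B) (f : hom x y) (g : hom y z) (h : hom x z)
    (t : c_hom h (comp1 g f)) : exists s : nerve B 2, tri_eq t (dt012 s).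
Proof.
pose S := skel2 f h h g g (id1 z).
have [u lij ljk|T hT] := @complete_cells _ _ S (@predT_sub 2) (fun _ s => tri_eq t s).
  case: u lij ljk => i j k ij jk ik q /=; elim/ord3_ind: i ij ik q;
    elim/ord3_ind: j jk => //; elim/ord3_ind: k => // jk ij ik q _ _.
  by exists t; exact: tri_eq_refl.
have AT : cells_assoc T.
  move=> i j k l ij jk kl ik jl il q1 q2 q3 q4 _; apply: cells_assoc_degenerate.
  by elim/ord3_ind: i ij ik il q1 q2 q3; elim/ord3_ind: j jk jl q4 => //;
    elim/ord3_ind: k kl => //; elim/ord3_ind: l.
exists (cells_simplex AT).
exact: (hT (@Triple 2 (@predT_sub 2) o20 o21 o22 isT isT isT isT)).
Qed.

Definition yoneda {B : two_cat} {n} (D : duskin B n) : smap (simplex n) (nerve B) :=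
  @SMap (simplex n) (nerve B) (fun m x => duskin_act x D) (fun m k a x => erefl).

Lemma yoneda_id (B : two_cat) n (D : duskin B n) : yoneda D n (mono_id n) = D.
Proof. by case: D. Qed.

Lemma ct_arr_eq (B : two_cat) n (S : skel B n) (P : subpred n) (T : cells S P)
    (i j k : 'I_n.+1) (ij ij' : i <= j) (jk jk' : j <= k) (ik ik' : i <= k) q q' :
  arr_eq (ct T ij jk ik q) (ct T ij' jk' ik' q').
Proof.
rewrite (bool_irrelevance ij' ij) (bool_irrelevance jk' jk) (bool_irrelevance ik' ik) in q' *.
rewrite (bool_irrelevance q q'); exact: arr_eq_refl.
Qed.

Lemma wl_idl (B : two_cat) (x y z : B) (h : hom y z) (f f' k : hom x y)
    (a : c_hom f f') (g : hom x z) (u : c_hom g (comp1 h f)) :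
  arr_eq a (c_id k) -> arr_eq (c_comp (wl h a) u) u.
Proof.
by move=> e; apply: comp_het_idl (arr_eq_trans (wl_arr_eq erefl e) _);
  rewrite wl_id; exact: arr_eq_refl.
Qed.

Lemma wr_idl (B : two_cat) (x y z : B) (h : hom x y) (f f' k : hom y z)
    (a : c_hom f f') (g : hom x z) (u : c_hom g (comp1 f h)) :
  arr_eq a (c_id k) -> arr_eq (c_comp (wr a h) u) u.
Proof.
by move=> e; apply: comp_het_idl (arr_eq_trans (wr_arr_eq erefl e) _);
  rewrite wr_id; exact: arr_eq_refl.
Qed.

Section Cells.

Context {B : two_cat}.

Lemma ct_eq_ord n (S : skel B n) (P : subpred n) (T : cells S P)
    (i j k i' j' k' : 'I_n.+1) (ij : i <= j) (jk : j <= k) (ik : i <= k)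
    (ij' : i' <= j') (jk' : j' <= k') (ik' : i' <= k') q q' :
  i = i' -> j = j' -> k = k' ->
  tri_eq (ct T ij jk ik q) (ct T ij' jk' ik' q').
Proof. by move=> ei ej ek; subst i' j' k'; exact: ct_eq. Qed.

Lemma cells_map_tri n (P : subpred n) (hP : sub_closed P) (S : skel B n)
    (T : cells S P) (AT : cells_assoc T) (t : sub_sset hP 2) (i j k : 'I_n.+1)
    (ij : i <= j) (jk : j <= k) (ik : i <= k) q :
  on_vertices [:: val i; val j; val k] (val t : mono 2 n) ->
  tri_eq (dt012 (cells_map hP AT 2 t)) (ct T ij jk ik q).
Proof.
move=> h; apply: ct_eq_ord; apply: val_inj; rewrite /=.
- exact: on_vertices_val o20 h.
- exact: on_vertices_val o21 h.
- exact: on_vertices_val o22 h.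
Qed.

Lemma cells_map_edg n (P : subpred n) (hP : sub_closed P) (S : skel B n)
    (T : cells S P) (AT : cells_assoc T) (t : sub_sset hP 1) (i j : 'I_n.+1)
    (ij : i <= j) :
  on_vertices [:: val i; val j] (val t : mono 1 n) ->
  hom_eq (de01 (cells_map hP AT 1 t)) (se S ij).
Proof.
move=> h.
have ei : (val t : mono 1 n) o10 = i by apply: val_inj; exact: on_vertices_val o10 h.
have ej : (val t : mono 1 n) o11 = j by apply: val_inj; exact: on_vertices_val o11 h.
subst i j; exact: eq_hom_eq (se_irr _ _ _).
Qed.

Lemma cells_ext n (S : skel B n) (P : subpred n) (T1 T2 : cells S P)
    (i j k : 'I_n.+1) (ij : i <= j) (jk : j <= k) (ik : i <= k) q :
  (i < j -> j < k -> ct T1 ij jk ik q = ct T2 ij jk ik q) ->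
  ct T1 ij jk ik q = ct T2 ij jk ik q.
Proof.
have [lij|nij] := ltnP i j; last first.
  have e : i = j by apply: val_inj; apply/eqP; rewrite eqn_leq ij.
  subst j => _; apply: arr_eq_eq; apply: arr_eq_trans (ct_idl T1 _ _) _.
  exact: arr_eq_sym (ct_idl T2 _ _).
have [ljk|njk] := ltnP j k; first exact.
have e : j = k by apply: val_inj; apply/eqP; rewrite eqn_leq jk.
subst k => _; apply: arr_eq_eq; apply: arr_eq_trans (ct_idr T1 _ _) _.
exact: arr_eq_sym (ct_idr T2 _ _).
Qed.

Definition skel_act m n (x : mono m n) (S : skel B n) : skel B m :=
  @Skel B m (fun i => S (x i)) (fun i j ij => se S (moP x ij))
    (fun i ii => se_id S (moP x ii)).

Definition cells_act m n (x : mono m n) (S : skel B n) (T : cells S (@predT_sub n)) :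
    cells (skel_act x S) (@predT_sub m) :=
  @Cells B m (skel_act x S) (@predT_sub m)
    (fun i j k ij jk ik _ => ct T (moP x ij) (moP x jk) (moP x ik) isT)
    (fun i j ii ij ij' _ => ct_idl T (moP x ij') isT)
    (fun i j ij ij' jj _ => ct_idr T (moP x ij') isT).

Lemma cells_act_assoc m n (x : mono m n) (S : skel B n) (T : cells S (@predT_sub n)) :
  cells_assoc T -> cells_assoc (cells_act x T).
Proof. by move=> AT i j k l *; exact: AT. Qed.

Section Mix.

Context {n : nat} {S : skel B n} (U1 U2 : cells S (@predT_sub n)) (P : subpred n)
  (a b c : 'I_n.+1).

Definition mix_ct (i j k : 'I_n.+1) (ij : i <= j) (jk : j <= k) (ik : i <= k)
    (q : P (tri ij jk)) : c_hom (se S ik) (comp1 (se S jk) (se S ij)) :=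
  if [&& i == a, j == b & k == c] then ct U2 ij jk ik isT else ct U1 ij jk ik isT.

Lemma mix_idl (i j : 'I_n.+1) (ii : i <= i) (ij ij' : i <= j) q :
  arr_eq (@mix_ct i i j ii ij ij' q) (c_id (se S ij)).
Proof. by rewrite /mix_ct; case: ifP => _; exact: ct_idl. Qed.

Lemma mix_idr (i j : 'I_n.+1) (ij ij' : i <= j) (jj : j <= j) q :
  arr_eq (@mix_ct i j j ij jj ij' q) (c_id (se S ij)).
Proof. by rewrite /mix_ct; case: ifP => _; exact: ct_idr. Qed.

Definition mix : cells S (@P) := Cells mix_idl mix_idr.

Lemma mix1 (i j k : 'I_n.+1) (ij : i <= j) (jk : j <= k) (ik : i <= k) q :
  ~~ [&& i == a, j == b & k == c] -> ct mix ij jk ik q = ct U1 ij jk ik isT.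
Proof. by rewrite /= /mix_ct => /negbTE ->. Qed.

Lemma mix2 (i j k : 'I_n.+1) (ij : i <= j) (jk : j <= k) (ik : i <= k) q :
  [&& i == a, j == b & k == c] -> ct mix ij jk ik q = ct U2 ij jk ik isT.
Proof. by rewrite /= /mix_ct => ->. Qed.

End Mix.

End Cells.

(** * Universal properties extracted from horn fillers *)

Section Converse.

Context {B C : two_cat} (F : two_functor B C).

Lemma cells_lift n h (S : skel B n) (T : cells S (@horn_pred n h)) (AT : cells_assoc T)
    (T' : cells (skelF F S) (@predT_sub n)) (AT' : cells_assoc T') :
  3 <= n -> extends T' (cellsF F T) ->
  (forall g : smap (simplex n) (Nsc C),
    lift_problem (horn_incl n h) (nerve_map F) (cells_map (@horn_closed n h) AT) g ->
    has_lift (horn_incl n h) (nerve_map F) (cells_map (@horn_closed n h) AT) g) ->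
  lift_cells F T T'.
Proof.
move=> n3 ex hl.
have lp : lift_problem (horn_incl n h) (nerve_map F) (cells_map (@horn_closed n h) AT)
    (yoneda (cells_simplex AT') : smap (simplex n) (Nsc C)).
  move=> m x /=; rewrite nerve_fun_cells; symmetry; exact: simplex_extends.
apply: (cells_has_lift (horn_edg h n3) (f := cells_map (@horn_closed n h) AT) _ _ (hl _ lp)).
  by move=> m x.
exact: yoneda_id.
Qed.

Lemma converse3 h (S : skel B 3) (T : cells S (@horn_pred 3 h)) (AT : cells_assoc T)
    (a b c : 'I_4) (ab : a <= b) (bc : b <= c) (ac : a <= c)
    (s : c_hom (se (skelF F S) ac) (comp1 (se (skelF F S) bc) (se (skelF F S) ab))) :
  a != b -> b != c ->
  (forall (i j k : 'I_4) (ij : i <= j) (jk : j <= k),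
    ~~ @horn_pred 3 h 2 (tri ij jk) -> [/\ i = a, j = b & k = c]) ->
  ~~ @horn_pred 3 h 2 (tri ab bc) ->
  (forall T' : cells (skelF F S) (@predT_sub 3), extends T' (cellsF F T) ->
    ct T' ab bc ac isT = s ->
    arr_eq (assocL (ct3 T' o30 o31 o32 isT)
                 (ct3 T' o30 o32 o33 isT))
         (assocR (ct3 T' o30 o31 o33 isT)
                 (ct3 T' o31 o32 o33 isT))) ->
  (forall g : smap (simplex 3) (Nsc C),
    lift_problem (horn_incl 3 h) (nerve_map F) (cells_map (@horn_closed 3 h) AT) g ->
    has_lift (horn_incl 3 h) (nerve_map F) (cells_map (@horn_closed 3 h) AT) g) ->
  exists T'' : cells S (@predT_sub 3),
    [/\ cells_assoc T'', extends T'' T & Fc F (ct T'' ab bc ac isT) = s].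
Proof.
move=> neab nebc mis nab asT hl.
have [T' [ex /(_ nab) tE]] := add_cell (cellsF F T) s neab nebc mis.
have AT' : cells_assoc T'.
  apply: cells_assoc3 => q1 q2 q3 q4 _.
  irr q1; irr q2; irr q3; irr q4; exact: asT.
have [T'' [AT'' ex'' eF]] := cells_lift AT' (isT : 3 <= 3) ex hl.
by exists T''; split=> //; rewrite eF.
Qed.

(** The degeneracy operator [s_2]; [rep1] is [s_1]. *)
Definition rep2 (a : 'I_5) : 'I_4 :=
  match val a with 0 => o30 | 1 => o31 | 2 => o32 | 3 => o32 | _ => o33 end.

Lemma rep2_mono (a b : 'I_5) : a <= b -> rep2 a <= rep2 b.
Proof. by elim/ord5_ind: a; elim/ord5_ind: b. Qed.

Definition rep1 (a : 'I_5) : 'I_4 :=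
  match val a with 0 => o30 | 1 => o31 | 2 => o31 | 3 => o32 | _ => o33 end.

Lemma rep1_mono (a b : 'I_5) : a <= b -> rep1 a <= rep1 b.
Proof. by elim/ord5_ind: a; elim/ord5_ind: b. Qed.

Section Left.

Context {S : skel B 3} (T1 T2 : cells S (@predT_sub 3)).
Hypothesis A1 : cells_assoc T1.
Hypothesis A2 : cells_assoc T2.
Hypothesis agree : forall (i j k : 'I_4) (ij : i <= j) (jk : j <= k) (ik : i <= k),
  i = o30 -> ct T1 ij jk ik isT = ct T2 ij jk ik isT.
Hypothesis agreeF : forall (i j k : 'I_4) (ij : i <= j) (jk : j <= k) (ik : i <= k),
  Fc F (ct T1 ij jk ik isT) = Fc F (ct T2 ij jk ik isT).

Let d := Mono rep2_mono.
Let U1 := cells_act d T1.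
Let U2 := cells_act d T2.
Let U := mix U1 U2 (@horn_pred 4 0) o41 o42 o44.

(* T1 and T2 differ only in their missing face. The degenerate 4-simplex on T1,
   with the triangle 124 replaced by that of T2, is still a horn, as its faces
   containing the vertex 0 commute; a filler makes the face 1234 commute, which
   says that T1 and T2 agree. *)
Lemma left_mix_assoc : cells_assoc U.
Proof.
move=> i j k l ij jk kl ik jl il q1 q2 q3 q4 q.
have [dg|/norP[nij /norP[njk nkl]]] := boolP [|| i == j, j == k | k == l].
  exact: cells_assoc_degenerate.
(* A nondegenerate 3-dimensional face in the horn omits a vertex other than 0, and only that one, so
   it contains 0. *)
have i0 : i = o40.
  case/existsP: q => x /andP[x0 /forallP hx].
  move: (hx o30) (hx o31) (hx o32) (hx o33) => /= {hx}.
  clear q1 q2 q3 q4; elim/ord5_ind: i nij ij ik il => //; elim/ord5_ind: j njk jk jl => //;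
  elim/ord5_ind: k nkl kl => //; elim/ord5_ind: l => //; by elim/ord5_ind: x x0.
subst i; rewrite [ct U ij jk ik q1]mix1 // [ct U ik kl il q2]mix1 // [ct U ij jl il q3]mix1 //.
have [sp|nsp] := boolP [&& j == o41, k == o42 & l == o44]; last first.
  rewrite [ct U jk kl jl q4]mix1 //; by apply: (cells_act_assoc d A1).
rewrite [ct U jk kl jl q4]mix2 //.
have ag (j' k' : 'I_5) (ij' : o40 <= j') (jk' : j' <= k') (ik' : o40 <= k') :
    ct U1 ij' jk' ik' isT = ct U2 ij' jk' ik' isT by exact: agree.
rewrite !ag; by apply: (cells_act_assoc d A2).
Qed.

Lemma left_mix_unique :
  (forall g : smap (simplex 4) (Nsc C),
    lift_problem (horn_incl 4 0) (nerve_map F)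
      (cells_map (@horn_closed 4 0) left_mix_assoc) g ->
    has_lift (horn_incl 4 0) (nerve_map F)
      (cells_map (@horn_closed 4 0) left_mix_assoc) g) ->
  ct3 T1 o31 o32 o33 isT =
  ct3 T2 o31 o32 o33 isT.
Proof.
move=> hl.
have ex : extends (cellsF F U1) (cellsF F U).
  move=> i j k ij jk ik q /=; rewrite /mix_ct; case: ifP => _ //; exact: agreeF.
have [T'' [AT'' ex'' _]] :=
  cells_lift (cellsF_assoc F (cells_act_assoc d A1)) (isT : 3 <= 4) ex hl.
have q (i j k : 'I_5) (ij : i <= j) (jk : j <= k) : @horn_pred 4 0 2 (tri ij jk).
  exact: horn_small.
pose M (i j k : 'I_5) (ij : i <= j) (jk : j <= k) (ik : i <= k) := ct T'' ij jk ik isT.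
have m1 i j k ij jk ik : ~~ [&& i == o41, j == o42 & k == o44] ->
    M i j k ij jk ik = ct U1 ij jk ik isT.
  by move=> h; rewrite /M (ex'' _ _ _ _ _ _ (q _ _ _ _ _)); exact: mix1.
have m2 i j k ij jk ik : [&& i == o41, j == o42 & k == o44] ->
    M i j k ij jk ik = ct U2 ij jk ik isT.
  by move=> h; rewrite /M (ex'' _ _ _ _ _ _ (q _ _ _ _ _)); exact: mix2.
have := AT'' o41 o42 o43 o44 isT isT isT isT isT isT isT isT isT isT isT.
rewrite -!/(M _ _ _ _ _ _).
rewrite (m1 o41 o42 o43) // (m1 o41 o43 o44) //.
rewrite (m2 o41 o42 o44) // (m1 o42 o43 o44) //.
move=> e; apply: arr_eq_eq.
(* In the face 1234 the triangles 123 and 234 are degenerate, so the condition compares 134, which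
   is the face 123 of [T1], with 124, which is that of [T2]. *)
have i1 : arr_eq (ct3 U1 o41 o42 o43 isT)
    (c_id (se S (@rep2_mono o41 o42 isT))).
  exact: (ct_idr T1).
have i2 : arr_eq (ct3 U1 o42 o43 o44 isT)
    (c_id (se S (@rep2_mono o43 o44 isT))).
  exact: (ct_idl T1).
have e1 : arr_eq (ct3 T1 o31 o32 o33 isT)
    (ct3 U1 o41 o43 o44 isT).
  exact: (@ct_arr_eq _ 3 S _ T1 o31 o32 o33).
have e2 : arr_eq (ct3 U2 o41 o42 o44 isT)
    (ct3 T2 o31 o32 o33 isT).
  exact: (@ct_arr_eq _ 3 S _ T2 o31 o32 o33).
apply: arr_eq_trans e1 _; apply: arr_eq_trans e2.
apply: arr_eq_trans (arr_eq_sym (wl_idl _ i1)) _.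
by apply: arr_eq_trans e _; exact: wr_idl i2.
Qed.

End Left.

Section Right.

Context {S : skel B 3} (T1 T2 : cells S (@predT_sub 3)).
Hypothesis A1 : cells_assoc T1.
Hypothesis A2 : cells_assoc T2.
Hypothesis agree : forall (i j k : 'I_4) (ij : i <= j) (jk : j <= k) (ik : i <= k),
  k = o33 -> ct T1 ij jk ik isT = ct T2 ij jk ik isT.
Hypothesis agreeF : forall (i j k : 'I_4) (ij : i <= j) (jk : j <= k) (ik : i <= k),
  Fc F (ct T1 ij jk ik isT) = Fc F (ct T2 ij jk ik isT).

Let d := Mono rep1_mono.
Let U1 := cells_act d T1.
Let U2 := cells_act d T2.
Let U := mix U1 U2 (@horn_pred 4 4) o40 o42 o43.

(** The mirror image of [left_mix_assoc]: the vertex 1 is repeated, the triangle 023 is exchanged,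
    and each nondegenerate 3-dimensional face of the horn contains the last vertex; [T1] and [T2]
    agree on the triangles ending there. *)
Lemma right_mix_assoc : cells_assoc U.
Proof.
move=> i j k l ij jk kl ik jl il q1 q2 q3 q4 q.
have [dg|/norP[nij /norP[njk nkl]]] := boolP [|| i == j, j == k | k == l].
  exact: cells_assoc_degenerate.
have l4 : l = o44.
  case/existsP: q => x /andP[x0 /forallP hx].
  move: (hx o30) (hx o31) (hx o32) (hx o33) => /= {hx}.
  clear q1 q2 q3 q4; elim/ord5_ind: i nij ij ik il => //; elim/ord5_ind: j njk jk jl => //;
  elim/ord5_ind: k nkl kl => //; elim/ord5_ind: l => //; by elim/ord5_ind: x x0.
subst l; rewrite [ct U ik kl il q2]mix1 ?andbF // [ct U ij jl il q3]mix1 ?andbF //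
  [ct U jk kl jl q4]mix1 ?andbF //.
have [sp|nsp] := boolP [&& i == o40, j == o42 & k == o43]; last first.
  rewrite [ct U ij jk ik q1]mix1 //; by apply: (cells_act_assoc d A1).
rewrite [ct U ij jk ik q1]mix2 //.
have ag (i' j' : 'I_5) (ij' : i' <= j') (jk' : j' <= o44) (ik' : i' <= o44) :
    ct U1 ij' jk' ik' isT = ct U2 ij' jk' ik' isT by exact: agree.
rewrite !ag; by apply: (cells_act_assoc d A2).
Qed.

Lemma right_mix_unique :
  (forall g : smap (simplex 4) (Nsc C),
    lift_problem (horn_incl 4 4) (nerve_map F)
      (cells_map (@horn_closed 4 4) right_mix_assoc) g ->
    has_lift (horn_incl 4 4) (nerve_map F)
      (cells_map (@horn_closed 4 4) right_mix_assoc) g) ->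
  ct3 T1 o30 o31 o32 isT =
  ct3 T2 o30 o31 o32 isT.
Proof.
move=> hl.
have ex : extends (cellsF F U1) (cellsF F U).
  move=> i j k ij jk ik q /=; rewrite /mix_ct; case: ifP => _ //; exact: agreeF.
have [T'' [AT'' ex'' _]] :=
  cells_lift (cellsF_assoc F (cells_act_assoc d A1)) (isT : 3 <= 4) ex hl.
have q (i j k : 'I_5) (ij : i <= j) (jk : j <= k) : @horn_pred 4 4 2 (tri ij jk).
  exact: horn_small.
pose M (i j k : 'I_5) (ij : i <= j) (jk : j <= k) (ik : i <= k) := ct T'' ij jk ik isT.
have m1 i j k ij jk ik : ~~ [&& i == o40, j == o42 & k == o43] ->
    M i j k ij jk ik = ct U1 ij jk ik isT.
  by move=> h; rewrite /M (ex'' _ _ _ _ _ _ (q _ _ _ _ _)); exact: mix1.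
have m2 i j k ij jk ik : [&& i == o40, j == o42 & k == o43] ->
    M i j k ij jk ik = ct U2 ij jk ik isT.
  by move=> h; rewrite /M (ex'' _ _ _ _ _ _ (q _ _ _ _ _)); exact: mix2.
have := AT'' o40 o41 o42 o43 isT isT isT isT isT isT isT isT isT isT isT.
rewrite -!/(M _ _ _ _ _ _).
rewrite (m1 o40 o41 o42) // (m2 o40 o42 o43) //.
rewrite (m1 o40 o41 o43) // (m1 o41 o42 o43) //.
move=> e; apply: arr_eq_eq.
have i1 : arr_eq (ct3 U1 o40 o41 o42 isT)
    (c_id (se S (@rep1_mono o40 o41 isT))).
  exact: (ct_idr T1).
have i2 : arr_eq (ct3 U1 o41 o42 o43 isT)
    (c_id (se S (@rep1_mono o42 o43 isT))).
  exact: (ct_idl T1).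
have e1 : arr_eq (ct3 T1 o30 o31 o32 isT)
    (ct3 U1 o40 o41 o43 isT).
  exact: (@ct_arr_eq _ 3 S _ T1 o30 o31 o32).
have e2 : arr_eq (ct3 U2 o40 o42 o43 isT)
    (ct3 T2 o30 o31 o32 isT).
  exact: (@ct_arr_eq _ 3 S _ T2 o30 o31 o32).
apply: arr_eq_trans e1 _; apply: arr_eq_trans e2; apply: arr_eq_sym.
apply: arr_eq_trans (arr_eq_sym (wl_idl _ i1)) _.
by apply: arr_eq_trans e _; exact: wr_idl i2.
Qed.

End Right.

End Converse.

Section AssocUnits.

Context {B : two_cat} {x0 x1 x2 x3 : B} {f01 : hom x0 x1} {f02 : hom x0 x2}
  {f03 : hom x0 x3} {f12 : hom x1 x2} {f13 : hom x1 x3} {f23 : hom x2 x3}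
  (t012 : c_hom f02 (comp1 f12 f01)) (t013 : c_hom f03 (comp1 f13 f01))
  (t023 : c_hom f03 (comp1 f23 f02)) (t123 : c_hom f13 (comp1 f23 f12)).

Lemma assocL_id012 k : arr_eq t012 (c_id k) -> arr_eq (assocL t012 t023) t023.
Proof. exact: wl_idl. Qed.

Lemma assocL_id023 k : arr_eq t023 (c_id k) -> arr_eq (assocL t012 t023) (wl f23 t012).
Proof. exact: comp_het_idr. Qed.

Lemma assocR_id123 k : arr_eq t123 (c_id k) -> arr_eq (assocR t013 t123) t013.
Proof. exact: wr_idl. Qed.

End AssocUnits.

Lemma assocR_id01 (B : two_cat) (x y z : B) (f01 : hom x x) (f03 : hom x z)
    (f12 : hom x y) (f13 : hom x z) (f23 : hom y z)
    (t013 : c_hom f03 (comp1 f13 f01)) (t123 : c_hom f13 (comp1 f23 f12))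
    (m n : hom x z) (t : c_hom m n) (u : c_hom f03 m) :
  f01 = id1 x -> arr_eq t t123 -> arr_eq u t013 ->
  arr_eq (assocR t013 t123) (c_comp t u).
Proof.
move=> e et eu; apply: arr_eq_comp; first exact: arr_eq_sym.
by apply: arr_eq_trans (arr_eq_sym et); rewrite e; exact: wr_1.
Qed.

Lemma val_coface n i (j : 'I_n.+1) : i <= n.+1 -> val (@coface n i j) = bump i j.
Proof. by move=> h; rewrite /= inordK. Qed.

Lemma horn3_quad h : ~~ @horn_pred 3 h 3 (@quad 3 o30 o31 o32 o33 isT isT isT).
Proof.
apply/negP => /existsP[x /andP[_ /forallP hx]].
by move: (hx o30) (hx o31) (hx o32) (hx o33) => {hx};
  elim/ord4_ind: x.
Qed.

Section Characterize.

Context {B C : two_cat} (F : two_functor B C).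

Lemma p_cocartesian_cocart_raw (x y : B) (f f' : hom x y)
    (tau : c_hom f (comp1 f' (id1 x))) (s : nerve B 2) :
  tri_eq tau (dt012 s) -> @p_cocartesian (Nsc B) (Nsc C) (nerve_map F) s ->
  cocartesian2 F tau.
Proof.
move=> es ps k v w e.
have [v' ev] : exists v' : c_hom f (comp1 (id1 y) k), arr_eq v' v.
  by apply: arr_cast; rewrite ?comp1_1l.
have [i ei] : exists i : c_hom k (comp1 k (id1 x)), arr_eq i (c_id k).
  by apply: arr_cast; rewrite ?comp1_1r.
have [w' ew] : exists w' : c_hom (F1 F f') (comp1 (F1 F (id1 y)) (F1 F k)), arr_eq w' w.
  by apply: arr_cast; rewrite ?F1_id ?comp1_1l ?comp1_1r.
(* A 3-simplex on [x, x, y, y] with a unit as 012, [tau] as 013, [v] as 023 and the sought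
   factorization as 123; by [eB] its associativity condition is [t tau = v]. *)
pose S := skel3 (id1 x) k f k f' (id1 y).
have eF : arr_eq (assocL (Fc F i) (Fc F v')) (assocR (Fc F tau) w').
  apply: (arr_eq_trans (u' := F2 F v)).
    have ei' : arr_eq (Fc F i) (c_id (F1 F k)).
      by apply: arr_eq_trans (FcE F _) _; rewrite -f_id; exact: F2_arr_eq.
    apply: arr_eq_trans (assocL_id012 _ ei') _.
    by apply: arr_eq_trans (FcE F _) _; exact: F2_arr_eq.
  rewrite -[F2 F v]e; apply: arr_eq_sym.
  apply: (assocR_id01 (F1_id F x) (arr_eq_sym ew)).
  exact: arr_eq_sym (FcE F tau).
have eB (t : c_hom (comp1 f' (id1 x)) k) (t' : c_hom f' (comp1 (id1 y) k)) :
    arr_eq t t' -> (arr_eq (assocL i v') (assocR tau t') <-> c_comp t tau = v).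
  move=> et.
  have h1 := arr_eq_trans (assocL_id012 v' ei) ev.
  have h2 := assocR_id01 erefl et (arr_eq_refl tau).
  split=> [h|h].
    by apply: arr_eq_eq; apply: arr_eq_trans (arr_eq_sym h2) _;
      apply: arr_eq_trans (arr_eq_sym h) h1.
  by apply: arr_eq_trans h1 _; apply: arr_eq_sym; rewrite -h.
have p012 : @horn_pred 3 0 2 (tri3 o30 o31 o32) by in_horn (o33).
have p013 : @horn_pred 3 0 2 (tri3 o30 o31 o33) by in_horn (o32).
have p023 : @horn_pred 3 0 2 (tri3 o30 o32 o33) by in_horn (o31).
have ext : exists t : c_hom (comp1 f' (id1 x)) k, F2 F t = w /\ c_comp t tau = v.
  have [T [T012 T013 T023 _]] := @cells3 B S (@horn_pred 3 0) (fun t => t = i)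
    (fun t => t = tau) (fun t => t = v') (fun _ => True)
    (fun _ => ex_intro _ i erefl) (fun _ => ex_intro _ tau erefl)
    (fun _ => ex_intro _ v' erefl) (fun h => False_ind _ (negP horn3_tri_0 h)).
  have AT : cells_assoc T.
    by apply: cells_assoc3 => q1 q2 q3 q4 q; case/negP: (horn3_quad 0).
  have [|g lp|T'' [AT'' ex'' eT]] := @converse3 B C F 0 S T AT o31 o32 o33
    isT isT isT w' isT isT missing3_0 horn3_tri_0.
  - move=> T' ex h; rewrite h (ex _ _ _ _ _ _ p012) (ex _ _ _ _ _ _ p013) (ex _ _ _ _ _ _ p023).
    by rewrite /= T012 T013 T023.
  - apply: (ps 3) => // t ht; apply: duskin2_ext.
    apply: (tri_eq_trans _ es); rewrite -(T013 p013).
    exact: (@cells_map_tri _ _ _ _ _ _ AT t o30 o31 o33).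
  pose t' := ct3 T'' o31 o32 o33 isT.
  have [t et] : exists t : c_hom (comp1 f' (id1 x)) k, arr_eq t t'.
    by apply: arr_cast; rewrite ?comp1_1l ?comp1_1r.
  exists t; split.
    apply: arr_eq_eq; apply: arr_eq_trans ew; rewrite -eT.
    by apply: arr_eq_trans (F2_arr_eq F et) _; exact: arr_eq_sym (FcE F _).
  apply/(eB _ _ et); have := AT'' o30 o31 o32 o33
    isT isT isT isT isT isT isT isT isT isT isT.
  rewrite (ex'' _ _ _ _ _ _ p012) (ex'' _ _ _ _ _ _ p013) (ex'' _ _ _ _ _ _ p023).
  by rewrite T012 T013 T023.
have [t [ht1 ht2]] := ext; exists t; split=> // t1 [ht1' ht2'].
have mk (r : c_hom (comp1 f' (id1 x)) k) : c_comp r tau = v ->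
    exists (T : cells S (@predT_sub 3)), [/\ cells_assoc T,
      ct3 T o30 o31 o32 isT = i,
      ct3 T o30 o31 o33 isT = tau,
      ct3 T o30 o32 o33 isT = v'
    & arr_eq r (ct3 T o31 o32 o33 isT)].
  move=> hr; have [r' er] : exists r' : c_hom f' (comp1 (id1 y) k), arr_eq r' r.
    by apply: arr_cast; rewrite ?comp1_1l ?comp1_1r.
  have [T [T012 T013 T023 T123]] := @cells3 B S (@predT_sub 3) (fun t => t = i)
    (fun t => t = tau) (fun t => t = v') (fun t => t = r')
    (fun _ => ex_intro _ i erefl) (fun _ => ex_intro _ tau erefl)
    (fun _ => ex_intro _ v' erefl) (fun _ => ex_intro _ r' erefl).
  exists T; rewrite T012 T013 T023 T123; split=> //; last exact: arr_eq_sym.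
  apply: cells_assoc3 => q1 q2 q3 q4 q; rewrite T012 T013 T023 T123.
  by apply/(eB r) => //; exact: arr_eq_sym.
have [T1 [A1 a012 a013 a023 a123]] := mk _ ht2.
have [T2 [A2 b012 b013 b023 b123]] := mk _ ht2'.
have agree (a b c : 'I_4) (ab : a <= b) (bc : b <= c) (ac : a <= c) :
    a = o30 -> ct T1 ab bc ac isT = ct T2 ab bc ac isT.
  move=> a0; apply: cells_ext; subst a; elim/ord4_ind: b ab bc => //;
    elim/ord4_ind: c ac => // ac ab bc _ _; irr ac; irr ab; irr bc.
  - by rewrite a012 b012.
  - by rewrite a013 b013.
  - by rewrite a023 b023.
have agreeF (a b c : 'I_4) (ab : a <= b) (bc : b <= c) (ac : a <= c) :
    Fc F (ct T1 ab bc ac isT) = Fc F (ct T2 ab bc ac isT).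
  have [/(agree _ _ _ ab bc ac) -> //|a0] := eqVneq a o30.
  apply: (@cells_ext _ _ _ _ (cellsF F T1) (cellsF F T2)) => lab lbc.
  elim/ord4_ind: a a0 ab ac lab => //; elim/ord4_ind: b bc lbc => //;
    elim/ord4_ind: c => // bc _ _ ab ac _; rewrite (bool_irrelevance ac isT)
    (bool_irrelevance ab isT) (bool_irrelevance bc isT) /=.
  apply: arr_eq_eq; apply: arr_eq_trans (FcE F _) _; apply: arr_eq_sym.
  apply: arr_eq_trans (FcE F _) _.
  apply: arr_eq_trans (F2_arr_eq F (arr_eq_sym b123)) _.
  apply: arr_eq_sym; apply: arr_eq_trans (F2_arr_eq F (arr_eq_sym a123)) _.
  by apply: eq_arr_eq; exact: etrans ht1 (esym ht1').
(* Two factorizations give two 3-simplices that differ only in the face 123; filling the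
   4-dimensional horn glued from them makes these faces equal. *)
have e123 := left_mix_unique (A1 := A1) (A2 := A2) (agree := agree) agreeF.
apply: arr_eq_eq; apply: arr_eq_trans a123 _; apply: arr_eq_sym.
apply: arr_eq_trans b123 _; rewrite e123; first exact: arr_eq_refl.
move=> g lp; apply: (ps 4) => // u hu; apply: duskin2_ext.
apply: (tri_eq_trans _ es); rewrite -a013.
have p014 : @horn_pred 4 0 2 (tri3 o40 o41 o44) by exact: horn_small.
apply: (tri_eq_trans (@cells_map_tri _ _ _ _ _ _ _ u o40 o41 o44 _ _ isT p014 hu)).
rewrite mix1 //; exact: (@ct_eq _ 3 S _ T1 o30 o31 o33).
Qed.

End Characterize.

Section Cartesian.

Context {B C : two_cat} (F : two_functor B C).

Lemma cartesian_edge_full_faithful (x y z : B) (h : hom x y) (f f' : hom z x)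
    (b : c_hom (comp1 h f) (comp1 h f')) (c : c_hom (F1 F f) (F1 F f')) (ed : nerve B 1) :
  hom_eq h (de01 ed) -> @cartesian_edge (Nsc B) (Nsc C) (nerve_map F) ed ->
  arr_eq (F2 F b) (wl (F1 F h) c) ->
  exists! a : c_hom f f', wl h a = b /\ F2 F a = c.
Proof.
move=> eh [ce _] e.
have [b' eb'] : exists b' : c_hom (comp1 h f) (comp1 (comp1 h f') (id1 z)), arr_eq b' b.
  by apply: arr_cast; rewrite ?comp1_1r.
have [c' ec'] : exists c' : c_hom (F1 F f) (comp1 (F1 F f') (F1 F (id1 z))), arr_eq c' c.
  by apply: arr_cast; rewrite ?F1_id ?comp1_1r.
(* On the vertices [z, z, x, y], with identities as 023 and 123 and [b] as 013, associativity says
   that the face 012 whiskered with [h] is [b]. The face 023 is thin, as lifting against a Cartesian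
   edge requires. *)
pose S := skel3 (id1 z) f (comp1 h f) f' (comp1 h f') h.
pose i023 : c_hom (comp1 h f) (comp1 h f) := c_id _.
pose i123 : c_hom (comp1 h f') (comp1 h f') := c_id _.
have eF : arr_eq (assocL c' (Fc F i023)) (assocR (Fc F b') (Fc F i123)).
  have e1 : arr_eq (Fc F i023) (c_id (F1 F (comp1 h f))).
    by apply: arr_eq_trans (FcE F _) _; rewrite /F2 f_id; exact: arr_eq_refl.
  have e2 : arr_eq (Fc F i123) (c_id (F1 F (comp1 h f'))).
    by apply: arr_eq_trans (FcE F _) _; rewrite /F2 f_id; exact: arr_eq_refl.
  apply: arr_eq_trans (assocL_id023 _ e1) _.
  apply: arr_eq_trans _ (arr_eq_sym (assocR_id123 _ e2)).
  apply: arr_eq_trans (wl_arr_eq erefl ec') _; apply: arr_eq_trans (arr_eq_sym e) _.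
  by apply: arr_eq_sym; apply: arr_eq_trans (FcE F _) _; exact: F2_arr_eq.
have eB (a : c_hom f f') (a' : c_hom f (comp1 f' (id1 z))) :
    arr_eq a a' -> (arr_eq (assocL a' i023) (assocR b' i123) <-> wl h a = b).
  move=> ea.
  have h1 := assocL_id023 a' (arr_eq_refl i023).
  have h2 := assocR_id123 b' (arr_eq_refl i123).
  have h3 := arr_eq_trans h1 (arr_eq_sym (wl_arr_eq (erefl h) ea)).
  have h4 := arr_eq_trans h2 eb'.
  split=> [k|k].
    by apply: arr_eq_eq; apply: arr_eq_trans (arr_eq_sym h3) _; exact: arr_eq_trans k h4.
  by apply: arr_eq_trans h3 _; rewrite k; exact: arr_eq_sym.
have p013 : @horn_pred 3 3 2 (tri3 o30 o31 o33) by in_horn (o32).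
have p023 : @horn_pred 3 3 2 (tri3 o30 o32 o33) by in_horn (o31).
have p123 : @horn_pred 3 3 2 (tri3 o31 o32 o33) by in_horn (o30).
have ext : exists a : c_hom f f', wl h a = b /\ F2 F a = c.
  have [T [_ T013 T023 T123]] := @cells3 B S (@horn_pred 3 3) (fun _ => True)
    (fun t => t = b') (fun t => t = i023) (fun t => t = i123)
    (fun h => False_ind _ (negP horn3_tri_3 h)) (fun _ => ex_intro _ b' erefl)
    (fun _ => ex_intro _ i023 erefl) (fun _ => ex_intro _ i123 erefl).
  have AT : cells_assoc T.
    by apply: cells_assoc3 => q1 q2 q3 q4 q; case/negP: (horn3_quad 3).
  have [|g lp|T'' [AT'' ex'' eT]] := @converse3 B C F 3 S T AT o30 o31 o32
    isT isT isT c' isT isT missing3_3 horn3_tri_3.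
  - move=> T' ex k; rewrite k (ex _ _ _ _ _ _ p123) (ex _ _ _ _ _ _ p013) (ex _ _ _ _ _ _ p023).
    by rewrite /= T013 T023 T123.
  - apply: (ce 3) => // t ht; last first.
      apply: (tri_eq_iso (tri_eq_sym
        (@cells_map_tri _ _ _ _ _ _ AT t o30 o32 o33 _ _ isT p023 ht))).
      rewrite T023; exact: is_iso_id.
    apply: duskin1_ext; apply: hom_eq_trans _ eh.
    exact: (@cells_map_edg _ _ _ _ _ _ AT t o32 o33).
  pose a' := ct3 T'' o30 o31 o32 isT.
  have [a ea] : exists a : c_hom f f', arr_eq a a' by apply: arr_cast; rewrite ?comp1_1r.
  exists a; split; last first.
    apply: arr_eq_eq; apply: arr_eq_trans ec'; rewrite -eT.
    by apply: arr_eq_trans (F2_arr_eq F ea) _; exact: arr_eq_sym (FcE F _).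
  apply/(eB _ _ ea); have := AT'' o30 o31 o32 o33
    isT isT isT isT isT isT isT isT isT isT isT.
  rewrite (ex'' _ _ _ _ _ _ p123) (ex'' _ _ _ _ _ _ p013) (ex'' _ _ _ _ _ _ p023).
  by rewrite T013 T023 T123.
have [a [ha1 ha2]] := ext; exists a; split=> // a1 [ha1' ha2'].
have mk (r : c_hom f f') : wl h r = b ->
    exists (T : cells S (@predT_sub 3)), [/\ cells_assoc T,
      arr_eq r (ct3 T o30 o31 o32 isT),
      ct3 T o30 o31 o33 isT = b',
      ct3 T o30 o32 o33 isT = i023
    & ct3 T o31 o32 o33 isT = i123].
  move=> hr; have [r' er] : exists r' : c_hom f (comp1 f' (id1 z)), arr_eq r' r.
    by apply: arr_cast; rewrite ?comp1_1r.
  have [T [T012 T013 T023 T123]] := @cells3 B S (@predT_sub 3) (fun t => t = r')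
    (fun t => t = b') (fun t => t = i023) (fun t => t = i123)
    (fun _ => ex_intro _ r' erefl) (fun _ => ex_intro _ b' erefl)
    (fun _ => ex_intro _ i023 erefl) (fun _ => ex_intro _ i123 erefl).
  exists T; rewrite T012 T013 T023 T123; split=> //; last exact: arr_eq_sym.
  apply: cells_assoc3 => q1 q2 q3 q4 q; rewrite T012 T013 T023 T123.
  by apply/(eB r) => //; exact: arr_eq_sym.
have [T1 [A1 a012 a013 a023 a123]] := mk _ ha1.
have [T2 [A2 b012 b013 b023 b123]] := mk _ ha1'.
have agree (i j k : 'I_4) (ij : i <= j) (jk : j <= k) (ik : i <= k) :
    k = o33 -> ct T1 ij jk ik isT = ct T2 ij jk ik isT.
  move=> a0; apply: cells_ext; subst k; elim/ord4_ind: j ij jk => //;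
    elim/ord4_ind: i ik => // ik ij jk _ _; irr ik; irr ij; irr jk.
  - by rewrite a013 b013.
  - by rewrite a023 b023.
  - by rewrite a123 b123.
have agreeF (i j k : 'I_4) (ij : i <= j) (jk : j <= k) (ik : i <= k) :
    Fc F (ct T1 ij jk ik isT) = Fc F (ct T2 ij jk ik isT).
  have [/(agree _ _ _ ij jk ik) -> //|a0] := eqVneq k o33.
  apply: (@cells_ext _ _ _ _ (cellsF F T1) (cellsF F T2)) => lij ljk.
  elim/ord4_ind: k a0 jk ik ljk => //; elim/ord4_ind: j ij lij => //;
    elim/ord4_ind: i => // ij _ _ jk ik _; rewrite (bool_irrelevance ik isT)
    (bool_irrelevance ij isT) (bool_irrelevance jk isT) /=.
  apply: arr_eq_eq; apply: arr_eq_trans (FcE F _) _; apply: arr_eq_sym.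
  apply: arr_eq_trans (FcE F _) _.
  apply: arr_eq_trans (F2_arr_eq F (arr_eq_sym b012)) _.
  apply: arr_eq_sym; apply: arr_eq_trans (F2_arr_eq F (arr_eq_sym a012)) _.
  by apply: eq_arr_eq; exact: etrans ha2 (esym ha2').
have e012 := right_mix_unique (A1 := A1) (A2 := A2) (agree := agree) agreeF.
apply: arr_eq_eq; apply: arr_eq_trans a012 _; apply: arr_eq_sym.
apply: arr_eq_trans b012 _; rewrite e012; first exact: arr_eq_refl.
have p034 : @horn_pred 4 4 2 (tri3 o40 o43 o44) by exact: horn_small.
move=> g lp; apply: (ce 4) => // u hu; last first.
  apply: (tri_eq_iso (tri_eq_sym
    (@cells_map_tri _ _ _ _ _ _ _ u o40 o43 o44 _ _ isT p034 hu))).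
  rewrite mix1 //; apply: (tri_eq_iso (t := i023)); last exact: is_iso_id.
  rewrite -a023; exact: (@ct_eq _ 3 S _ T1 o30 o32 o33).
apply: duskin1_ext; apply: hom_eq_trans _ eh.
exact: (@cells_map_edg _ _ _ _ _ _ _ u o43 o44 isT hu).
Qed.

End Cartesian.

Section Lean.

Context {B C : two_cat} (F : two_functor B C).

Lemma is_id_degenerate (e : nerve B 1) : is_id (de01 e) -> degenerate e.
Proof.
move=> h; exists 0, (codeg 0), (act (pt o10) e); split=> //.
apply: duskin1_ext; rewrite /= de_id.
rewrite /de01 in h; case: h; exact: hom_eq_refl.
Qed.

Lemma face2_edge (s : nerve B 2) :
  hom_eq (de01 (face 2 s)) (de2 s o20 o21).
Proof. by apply: (de_eq _ _ (erefl s)); apply: val_inj; rewrite val_coface. Qed.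

Lemma cocart_p_cocartesian (s : nerve B 2) :
  @left_degenerate (Nsc B) s -> cocartesian2 F (dt012 s) ->
  @p_cocartesian (Nsc B) (Nsc C) (nerve_map F) s.
Proof.
move=> /degenerate_is_id ld cs n n3 f g lp fs; apply: left_horn_lift => // t ht; last first.
  by rewrite fs.
(* Only the triangle on [0, 1, n] is prescribed, so the edge on [0, 1] is recovered as its face.
   That triangle lies in the horn because, for [n >= 3], it omits the vertex 2. *)
pose b : 'I_n.+1 := (val t : mono 1 n) o11.
have b1 : val b = 1 by exact: on_vertices_val o11 ht.
have le1 : b <= (ord_max : 'I_n.+1) by rewrite -ltnS.
have p : @horn_pred n 0 2 (tri (@moP _ _ (val t : mono 1 n) o10 o11 isT) le1).
  apply: (horn_intro (a := inord 2)); first by rewrite inordK // ltnS ltnW.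
  have l2 : 2 < n.+1 by rewrite ltnS ltnW.
  elim/ord3_ind; rewrite -val_eqE /= inordK //.
  - by rewrite (on_vertices_val o10 ht).
  - by rewrite -/b b1.
  - by rewrite neq_ltn n3 orbT.
pose u : horn n 0 2 := exist _ (tri _ _) p.
have fu : f 2 u = s.
  apply: fs; apply: on_vertices_tri => //; exact: on_vertices_val o10 ht.
have -> : t = act (@edg 2 o20 o21 isT) u.
  by apply: val_inj; apply: mono_ext; elim/ord2_ind.
rewrite sm_act fu; apply: hom_eq_is_id ld; apply: hom_eq_sym.
by apply: (de_eq _ _ (erefl s)); apply: val_inj; rewrite val_coface.
Qed.

Lemma p_cocartesian_cocart (s : nerve B 2) :
  @left_degenerate (Nsc B) s -> @p_cocartesian (Nsc B) (Nsc C) (nerve_map F) s ->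
  cocartesian2 F (dt012 s).
Proof.
move=> /degenerate_is_id ld ps.
have hid : is_id (de2 s o20 o21) by apply: hom_eq_is_id ld; exact: hom_eq_sym (face2_edge s).
have key x y z (f : hom x y) (g : hom y z) (h : hom x z) (t : c_hom h (comp1 g f)) :
    is_id f -> tri_eq t (dt012 s) -> cocartesian2 F t.
  move=> i; case: y f / i g t => g t et; exact: p_cocartesian_cocart_raw et ps.
exact: key hid (tri_eq_refl _).
Qed.

Lemma tri_eq_unit (x y : B) (p : hom x y) (i i' : hom x x)
    (t : c_hom p (comp1 p i)) (t' : c_hom p (comp1 p i')) :
  i = i' -> arr_eq t (c_id p) -> arr_eq t' (c_id p) -> tri_eq t t'.
Proof.
move=> e; subst i' => h h'; apply: arr_tri_eq; exact: arr_eq_trans h (arr_eq_sym h').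
Qed.

Ltac coface_vals := apply: val_inj; rewrite val_coface.

Lemma face3_tri (r : nerve B 3) :
  [/\ tri_eq (dt012 (face 3 r)) (dt3 r o30 o31 o32),
      tri_eq (dt012 (face 2 r)) (dt3 r o30 o31 o33),
      tri_eq (dt012 (face 1 r)) (dt3 r o30 o32 o33)
    & tri_eq (dt012 (face 0 r)) (dt3 r o31 o32 o33)].
Proof.
by split; apply: (dt_eq _ _ _ _ _ _ (erefl r)); coface_vals.
Qed.

(** In the 3-simplex witnessing the left-degeneration, face 3 is degenerate and face 0 is thin, so
    [s] and its left-degeneration differ by invertible 2-morphisms. *)
Lemma lean_cocart (s : nerve B 2) :
  @cocartesian_triangle (Nsc B) (Nsc C) (nerve_map F) s -> cocartesian2 F (dt012 s).
Proof.
case=> t [[ld [r [r3 r2 r1 r0]]] pt].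
have ct := p_cocartesian_cocart ld pt.
have [e3 e2 e1 e0] := face3_tri r.
have i012 : is_iso (dt012 (face 3 r)).
  rewrite r3; apply: nerve_thin_deg.
  by exists 1, (codeg 0), (face 2 s).
rewrite r2 in e2; rewrite r1 in e1.
apply: (tri_eq_cocart (tri_eq_sym e1)).
have as0123 := dtA r (isT : o30 <= o31) (isT : o31 <= o32) (isT : o32 <= o33)
  isT isT isT.
apply: (cocartesian_iso_cancel (wl_iso (de2 r o32 o33) (tri_eq_iso e3 i012))).
apply: cocartesian_arr_eq (arr_eq_sym as0123) _; apply: cocartesian_comp.
  apply: cocartesian_iso; apply: wr_iso; exact: tri_eq_iso e0 r0.
exact: (tri_eq_cocart e2).
Qed.

Lemma cocart_lean (s : nerve B 2) :
  cocartesian2 F (dt012 s) -> @cocartesian_triangle (Nsc B) (Nsc C) (nerve_map F) s.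
Proof.
move=> cs.
pose p := de2 s o20 o21; pose g := de2 s o21 o22; pose h := de2 s o20 o22.
pose x := dv s o20.
(* An explicit left-degeneration: the edge 13 is the composite [g p], so that 123 is an identity and
   013 carries the 2-morphism of [s] up to the unit law. *)
pose S := skel3 (id1 x) p h p (comp1 g p) g.
have [i ei] : exists i : c_hom p (comp1 p (id1 x)), arr_eq i (c_id p).
  by apply: arr_cast; rewrite ?comp1_1r.
have [th eth] : exists th : c_hom h (comp1 (comp1 g p) (id1 x)), arr_eq th (dt012 s).
  by apply: arr_cast; rewrite ?comp1_1r.
pose i123 : c_hom (comp1 g p) (comp1 g p) := c_id _.
have [T [T012 T013 T023 T123]] := @cells3 B S (@predT_sub 3) (fun t => t = i)
    (fun t => t = th) (fun t => t = dt012 s) (fun t => t = i123)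
    (fun _ => ex_intro _ i erefl) (fun _ => ex_intro _ th erefl)
    (fun _ => ex_intro _ (dt012 s) erefl) (fun _ => ex_intro _ i123 erefl).
have AT : cells_assoc T.
  apply: cells_assoc3 => q1 q2 q3 q4 q; rewrite T012 T013 T023 T123.
  apply: arr_eq_trans (assocL_id012 _ ei) _.
  apply: arr_eq_trans (arr_eq_sym eth) _.
  exact: arr_eq_sym (assocR_id123 _ (arr_eq_refl i123)).
pose r : nerve B 3 := cells_simplex AT.
have [e3 e2 e1 e0] := face3_tri r.
have d3 : dt3 r o30 o31 o32 = i by exact: T012.
have d2 : dt3 r o30 o31 o33 = th by exact: T013.
have d1 : dt3 r o30 o32 o33 = dt012 s by exact: T023.
have d0 : dt3 r o31 o32 o33 = i123 by exact: T123.
rewrite d3 in e3; rewrite d2 in e2; rewrite d1 in e1; rewrite d0 in e0.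
have ld : @left_degenerate (Nsc B) (face 2 r : nerve B 2).
  apply: is_id_degenerate; apply: (hom_eq_is_id (f' := id1 x)); last exact: is_id_refl.
  apply: hom_eq_trans (face2_edge _) _; exact: tri_eq_01 e2.
exists (face 2 r); split; first (split=> //; exists r; split=> //).
- apply: duskin2_ext; apply: tri_eq_trans e3 _.
  apply: (tri_eq_trans (t' := dt3 s o20 o20 o21)).
    apply: tri_eq_unit => //; first by rewrite de_id.
    exact: (@dt_idl _ _ s o20 o21 isT isT isT).
  by apply: (dt_eq _ _ _ _ _ _ (erefl s)); coface_vals.
- by apply: duskin2_ext.
- apply: (tri_eq_iso (tri_eq_sym e0)); exact: is_iso_id.
- apply: cocart_p_cocartesian => //; apply: (tri_eq_cocart (tri_eq_sym e2)).
  exact: cocartesian_arr_eq (arr_eq_sym eth) cs.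
Qed.

End Lean.

(** * Horns of the triangle *)

(** The edge opposite to the vertex [j]; [oret j] is a codegeneracy retracting onto it, so that each
    simplex of a 2-dimensional horn is pulled back from one of its two edges. *)
Definition oedge (j : nat) : mono 1 2 :=
  match j with
  | 0 => @edg 2 o21 o22 isT
  | 1 => @edg 2 o20 o22 isT
  | _ => @edg 2 o20 o21 isT
  end.

Definition oret (j : nat) : mono 2 1 :=
  match j with 0 | 1 => codeg 0 | _ => codeg 1 end.

Lemma oret_oedge j : mono_comp (oret j) (oedge j) = mono_id 1.
Proof. by case: j => [|[|j]]; apply: mono_ext; elim/ord2_ind; apply: val_inj. Qed.

Lemma oedge_factor (j : 'I_3) m (x : mono m 2) : (forall k, x k != j) ->
  x = mono_comp (oedge j) (mono_comp (oret j) x).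
Proof.
move=> h; apply: mono_ext => k; have := h k; rewrite /=.
by move: (x k) => a; elim/ord3_ind: j {h}; elim/ord3_ind: a.
Qed.

Lemma oedge_horn i (j : 'I_3) : j != i :> nat -> @horn_pred 2 i 1 (oedge j).
Proof.
move=> ji; apply: (horn_intro ji).
by elim/ord3_ind: j {ji}; elim/ord2_ind.
Qed.

Definition horn_edge i (j : 'I_3) (ji : j != i :> nat) : horn 2 i 1 :=
  exist _ (oedge j) (oedge_horn ji).

Lemma horn2_ext (X : sset) i (f f' : smap (horn 2 i) X) :
  (forall (j : 'I_3) (ji : j != i :> nat), f 1 (horn_edge ji) = f' 1 (horn_edge ji)) ->
  smap_eq f f'.
Proof.
move=> h m x; have [j /andP[ji /forallP hx]] := existsP (valP x).
have -> : x = act (mono_comp (oret j) (val x)) (horn_edge ji).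
  by apply: val_inj; exact: oedge_factor.
by rewrite !sm_act h.
Qed.

Section Horn2Map.

Context {X : sset} (i j1 j2 : 'I_3) (a1 a2 : X 1).
Hypothesis ji1 : j1 != i.
Hypothesis ji2 : j2 != i.
Hypothesis j12 : j1 != j2.
Hypothesis compat : act (pt (oret j1 i)) a1 = act (pt (oret j2 i)) a2.

Let f m (x : horn 2 i m) : X m :=
  if [forall k, (val x : mono m 2) k != j1] then act (mono_comp (oret j1) (val x)) a1
  else act (mono_comp (oret j2) (val x)) a2.

Lemma horn2_const m (x : mono m 2) (j : 'I_3) (a : X 1) : (forall k, x k = i) ->
  act (mono_comp (oret j) x) a = act (@Mono m 0 (fun _ => ord0) (fun _ _ _ => isT))
     (act (pt (oret j i)) a).
Proof.
move=> h; rewrite -act_comp; congr (act _ a); apply: mono_ext => k /=.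
by rewrite h.
Qed.

Lemma horn2_nat m n (a : mono m n) (x : horn 2 i n) : f (act a x) = act a (f x).
Proof.
rewrite /f; have [/forallP h1|h1] := boolP [forall k, (val x : mono n 2) k != j1].
  have -> : [forall k, (val (act a x) : mono m 2) k != j1].
    by apply/forallP => k; exact: h1.
  by rewrite -act_comp; congr (act _ a1); exact: mono_ext.
have h2 : forall k, (val x : mono n 2) k != j2.
  have [j /andP[ji /forallP hx]] := existsP (valP x).
  have [e|nj1] := eqVneq j j1; first by case/negP: h1; apply/forallP; rewrite -e.
  suff <- : j = j2 by [].
  move: ji ji1 ji2 j12 nj1; rewrite val_eqE; clear.
  by elim/ord3_ind: i; elim/ord3_ind: j1; elim/ord3_ind: j2 => //; elim/ord3_ind: j.
have [/forallP h3|h3] := boolP [forall k, (val (act a x) : mono m 2) k != j1].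
  (* A simplex missing both [j1] and [j2] is constant at the common vertex [i], where [compat]
     reconciles the two branches of [f]. *)
  have c k : (val (act a x) : mono m 2) k = i.
    have := h3 k; have := h2 (a k); rewrite /=; move: ((val x : mono n 2) (a k)).
    move: ji1 ji2 j12; clear.
    by elim/ord3_ind: i; elim/ord3_ind: j1; elim/ord3_ind: j2 => // _ _ _; elim/ord3_ind.
  rewrite horn2_const // compat -(horn2_const (x := val (act a x))) // -act_comp.
  by congr (act _ a2); exact: mono_ext.
by rewrite -act_comp; congr (act _ a2); exact: mono_ext.
Qed.

Lemma horn2_map : exists g : smap (horn 2 i) X,
  (forall h : j1 != i :> nat, g 1 (horn_edge h) = a1) /\
  (forall h : j2 != i :> nat, g 1 (horn_edge h) = a2).
Proof.
exists (SMap horn2_nat); split=> h; rewrite /= /f /=.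
  have -> : [forall k, oedge j1 k != j1].
    by apply/forallP; clear; elim/ord3_ind: j1; elim/ord2_ind.
  by rewrite oret_oedge act_id.
have -> : [forall k, oedge j2 k != j1] = false.
  apply/negP => /forallP; move: j12; clear.
  by elim/ord3_ind: j1; elim/ord3_ind: j2 => // _ k; move: (k o10) (k o11).
by rewrite oret_oedge act_id.
Qed.

End Horn2Map.

(** * Fillers of 2-dimensional horns *)

Section Triangles.

Context {B C : two_cat} (F : two_functor B C).

Lemma hom_eq_F (x y x' y' : B) (f : hom x y) (f' : hom x' y') :
  hom_eq f f' -> hom_eq (F1 F f) (F1 F f').
Proof. by case; exact: hom_eq_refl. Qed.

Lemma tri_eq_F (x y z x' y' z' : B) (f : hom x y) (g : hom y z) (h : hom x z)
    (f' : hom x' y') (g' : hom y' z') (h' : hom x' z')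
    (t : c_hom h (comp1 g f)) (t' : c_hom h' (comp1 g' f')) :
  tri_eq t t' -> tri_eq (Fc F t) (Fc F t').
Proof. by case; exact: tri_eq_refl. Qed.

Hypothesis hF : buckley_2fibration F.

Section Fill2.

Context {x0 x1 x2 : B}.

(** A coCartesian lift has a prescribed source, whereas [s] ends at the image of [f12 f01]; so the
    inverse of [s] is lifted out of that composite and the lift is inverted. *)
Lemma inner_fill2 (y0 y1 y2 : C) (g01 : hom y0 y1) (g12 : hom y1 y2) (g02 : hom y0 y2)
    (s : c_hom g02 (comp1 g12 g01)) (f01 : hom x0 x1) (f12 : hom x1 x2) :
  hom_eq (F1 F f01) g01 -> hom_eq (F1 F f12) g12 -> is_iso s ->
  exists (f02 : hom x0 x2) (t : c_hom f02 (comp1 f12 f01)), tri_eq (Fc F t) s /\ is_iso t.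
Proof.
move=> h1 h2; have e0 := hom_eq_src h1; have e1 := hom_eq_tgt h1; have e2 := hom_eq_tgt h2.
subst y0 y1 y2; have k1 := hom_eq_eq h1; have k2 := hom_eq_eq h2.
clear h1 h2; subst g01 g12; case=> v [v1 v2].
have [op _ _] := hF.
have [w ew] : exists w : c_hom (F1 F (comp1 f12 f01)) g02, arr_eq w v.
  by apply: arr_cast; rewrite ?F1_comp.
have iw : is_iso w by apply: arr_eq_iso ew _; exists s.
have [f02 [u [eu [t [t1 t2]]]]] := opfibration_iso (op x0 x2) iw.
have ef : F1 F f02 = g02 by exact: arr_eq_tgt eu.
subst g02; exists f02, t; split; last by exists u.
apply: arr_tri_eq; apply: arr_eq_trans (FcE F t) _.
apply: (arr_eq_cancel_iso (arr_eq_trans eu ew)).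
  by apply: F2_iso; exists t.
by rewrite v1 -f_comp t2 f_id; exact: arr_eq_refl.
Qed.

Lemma left_fill2 (y0 y1 y2 : C) (g01 : hom y0 y1) (g12 : hom y1 y2) (g02 : hom y0 y2)
    (s : c_hom g02 (comp1 g12 g01)) (f01 : hom x0 x1) (f02 : hom x0 x2) : is_id f01 ->
  hom_eq (F1 F f01) g01 -> hom_eq (F1 F f02) g02 ->
  exists (f12 : hom x1 x2) (t : c_hom f02 (comp1 f12 f01)),
    tri_eq (Fc F t) s /\ cocartesian2 F t.
Proof.
move=> i; case: x1 f01 / i.
move=> h1 h2; have e0 := hom_eq_src h1; have e1 := hom_eq_tgt h1; have e2 := hom_eq_tgt h2.
subst y0 y1 y2; have k1 := hom_eq_eq h1; have k2 := hom_eq_eq h2.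
clear h1 h2; subst g01 g02.
have [op _ _] := hF; have [f12 [u [eu cu]]] := op x0 x2 f02 _ s.
have ef : F1 F f12 = g12 by have := arr_eq_tgt eu; rewrite F1_id comp1_1r.
subst g12; have [t et] : exists t : c_hom f02 (comp1 f12 (id1 x0)), arr_eq t u.
  by apply: arr_cast; rewrite ?comp1_1r.
exists f12, t; split; last exact: cocartesian_arr_eq (arr_eq_sym et) cu.
apply: arr_tri_eq; apply: arr_eq_trans (FcE F t) _.
exact: arr_eq_trans (F2_arr_eq F et) eu.
Qed.

(** Pushing [f02] forward along [s] yields [k] strictly over [F f12 g01]; then [acart], applied over
    an identity, factors [k] through [f12] up to an invertible 2-morphism. *)
Lemma right_fill2 (y0 y1 y2 : C) (g01 : hom y0 y1) (g12 : hom y1 y2) (g02 : hom y0 y2)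
    (s : c_hom g02 (comp1 g12 g01)) (f12 : hom x1 x2) (f02 : hom x0 x2) : acart F f12 ->
  hom_eq (F1 F f12) g12 -> hom_eq (F1 F f02) g02 ->
  exists (f01 : hom x0 x1) (t : c_hom f02 (comp1 f12 f01)),
    [/\ tri_eq (Fc F t) s, cocartesian2 F t & is_iso s -> is_iso t].
Proof.
move=> ah h1 h2; have e1 := hom_eq_src h1; have e2 := hom_eq_tgt h1; have e0 := hom_eq_src h2.
subst y0 y1 y2; have k1 := hom_eq_eq h1; have k2 := hom_eq_eq h2.
clear h1 h2; subst g12 g02.
have [op _ _] := hF; have [k [u [eu cu]]] := op x0 x2 f02 _ s.
have [w ew] : exists w : c_hom (F1 F k) (comp1 (F1 F f12) g01), arr_eq w (c_id (F1 F k)).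
  by apply: arr_cast => //; exact: arr_eq_tgt eu.
have [f01 [t [ef it et]]] := ah.2 _ _ _ w (arr_eq_iso ew (is_iso_id _)).
subst g01; exists f01, (c_comp t u); split.
- apply: arr_tri_eq; apply: arr_eq_trans (FcE F _) _; rewrite F2_comp.
  apply: arr_eq_trans (comp_het_idl _ (arr_eq_trans et ew)) eu.
- by apply: cocartesian_comp => //; exact: cocartesian_iso.
- move=> js; apply: is_iso_comp => //; apply: cocartesian_over_iso cu _.
  exact: arr_eq_iso eu js.
Qed.

End Fill2.

End Triangles.

Section Horn2Lift.

Context {B C : two_cat} (F : two_functor B C).

Lemma oedge_de (X : two_cat) (s : nerve X 2) :
  [/\ hom_eq (de01 (act (oedge 0) s)) (de2 s o21 o22),
      hom_eq (de01 (act (oedge 1) s)) (de2 s o20 o22)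
    & hom_eq (de01 (act (oedge 2) s)) (de2 s o20 o21)].
Proof. by split; apply: (de_eq _ _ (erefl s)). Qed.

Lemma horn2_vertex (X : two_cat) i (f : smap (horn 2 i) (nerve X)) (j j' : 'I_3)
    (ji : j != i :> nat) (ji' : j' != i :> nat) (a b : 'I_2) :
  oedge j a = oedge j' b -> dv (f 1 (horn_edge ji)) a = dv (f 1 (horn_edge ji')) b.
Proof.
move=> e; have e' : act (pt a) (horn_edge ji) = act (pt b) (horn_edge ji').
  by apply: val_inj; apply: mono_ext => k /=.
have := congr1 (fun d => dv d ord0) (congr1 (f 0) e').
by rewrite !sm_act.
Qed.

Lemma horn2_lift i (f : smap (horn 2 i) (Nsc B)) (g : smap (simplex 2) (Nsc C))
    (D : nerve B 2) :
  (forall (j : 'I_3) (ji : j != i :> nat), f 1 (horn_edge ji) = act (oedge j) D) ->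
  nerve_fun F D = g 2 (mono_id 2) ->
  exists h : smap (simplex 2) (Nsc B),
    [/\ smap_eq (smap_comp h (horn_incl 2 i)) f, smap_eq (smap_comp (nerve_map F) h) g
      & h 2 (mono_id 2) = D].
Proof.
move=> hf hg; exists (yoneda D : smap (simplex 2) (Nsc B)); split.
- by apply: horn2_ext => j ji; rewrite hf.
- move=> m x; rewrite (smap_simplex g x) -hg /=.
  exact: (sm_act (nerve_map F) (x : mono m 2) (D : Nsc B 2)).
- exact: yoneda_id.
Qed.

Lemma horn2_problem i (f : smap (horn 2 i) (Nsc B)) (g : smap (simplex 2) (Nsc C))
    (j : 'I_3) (ji : j != i :> nat) :
  lift_problem (horn_incl 2 i) (nerve_map F) f g ->
  hom_eq (F1 F (de01 (f 1 (horn_edge ji)))) (de01 (act (oedge j) (g 2 (mono_id 2) : nerve C 2))).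
Proof.
move=> lp; have e := lp 1 (horn_edge ji).
have e2 : g 1 (oedge j) = act (oedge j) (g 2 (mono_id 2)) by exact: smap_simplex.
rewrite -[act _ _]e2 -[g 1 (oedge j)]e; exact: hom_eq_refl.
Qed.

Lemma nerve_fun_tri (D : nerve B 2) (G : nerve C 2) (x y z : B) (f : hom x y)
    (g : hom y z) (h : hom x z) (t : c_hom h (comp1 g f)) :
  tri_eq t (dt012 D) -> tri_eq (Fc F t) (dt012 G) -> nerve_fun F D = G.
Proof.
move=> h1 h2; apply: duskin2_ext; apply: tri_eq_trans h2; apply: tri_eq_sym.
exact: tri_eq_F.
Qed.

Hypothesis hF : buckley_2fibration F.

Lemma inner_horn_lift2 (f : smap (horn 2 1) (Nsc B)) (g : smap (simplex 2) (Nsc C)) :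
  lift_problem (horn_incl 2 1) (nerve_map F) f g -> nerve_thin (g 2 (mono_id 2)) ->
  exists h : smap (simplex 2) (Nsc B),
    [/\ smap_eq (smap_comp h (horn_incl 2 1)) f, smap_eq (smap_comp (nerve_map F) h) g
      & nerve_thin (h 2 (mono_id 2))].
Proof.
move=> lp thg.
have j0 : (o20 : 'I_3) != 1 :> nat by [].
have j2 : (o22 : 'I_3) != 1 :> nat by [].
pose e12 := f 1 (horn_edge j0); pose e01 := f 1 (horn_edge j2).
have [G12 G02 G01] := oedge_de (g 2 (mono_id 2) : nerve C 2).
have h12 := hom_eq_trans (horn2_problem j0 lp) G12.
have h01 := hom_eq_trans (horn2_problem j2 lp) G01.
have ev : dv e12 o10 = dv e01 o11 by exact: horn2_vertex.
have [f12 ef12] : exists f12 : hom (dv e01 o11) (dv e12 o11), hom_eq f12 (de01 e12).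
  exact: hom_transport.
have [f02 [t [et it]]] := inner_fill2 hF h01 (hom_eq_trans (hom_eq_F F ef12) h12) thg.
have [D tD] := nerve2_of t.
have [D12 D02 D01] := oedge_de D.
have [|h [h1 h2 h3]] := @horn2_lift 1 f g D _ (nerve_fun_tri tD et).
  elim/ord3_ind => // ji; apply: duskin1_ext.
  - rewrite (bool_irrelevance ji j0); apply: hom_eq_trans (hom_eq_sym ef12) _.
    apply: hom_eq_trans (tri_eq_12 tD) _.
    exact: hom_eq_sym.
  - rewrite (bool_irrelevance ji j2); apply: hom_eq_trans (tri_eq_01 tD) _; exact: hom_eq_sym.
exists h; split=> //; rewrite h3; exact: tri_eq_iso tD it.
Qed.

Lemma left_horn_lift2 (f : smap (horn 2 0) (Nsc B)) (g : smap (simplex 2) (Nsc C)) :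
  lift_problem (horn_incl 2 0) (nerve_map F) f g ->
  (forall ji, is_id (de01 (f 1 (@horn_edge 0 o22 ji)))) ->
  exists h : smap (simplex 2) (Nsc B),
    [/\ smap_eq (smap_comp h (horn_incl 2 0)) f, smap_eq (smap_comp (nerve_map F) h) g
      & cocartesian2 F (dt012 (h 2 (mono_id 2)))].
Proof.
move=> lp hid.
have j1 : (o21 : 'I_3) != 0 :> nat by [].
have j2 : (o22 : 'I_3) != 0 :> nat by [].
pose e02 := f 1 (horn_edge j1); pose e01 := f 1 (horn_edge j2).
have [G12 G02 G01] := oedge_de (g 2 (mono_id 2) : nerve C 2).
have h02 := hom_eq_trans (horn2_problem j1 lp) G02.
have h01 := hom_eq_trans (horn2_problem j2 lp) G01.
have ev : dv e02 o10 = dv e01 o10 by exact: horn2_vertex.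
have [f02 ef02] : exists f02 : hom (dv e01 o10) (dv e02 o11), hom_eq f02 (de01 e02).
  exact: hom_transport.
have [f12 [t [et it]]] := left_fill2 hF (dt012 (g 2 (mono_id 2) : nerve C 2)) (hid j2) h01
  (hom_eq_trans (hom_eq_F F ef02) h02).
have [D tD] := nerve2_of t.
have [D12 D02 D01] := oedge_de D.
have [|h [h1 h2 h3]] := @horn2_lift 0 f g D _ (nerve_fun_tri tD et).
  elim/ord3_ind => // ji; apply: duskin1_ext.
  - rewrite (bool_irrelevance ji j1); apply: hom_eq_trans (hom_eq_sym ef02) _.
    apply: hom_eq_trans (tri_eq_02 tD) _.
    exact: hom_eq_sym.
  - rewrite (bool_irrelevance ji j2); apply: hom_eq_trans (tri_eq_01 tD) _; exact: hom_eq_sym.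
exists h; split=> //; rewrite h3; exact: (tri_eq_cocart tD it).
Qed.

Lemma right_horn_lift2 (f : smap (horn 2 2) (Nsc B)) (g : smap (simplex 2) (Nsc C)) :
  lift_problem (horn_incl 2 2) (nerve_map F) f g ->
  (forall ji, acart F (de01 (f 1 (@horn_edge 2 o20 ji)))) ->
  exists h : smap (simplex 2) (Nsc B),
    [/\ smap_eq (smap_comp h (horn_incl 2 2)) f, smap_eq (smap_comp (nerve_map F) h) g,
        cocartesian2 F (dt012 (h 2 (mono_id 2)))
      & nerve_thin (g 2 (mono_id 2)) -> nerve_thin (h 2 (mono_id 2))].
Proof.
move=> lp hac.
have j0 : (o20 : 'I_3) != 2 :> nat by [].
have j1 : (o21 : 'I_3) != 2 :> nat by [].
pose e12 := f 1 (horn_edge j0); pose e02 := f 1 (horn_edge j1).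
have [G12 G02 G01] := oedge_de (g 2 (mono_id 2) : nerve C 2).
have h12 := hom_eq_trans (horn2_problem j0 lp) G12.
have h02 := hom_eq_trans (horn2_problem j1 lp) G02.
have ev : dv e02 o11 = dv e12 o11 by exact: horn2_vertex.
have [f02 ef02] : exists f02 : hom (dv e02 o10) (dv e12 o11), hom_eq f02 (de01 e02).
  exact: hom_transport.
have [f12 [t [et it js]]] := right_fill2 hF (dt012 (g 2 (mono_id 2) : nerve C 2)) (hac j0) h12
  (hom_eq_trans (hom_eq_F F ef02) h02).
have [D tD] := nerve2_of t.
have [D12 D02 D01] := oedge_de D.
have [|h [h1 h2 h3]] := @horn2_lift 2 f g D _ (nerve_fun_tri tD et).
  elim/ord3_ind => // ji; apply: duskin1_ext.
  - rewrite (bool_irrelevance ji j0); apply: hom_eq_trans (tri_eq_12 tD) _; exact: hom_eq_sym.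
  - rewrite (bool_irrelevance ji j1); apply: hom_eq_trans (hom_eq_sym ef02) _.
    apply: hom_eq_trans (tri_eq_02 tD) _.
    exact: hom_eq_sym.
exists h; split=> //; rewrite h3; first exact: (tri_eq_cocart tD it).
by move=> thg; apply: (tri_eq_iso tD); exact: js.
Qed.

Lemma acart_cartesian_edge (e : nerve B 1) :
  acart F (de01 e) -> @cartesian_edge (Nsc B) (Nsc C) (nerve_map F) e.
Proof.
move=> ac; split=> [n n3 f g lp fe ft|f g lp fe tg].
  apply: right_horn_lift => // t ht; first by rewrite fe.
  by apply: cocartesian_iso; exact: ft.
have [|h [h1 h2 _ h4]] := right_horn_lift2 lp.
  by move=> ji; rewrite fe //; exact: on_vertices_edg.
by exists h; split=> //; exact: h4.
Qed.

Lemma cartesian_edge_acart (e : nerve B 1) :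
  @cartesian_edge (Nsc B) (Nsc C) (nerve_map F) e -> acart F (de01 e).
Proof.
move=> ce; split=> [z f f' b c eb|z k g t it].
  exact: (cartesian_edge_full_faithful (hom_eq_refl _) ce eb).
have [ek hk] := nerve1_of k.
have [G tG] := nerve2_of t.
(* The horn has [e] as edge 12 and [k] as edge 02, glued at the vertex 2 over the triangle [t]; the
   2-dimensional clause of [cartesian_edge] fills it by a thin triangle. *)
have cv : act (pt (oret 0 o22)) e = act (pt (oret 1 o22)) ek :> nerve B 0.
  apply: duskin0_ext; rewrite /=.
  have -> : Ordinal (codeg_bound 0 o22) = o11 :> 'I_2 by apply: val_inj.
  exact: hom_eq_tgt hk.
have [f [f0 f1]] := @horn2_map (nerve B) o22 o20 o21 e ek isT isT isT cv.
have [G12 G02 G01] := oedge_de G.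
have lp : @lift_problem _ _ (Nsc B) (Nsc C) (horn_incl 2 2) (nerve_map F) f
    (yoneda G : smap (simplex 2) (Nsc C)).
  apply: horn2_ext => j ji; apply: duskin1_ext; move: ji.
  elim/ord3_ind: j => // ji; rewrite /= ?f0 ?f1.
  - apply: hom_eq_trans (tri_eq_12 tG) _; exact: hom_eq_sym.
  - apply: hom_eq_trans (hom_eq_F F (hom_eq_sym hk)) _.
    apply: hom_eq_trans (tri_eq_02 tG) _; exact: hom_eq_sym.
have [||h [h1 h2 h3]] := ce.2 f (yoneda G : smap (simplex 2) (Nsc C)) lp.
- move=> u hu; have -> : u = @horn_edge 2 o20 isT.
    apply: val_inj; apply: mono_ext; elim/ord2_ind; apply: val_inj.
      exact: on_vertices_val o10 hu.
    exact: on_vertices_val o11 hu.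
  exact: f0.
- by rewrite yoneda_id; exact: tri_eq_iso tG it.
pose D : nerve B 2 := h 2 (mono_id 2).
have hD (j : 'I_3) (ji : j != 2 :> nat) : f 1 (horn_edge ji) = act (oedge j) D.
  rewrite -(h1 1 (horn_edge ji)); exact: (smap_simplex h (oedge j)).
have hG : nerve_fun F D = G.
  by rewrite -[RHS](yoneda_id G) -[RHS](h2 2 (mono_id 2)).
have [D12 D02 D01] := oedge_de D.
have k12 : hom_eq (de2 D o21 o22) (de01 e).
  by apply: hom_eq_trans (hom_eq_sym D12) _; rewrite -(hD o20 isT) f0; exact: hom_eq_refl.
have k02 : hom_eq (de2 D o20 o22) k.
  apply: hom_eq_trans (hom_eq_sym D02) _; rewrite -(hD o21 isT) f1; exact: hom_eq_sym.
have [f01 k01] : exists f01 : hom z (dv e o10), hom_eq f01 (de2 D o20 o21).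
  by apply: hom_transport; [exact: hom_eq_src k02 | exact: hom_eq_src k12].
have [t' et'] := tri_transport (t := dt012 D) (hom_eq_sym k01) k12 k02.
have ett : tri_eq (Fc F t') t.
  apply: tri_eq_trans (tri_eq_F F et') _; apply: tri_eq_trans (tri_eq_sym tG).
  by rewrite -hG; exact: tri_eq_refl.
have eg : F1 F f01 = g by exact: hom_eq_eq (tri_eq_01 ett).
subst g; exists f01, t'; split=> //.
  exact: (tri_eq_iso (tri_eq_sym et') h3).
rewrite -(tri_eq_eq ett); exact: arr_eq_sym (FcE F t').
Qed.

End Horn2Lift.

Lemma degenerate_smap (X Y : sset) (h : smap X Y) n (x : X n) :
  degenerate x -> degenerate (h n x).
Proof. by case=> m [a [y [lt ->]]]; exists m, a, (h m y); rewrite sm_act. Qed.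

Lemma listed_map (L : sset) (E : L 1 -> Prop) (T K : L 2 -> Prop) (X : mbsset)
    (h : smap L X) :
  (forall e, E e -> marked (h 1 e)) -> (forall s, T s -> mb_thin (h 2 s)) ->
  (forall s, K s -> lean (h 2 s)) ->
  exists k : mbmap (listed E T K) X, mm k = h.
Proof.
move=> hE hT hK; have [m1 m2 m3] := mbP X.
have dg n (x : L n) : degenerate x -> degenerate (h n x) by exact: degenerate_smap.
unshelve eexists (@MBMap (listed E T K) X h _ _ _) => //=.
- by move=> e [/hE|/dg/m1].
- by move=> s [/hT|/dg/m2].
- by move=> s [/hK|/hT/m3|/dg/m2/m3].
Qed.

(** The lift can only be [u] itself; what remains is that [u] respects the added decorations. *)
Lemma rlp_same_underlying (L : sset) (E E' : L 1 -> Prop) (T T' K K' : L 2 -> Prop)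
    (X Y : mbsset) (p : mbmap X Y) (f : mbmap (listed E T K) (listed E' T' K')) :
  smap_eq f (smap_id L) ->
  (forall (u : mbmap (listed E T K) X) (g : mbmap (listed E' T' K') Y),
    smap_eq (smap_comp p u) g ->
    [/\ forall e, E' e -> marked (u 1 e), forall s, T' s -> mb_thin (u 2 s)
      & forall s, K' s -> lean (u 2 s)]) ->
  mb_rlp f p.
Proof.
move=> fid H u g e.
have e' : smap_eq (smap_comp p u) g.
  by move=> n x; have /= -> := e n x; rewrite (fid n x).
have [h1 h2 h3] := H u g e'.
have [k kE] := @listed_map L E' T' K' X u h1 h2 h3.
exists k; split=> n x /=; first by rewrite kE (fid n x).
by rewrite kE; exact: e'.
Qed.

(** For [n >= 3] a triangle misses some vertex, which is not [h] since it contains [h]. This carries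
    decorations of distinguished triangles from a horn to its filler. *)
Lemma horn_image n h (x : mono 2 n) k : 3 <= n -> val (x k) = h -> @horn_pred n h 2 x.
Proof.
move=> n3 xk.
have [a ha] : exists a, a \notin x @: setT.
  apply/existsP; apply: contraT; rewrite negb_exists => /forallP hx.
  have : #|'I_n.+1| <= #|x @: setT|.
    by apply: subset_leq_card; apply/subsetP => a _; have := hx a; rewrite negbK.
  move=> /leq_trans /(_ (leq_imset_card _ _)); rewrite cardsT !card_ord.
  by rewrite leqNgt ltnS n3.
apply: (horn_intro (a := a)).
  by apply: contra ha => /eqP e; apply/imsetP; exists k => //; apply: val_inj; rewrite xk.
by move=> l; apply: contra ha => /eqP <-; exact: imset_f.
Qed.

Lemma on_vertices_id (x : mono 2 2) : on_vertices [:: 0; 1; 2] x -> x = mono_id 2.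
Proof.
move=> h; apply: mono_ext; elim/ord3_ind; apply: val_inj.
- exact: on_vertices_val o20 h.
- exact: on_vertices_val o21 h.
- exact: on_vertices_val o22 h.
Qed.

(** * Lifting against the horn generators *)

Section Main.

Context {B C : two_cat} (F : two_functor B C) (hF : buckley_2fibration F).

Let X := Nsc B.
Let Y := Nsc C.

Lemma is_id_acart (x y : B) (f : hom x y) : is_id f -> acart F f.
Proof. by case; exact: acart_id. Qed.

Lemma thin_lean (s : X 2) : thin s -> cocartesian_triangle (nerve_map F) s.
Proof. by move=> h; apply: cocart_lean; exact: cocartesian_iso. Qed.

Lemma nerve_mb_axioms : @mb_axioms X (cartesian_edge (nerve_map F)) (@thin X)
  (cocartesian_triangle (nerve_map F)).
Proof.
split=> [e de|s|s]; last exact: thin_lean; last exact: thin_deg.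
by apply: acart_cartesian_edge => //; apply: is_id_acart; exact: degenerate_is_id.
Qed.

Definition nerve_mb : mbsset := MBSSet nerve_mb_axioms.

Lemma nerve_map_thin (s : X 2) : thin s -> thin (nerve_map F 2 s).
Proof. exact: Fc_iso. Qed.

Definition nerve_mb_map : mbmap nerve_mb (mb_of_scaled Y) :=
  @MBMap nerve_mb (mb_of_scaled Y) (nerve_map F) (fun _ _ => I) nerve_map_thin
    (fun _ _ => I).

Let p := nerve_mb_map.

(** For [n >= 3] the distinguished triangle lies in the horn and inherits its thinness; for [n = 2]
    it is the filler itself, which must be chosen thin. *)
Lemma rlp_A1 n i
    (f : mbmap
      (@listed (horn n i) mb_flat
        (fun t => on_vertices [:: i.-1; i; i.+1] (val t)) mb_flat)
      (@listed (simplex n) mb_flat (on_vertices [:: i.-1; i; i.+1]) mb_flat)) :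
    2 <= n -> 0 < i < n -> smap_eq f (horn_incl n i) -> mb_rlp f p.
Proof.
move=> n2 hi fE u g e.
have lp : lift_problem (horn_incl n i) (nerve_map F) u g.
  by move=> m x; have := e m x; rewrite /= (fE m x).
suff [h [h1 h2 h3]] : exists h : smap (simplex n) X,
    [/\ smap_eq (smap_comp h (horn_incl n i)) u, smap_eq (smap_comp (nerve_map F) h) g
      & forall s, on_vertices [:: i.-1; i; i.+1] s -> nerve_thin (h 2 s)].
  have [k kE] := @listed_map (simplex n) mb_flat (on_vertices [:: i.-1; i; i.+1]) mb_flat
    nerve_mb h (fun _ x => match x with end) h3 (fun _ x => match x with end).
  exists k; split=> m x /=; rewrite kE; last exact: h2.
  by rewrite (fE m x); exact: h1.
move: n2; rewrite leq_eqVlt => /orP[/eqP e2|n3].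
  subst n; have i1 : i = 1 by move: hi; case: (i) => [|[|]].
  subst i; have thg : nerve_thin (g 2 (mono_id 2)).
    apply: (mm_thin g); left.
    by rewrite /on_vertices !enum_ordSl enum_ord0.
  have [h [h1 h2 h3]] := inner_horn_lift2 hF lp thg.
  by exists h; split=> // s /on_vertices_id ->.
have [|h [h1 h2]] := inner_horn_lift n3 hi lp.
  by move=> t ht; apply: (mm_thin u); left.
exists h; split=> // s hs.
have q : horn_pred i s by apply: (horn_image (k := o21) n3); exact: on_vertices_val o21 hs.
have -> : h 2 s = u 2 (exist _ s q) by rewrite -(h1 2 (exist _ s q)).
by apply: (mm_thin u); left.
Qed.

Lemma rlp_A4 n
    (f : mbmap
      (@listed (horn n n) (fun e => on_vertices [:: n.-1; n] (val e)) mb_flat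
        (fun t => on_vertices [:: 0; n.-1; n] (val t)))
      (@listed (simplex n) (on_vertices [:: n.-1; n]) mb_flat
        (on_vertices [:: 0; n.-1; n]))) :
    2 <= n -> smap_eq f (horn_incl n n) -> mb_rlp f p.
Proof.
move=> n2 fE u g e.
have lp : lift_problem (horn_incl n n) (nerve_map F) u g.
  by move=> m x; have := e m x; rewrite /= (fE m x).
have hac (t : horn n n 1) : on_vertices [:: n.-1; n] (val t : mono 1 n) ->
    acart F (de01 (u 1 t)).
  by move=> ht; apply: cartesian_edge_acart; apply: (mm_marked u); left.
have [n0 hn] : exists n0, n = n0.+2 by move: n2; case: (n) => [|[|m]] // _; exists m.
suff [h [h1 h2 h3]] : exists h : smap (simplex n) X,
    [/\ smap_eq (smap_comp h (horn_incl n n)) u, smap_eq (smap_comp (nerve_map F) h) g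
      & forall s, on_vertices [:: 0; n.-1; n] s -> cocartesian_triangle (nerve_map F) (h 2 s)].
  have h4 s : on_vertices [:: n.-1; n] s -> cartesian_edge (nerve_map F) (h 1 s).
    move=> hs; have q : horn_pred n s.
      apply: (horn_intro (a := ord0)); first by rewrite hn.
      elim/ord2_ind; rewrite -val_eqE /=.
        by rewrite (on_vertices_val o10 hs) hn.
      by rewrite (on_vertices_val o11 hs) hn.
    have -> : h 1 s = u 1 (exist _ s q) by rewrite -(h1 1 (exist _ s q)).
    by apply: (mm_marked u); left.
  have [k kE] := @listed_map (simplex n) (on_vertices [:: n.-1; n]) mb_flat
    (on_vertices [:: 0; n.-1; n]) nerve_mb h h4 (fun _ x => match x with end) h3.
  exists k; split=> m x /=; rewrite kE; last exact: h2.
  by rewrite (fE m x); exact: h1.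
move: n2; rewrite leq_eqVlt => /orP[/eqP e2|n3].
  clear n0 hn; subst n; have [|h [h1 h2 h3 _]] := right_horn_lift2 hF lp.
    by move=> ji; apply: hac; exact: on_vertices_edg.
  by exists h; split=> // s /on_vertices_id ->; exact: cocart_lean.
have [|h [h1 h2]] := right_horn_lift n3 lp hac.
  by move=> t ht; apply: lean_cocart; apply: (mm_lean u); apply: Or31.
exists h; split=> // s hs.
have q : horn_pred n s by apply: (horn_image (k := o22) n3); exact: on_vertices_val o22 hs.
have -> : h 2 s = u 2 (exist _ s q) by rewrite -(h1 2 (exist _ s q)).
by apply: (mm_lean u); apply: Or31.
Qed.

Lemma horn_incl_quot n i m (x : horn n i m) :
  horn_incl_c01 n i m (horn_quot01 n i m x) = quot01 n m (horn_incl n i m x).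
Proof.
rewrite /=; case: insubP => [y _ <- //|]; rewrite negbK => h /=.
by rewrite insubN // negbK.
Qed.

(** The problem is pulled back along the quotient map to a horn whose edge 01 is an identity, solved
    there, and the filler is descended again. *)
Lemma rlp_A3 n
    (f : mbmap
      (@listed (horn_c01 n 0) mb_flat mb_flat
        (image_of (horn_quot01 n 0)
          (fun t : horn n 0 2 => on_vertices [:: 0; 1; n] (val t))))
      (@listed (simplex_c01 n) mb_flat mb_flat
        (image_of (quot01 n)
          (fun t : simplex n 2 => on_vertices [:: 0; 1; n] t)))) :
    2 <= n -> smap_eq f (horn_incl_c01 n 0) -> mb_rlp f p.
Proof.
move=> n2 fE u g e.
pose w : smap (horn n 0) X := smap_comp u (horn_quot01 n 0).
pose G : smap (simplex n) Y := smap_comp g (quot01 n).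
have lp : lift_problem (horn_incl n 0) (nerve_map F) w G.
  move=> m x; rewrite -[RHS]/(g m (quot01 n m (horn_incl n 0 m x))) -horn_incl_quot.
  rewrite -(fE m _); exact: e.
have wpt m (x : horn n 0 m) : edge01_pred (val x) -> w m x = u m None.
  by move=> hx; rewrite /w /= insubN // negbK.
have hid (t : horn n 0 1) : on_vertices [:: 0; 1] (val t : mono 1 n) -> is_id (de01 (w 1 t)).
  move=> ht; rewrite wpt.
    apply: degenerate_is_id; apply: (degenerate_smap u).
    by exists 0, (codeg 0), None.
  apply/forallP; elim/ord2_ind.
    by rewrite [X in X <= _](on_vertices_val o10 ht).
  by rewrite [X in X <= _](on_vertices_val o11 ht).
suff [h [h1 h2 h3]] : exists h : smap (simplex n) X,
    [/\ smap_eq (smap_comp h (horn_incl n 0)) w, smap_eq (smap_comp (nerve_map F) h) G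
      & forall s, on_vertices [:: 0; 1; n] s -> cocartesian_triangle (nerve_map F) (h 2 s)].
  (* Simplices of the edge 01 omit the vertex [n], so they lie in the horn, where the map is already
     constant on that edge; hence the filler factors through the quotient. *)
  have hpt m (x : simplex n m) : edge01_pred x -> forall y,
      h m x = smap_comp u (collapse_pt (@horn_edge01_closed n 0)) m y.
    move=> hx y; have q : horn_pred 0 x.
      apply: (horn_intro (a := ord_max)); first by rewrite /= -lt0n ltnW.
      move=> k; rewrite -val_eqE neq_ltn /= (leq_ltn_trans (forallP hx k)) //.
    have -> : h m x = w m (exist _ x q) by rewrite -(h1 m (exist _ x q)).
    exact: wpt.
  have [h' [q1 q2 _]] := (collapse_pushout (@edge01_closed n)).2 _ _ _ hpt.
  have h4 s : image_of (quot01 n) (fun t : simplex n 2 => on_vertices [:: 0; 1; n] t) s ->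
      cocartesian_triangle (nerve_map F) (h' 2 s).
    case=> x hx ->; have -> : h' 2 (quot01 n 2 x) = h 2 x by exact: q1.
    exact: h3.
  have [k kE] := @listed_map (simplex_c01 n) mb_flat mb_flat _ nerve_mb h'
     (fun _ x => match x with end) (fun _ x => match x with end) h4.
  have o m : mono m 0 by exists (fun _ => ord0).
  have hN m : h' m None = u m None by exact: (q2 m (o m)).
  exists k; split=> m [x|]; rewrite /= kE.
  - have -> : Some x = horn_quot01 n 0 m (val x) by rewrite /= valK.
    rewrite (fE m _) horn_incl_quot.
    have -> : h' m (quot01 n m (horn_incl n 0 m (val x))) = h m (horn_incl n 0 m (val x))
      by exact: q1.
    exact: h1.
  - by rewrite (fE m _) /= hN.
  - have -> : Some x = quot01 n m (val x) by rewrite /= valK.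
    have -> : h' m (quot01 n m (val x)) = h m (val x) by exact: q1.
    exact: h2.
  - by rewrite hN; have := e m None; rewrite /= (fE m _).
move: n2; rewrite leq_eqVlt => /orP[/eqP e2|n3].
  subst n; have [|h [h1 h2 h3]] := left_horn_lift2 hF lp.
    by move=> ji; apply: hid; exact: on_vertices_edg.
  by exists h; split=> // s /on_vertices_id ->; exact: cocart_lean.
have [|h [h1 h2]] := left_horn_lift n3 lp hid.
  by move=> t ht; apply: lean_cocart; apply: (mm_lean u); apply: Or31; exists t.
exists h; split=> // s hs.
have q : horn_pred 0 s by apply: (horn_image (k := o20) n3); exact: on_vertices_val o20 hs.
have -> : h 2 s = w 2 (exist _ s q) by rewrite -(h1 2 (exist _ s q)).
by apply: (mm_lean u); apply: Or31; exists (exist _ s q).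
Qed.

End Main.

Notation T012 := (tri3 o30 o31 o32).
Notation T013 := (tri3 o30 o31 o33).
Notation T023 := (tri3 o30 o32 o33).
Notation T123 := (tri3 o31 o32 o33).

Lemma tri_eqP n (x : mono 2 n) (i j k : 'I_n.+1) (ij : i <= j) (jk : j <= k) :
  x o20 = i -> x o21 = j -> x o22 = k -> x = tri ij jk.
Proof. by move=> *; apply: mono_ext; elim/ord3_ind. Qed.

Lemma mono_2_3_cases (x : mono 2 3) :
  (x o20 = x o21 \/ x o21 = x o22) \/ [\/ x = T012, x = T013, x = T023 | x = T123].
Proof.
have h1 : x o20 <= x o21 by exact: moP.
have h2 : x o21 <= x o22 by exact: moP.
case e0 : (x o20) h1 => [[|[|[|[|i]]]] hi] //; case e1 : (x o21) h2 => [[|[|[|[|j]]]] hj] //;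
case e2 : (x o22) => [[|[|[|[|k]]]] hk] //= _ _;
  try (by left; left; apply: val_inj); try (by left; right; apply: val_inj); right.
- by apply: Or41; apply: tri_eqP; rewrite ?e0 ?e1 ?e2; apply: val_inj.
- by apply: Or42; apply: tri_eqP; rewrite ?e0 ?e1 ?e2; apply: val_inj.
- by apply: Or43; apply: tri_eqP; rewrite ?e0 ?e1 ?e2; apply: val_inj.
- by apply: Or44; apply: tri_eqP; rewrite ?e0 ?e1 ?e2; apply: val_inj.
Qed.

Lemma mono_1_2_cases (x : mono 1 2) :
  x o10 = x o11 \/ [\/ x = oedge 0, x = oedge 1 | x = oedge 2].
Proof.
have h1 : x o10 <= x o11 by exact: moP.
case e0 : (x o10) h1 => [[|[|[|i]]] hi] //; case e1 : (x o11) => [[|[|[|j]]] hj] //= _;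
  try (by left; apply: val_inj); right.
- by apply: Or33; apply: mono_ext; elim/ord2_ind; rewrite ?e0 ?e1; apply: val_inj.
- by apply: Or32; apply: mono_ext; elim/ord2_ind; rewrite ?e0 ?e1; apply: val_inj.
- by apply: Or31; apply: mono_ext; elim/ord2_ind; rewrite ?e0 ?e1; apply: val_inj.
Qed.

Lemma faces_but_tri (i : nat) (a b c : 'I_4) (ab : a <= b) (bc : b <= c) (k : 'I_3) :
  a < b -> b < c -> val (tri ab bc k) = i -> faces_but i (tri ab bc).
Proof.
move=> lab lbc hk; split; last by exists k.
have lac := ltn_trans lab lbc.
have n1 : a != b by rewrite neq_ltn lab.
have n2 : b != c by rewrite neq_ltn lbc.
have n3 : a != c by rewrite neq_ltn lac.
by elim/ord3_ind; elim/ord3_ind => //= /eqP;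
  rewrite ?(negbTE n1) ?(negbTE n2) ?(negbTE n3) // eq_sym
    ?(negbTE n1) ?(negbTE n2) ?(negbTE n3).
Qed.

Lemma on_vertices_tri_inv (a b c : nat) n (x : mono 2 n) (i j k : 'I_n.+1)
    (ij : i <= j) (jk : j <= k) : on_vertices [:: a; b; c] x ->
  a = i -> b = j -> c = k -> x = tri ij jk.
Proof.
move=> h ea eb ec; subst a b c; apply: tri_eqP; apply: val_inj.
- exact: on_vertices_val o20 h.
- exact: on_vertices_val o21 h.
- exact: on_vertices_val o22 h.
Qed.

Section SimplexMap.

Context {B : two_cat} {n : nat} (u : smap (simplex n) (nerve B)).

Let D : nerve B n := u n (mono_id n).

Lemma simplex_dt (i j k : 'I_n.+1) (ij : i <= j) (jk : j <= k) (ik : i <= k) :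
  tri_eq (dt012 (u 2 (tri ij jk))) (dt D ij jk ik).
Proof. rewrite smap_simplex; exact: (dt_eq _ _ _ _ _ _ (erefl D)). Qed.

Lemma simplex_de (i j : 'I_n.+1) (ij : i <= j) :
  hom_eq (de01 (u 1 (edg ij))) (de D ij).
Proof. rewrite smap_simplex; exact: (de_eq _ _ (erefl D)). Qed.

Lemma simplex_thin_deg (x : mono 2 n) :
  x o20 = x o21 \/ x o21 = x o22 -> nerve_thin (u 2 x).
Proof.
rewrite smap_simplex => -[e|e]; first exact: (@dt_iso_l B n D _ _ _ _ _ _ e).
exact: (@dt_iso_r B n D _ _ _ _ _ _ e).
Qed.

Lemma simplex_edge_id (x : mono 1 n) :
  x o10 = x o11 -> is_id (de01 (u 1 x)).
Proof.
rewrite smap_simplex /de01 /= => e; move: (moP _ _); rewrite -e => i.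
rewrite de_id; exact: is_id_refl.
Qed.

End SimplexMap.

(** * Lifting against the remaining generators *)

Section Generators.

Context {B C : two_cat} (F : two_functor B C) (hF : buckley_2fibration F).

Let p := nerve_mb_map hF.

Lemma lean_all_faces (w : smap (simplex 3) (nerve B)) :
  cocartesian2 F (dt012 (w 2 T012)) -> cocartesian2 F (dt012 (w 2 T013)) ->
  cocartesian2 F (dt012 (w 2 T023)) -> cocartesian2 F (dt012 (w 2 T123)) ->
  forall x, cocartesian_triangle (nerve_map F) (w 2 x).
Proof.
move=> h1 h2 h3 h4 x; case: (mono_2_3_cases x) => [d|[]->]; try exact: cocart_lean.
by apply: thin_lean; exact: simplex_thin_deg.
Qed.

Lemma simplex3_assoc (w : smap (simplex 3) (nerve B)) :
  let D : nerve B 3 := w 3 (mono_id 3) in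
  arr_eq (assocL (dt3 D o30 o31 o32)
                 (dt3 D o30 o32 o33))
         (assocR (dt3 D o30 o31 o33)
                 (dt3 D o31 o32 o33)).
Proof. exact: dtA. Qed.

Lemma rlp_A2
    (f : mbmap
      (@listed (simplex 4) mb_flat
        (on_any [:: [:: 0; 2; 4]; [:: 1; 2; 3]; [:: 0; 1; 3]; [:: 1; 3; 4];
                    [:: 0; 1; 2]]) mb_flat)
      (@listed (simplex 4) mb_flat
        (on_any [:: [:: 0; 2; 4]; [:: 1; 2; 3]; [:: 0; 1; 3]; [:: 1; 3; 4];
                    [:: 0; 1; 2]; [:: 0; 3; 4]; [:: 0; 1; 4]]) mb_flat)) :
    smap_eq f (smap_id (simplex 4)) -> mb_rlp f p.
Proof.
move=> fE; apply: rlp_same_underlying fE _ => u g _; split=> // x [s hs sx].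
have [hs'|hs'] := boolP (s \in [:: [:: 0; 2; 4]; [:: 1; 2; 3]; [:: 0; 1; 3]; [:: 1; 3; 4];
                    [:: 0; 1; 2]]).
  by apply: (mm_thin u); left; exists s.
pose D : nerve B 4 := u 4 (mono_id 4).
have th (i j k : 'I_5) (ij : i <= j) (jk : j <= k) (ik : i <= k) :
    [:: val i; val j; val k] \in [:: [:: 0; 2; 4]; [:: 1; 2; 3]; [:: 0; 1; 3]; [:: 1; 3; 4];
                    [:: 0; 1; 2]] -> is_iso (dt D ij jk ik).
  move=> m; apply: (tri_eq_iso (simplex_dt u ij jk ik)); apply: (mm_thin u).
  by left; exists [:: val i; val j; val k] => //; exact: on_vertices_tri.
have [i034 i014] := @saturation_iso B _ _ _ _ _ _ _ _ _ _ _ _ _ _ _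
  (dt3 D o40 o41 o42) (dt3 D o40 o41 o43)
  (dt3 D o40 o41 o44) (dt3 D o40 o42 o43)
  (dt3 D o40 o42 o44) (dt3 D o40 o43 o44)
  (dt3 D o41 o42 o43) (dt3 D o41 o42 o44)
  (dt3 D o41 o43 o44) (dt3 D o42 o43 o44)
  (dtA D _ _ _ _ _ _) (dtA D _ _ _ _ _ _) (dtA D _ _ _ _ _ _) (dtA D _ _ _ _ _ _)
  (th o40 o41 o42 isT isT isT isT) (th o41 o42 o43 isT isT isT isT)
  (th o40 o41 o43 isT isT isT isT) (th o41 o43 o44 isT isT isT isT)
  (th o40 o42 o44 isT isT isT isT).
move: hs' hs; rewrite !inE !negb_or => /and5P[/negbTE-> /negbTE-> /negbTE-> /negbTE-> /negbTE->].
rewrite !orFb; case/orP => /eqP es; rewrite es in sx.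
- rewrite (on_vertices_tri_inv (i := o40) (j := o43) (k := o44) isT isT sx) //.
  exact: (tri_eq_iso (tri_eq_sym (simplex_dt u _ _ _)) i034).
- rewrite (on_vertices_tri_inv (i := o40) (j := o41) (k := o44) isT isT sx) //.
  exact: (tri_eq_iso (tri_eq_sym (simplex_dt u _ _ _)) i014).
Qed.

Lemma rlp_A5
    (f : mbmap (@listed (simplex 0) mb_sharp mb_sharp mb_sharp)
               (@listed (simplex 1) mb_sharp mb_sharp mb_sharp)) :
    (forall n (x : simplex 0 n) k, val ((f n x : mono n 1) k) = 1) -> mb_rlp f p.
Proof.
move=> f1 u g e.
pose v : nerve B 0 := u 0 (mono_id 0); pose b := dv v ord0.
pose G : nerve C 1 := g 1 (mono_id 1).
have fm m (x : simplex 0 m) : f m x = mono_comp (pt o11) (x : mono m 0).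
  by apply: mono_ext => k; apply: val_inj; rewrite f1.
have gv : dv G o11 = F b.
  have := e 0 (mono_id 0); rewrite /= fm => h.
  have -> : F b = dv (nerve_fun F v) ord0 by [].
  rewrite [nerve_fun F v]h -[RHS]/(dv (g 0 (mono_comp (pt o11) (mono_id 0)) : nerve C 0) ord0).
  by rewrite (smap_simplex g).
have [_ _ ca] := hF.
have [k ek] := hom_transport (de01 G) erefl gv.
(* [k] is the target edge recast to end at [F b], which lets the third clause of the 2-fibration
   supply a Cartesian lift. *)
have [c' [g' [eg cg]]] := ca b _ k.
have hg : hom_eq (F1 F g') k.
  have h (s : {c0 : C & c_ob (hom c0 (F b))}) :
      s = existT (fun c0 : C => c_ob (hom c0 (F b))) _ k ->
      hom_eq (projT2 s) k.
    by move=> ->; exact: hom_eq_refl.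
  exact: (h _ eg).
have [D eD] := nerve1_of g'.
have acD : acart F (de01 D).
  by apply: (hom_eq_acart eD); exact: acart_cartesian1.
have [|||q qE] := @listed_map (simplex 1) mb_sharp mb_sharp mb_sharp (nerve_mb hF) (yoneda D).
- move=> x _; apply: acart_cartesian_edge => //=.
  have [e01|/eqP ne] := eqVneq ((x : mono 1 1) o10) ((x : mono 1 1) o11).
    apply: (is_id_acart hF); apply: (simplex_edge_id (yoneda D) e01).
  have -> : x = mono_id 1.
    have := moP (x : mono 1 1) (isT : o10 <= o11).
    case e0 : ((x : mono 1 1) o10) ne => [[|[|i]] hi] //;
      case e1 : ((x : mono 1 1) o11) => [[|[|j]] hj] //= ne _;
      try (by case: ne; apply: val_inj).
    by apply: mono_ext; elim/ord2_ind; rewrite ?e0 ?e1; apply: val_inj.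
  by apply: hom_eq_acart acD; exact: (de_eq _ _ (erefl D) erefl erefl).
(* Triangles of the 1-simplex factor through dimension 1, hence are degenerate. *)
- by move=> x _; apply: nerve_thin_deg; exists 1, x, D.
- by move=> x _; apply: thin_lean => //; apply: nerve_thin_deg; exists 1, x, D.
exists q; split=> m x; rewrite /= qE.
- rewrite fm; have -> : u m x = act (x : mono m 0) v by exact: smap_simplex.
  by have <- : duskin_act (pt o11) D = v
    by apply: duskin0_ext; exact: esym (hom_eq_tgt eD).
- rewrite -[RHS]/(g m x) (smap_simplex g x).
  have -> : g 1 (mono_id 1) = nerve_fun F D.
    apply: duskin1_ext; apply: hom_eq_trans (hom_eq_sym ek) _.
    apply: hom_eq_trans (hom_eq_sym hg) _; exact: hom_eq_F.
  exact: (sm_act (nerve_map F) (x : mono m 1) (D : Nsc B 1)).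
Qed.

(** The edge 02 is isomorphic, through the thin triangle, to the composite of the two marked
    edges. *)
Lemma rlp_S1
    (f : mbmap
      (@listed (simplex 2) (on_any [:: [:: 0; 1]; [:: 1; 2]]) mb_sharp mb_sharp)
      (@listed (simplex 2) mb_sharp mb_sharp mb_sharp)) :
    smap_eq f (smap_id (simplex 2)) -> mb_rlp f p.
Proof.
move=> fE; apply: rlp_same_underlying fE _ => u g _; split=> [x _|x _|x _]; last first.
- by apply: (mm_lean u); apply: Or31.
- by apply: (mm_thin u); left.
apply: acart_cartesian_edge => //.
pose D : nerve B 2 := u 2 (mono_id 2).
have h01 : acart F (de2 D o20 o21).
  apply: (hom_eq_acart (simplex_de u _)); apply: cartesian_edge_acart.
  by apply: (mm_marked u); left; exists [:: 0; 1] => //; exact: on_vertices_edg.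
have h12 : acart F (de2 D o21 o22).
  apply: (hom_eq_acart (simplex_de u _)); apply: cartesian_edge_acart.
  by apply: (mm_marked u); left; exists [:: 1; 2] => //; exact: on_vertices_edg.
have h02 : acart F (de2 D o20 o22).
  apply: (acart_iso (t := dt012 D)); last exact: acart_comp.
  by apply: (mm_thin u); left.
case: (mono_1_2_cases x) => [d|[]->].
- by apply: (is_id_acart hF); exact: simplex_edge_id.
- exact: hom_eq_acart (hom_eq_sym (simplex_de u _)) h12.
- exact: hom_eq_acart (hom_eq_sym (simplex_de u _)) h02.
- exact: hom_eq_acart (hom_eq_sym (simplex_de u _)) h01.
Qed.

(** A coCartesian 2-morphism over an invertible one is invertible. *)
Lemma rlp_S2
    (f : mbmap (@listed (simplex 2) mb_flat mb_flat mb_sharp)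
               (@listed (simplex 2) mb_flat mb_sharp mb_sharp)) :
    smap_eq f (smap_id (simplex 2)) -> mb_rlp f p.
Proof.
move=> fE; apply: rlp_same_underlying fE _ => u g e; split=> // x _; last first.
  by apply: (mm_lean u); apply: Or31.
have cx : cocartesian2 F (dt012 (u 2 x)).
  by apply: lean_cocart; apply: (mm_lean u); apply: Or31.
apply: (cocartesian_over_iso cx).
have : thin (g 2 x) by apply: (mm_thin g); left.
rewrite -(e 2 x) => h.
exact: is_iso_arr_eq (FcE F _) h.
Qed.

Lemma rlp_S3 i
    (f : mbmap
      (@listed (simplex 3) mb_flat (on_vertices [:: i.-1; i; i.+1])
        (faces_but i))
      (@listed (simplex 3) mb_flat (on_vertices [:: i.-1; i; i.+1]) mb_sharp)) :
    0 < i < 3 -> smap_eq f (smap_id (simplex 3)) -> mb_rlp f p.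
Proof.
move=> hi fE; apply: rlp_same_underlying fE _ => u g e; split=> // x.
  by move=> hx; apply: (mm_thin u); left.
move=> _; have ln (a b c : 'I_4) (ab : a <= b) (bc : b <= c) (k : 'I_3) :
    a < b -> b < c -> val (tri ab bc k) = i -> cocartesian2 F (dt012 (u 2 (tri ab bc))).
  move=> lab lbc hk; apply: lean_cocart; apply: (mm_lean u); apply: Or31.
  exact: faces_but_tri hk.
have th (a b c : 'I_4) (ab : a <= b) (bc : b <= c) : val a = i.-1 -> val b = i -> val c = i.+1 ->
    is_iso (dt012 (u 2 (tri ab bc))).
  by move=> ea eb ec; apply: (mm_thin u); left; exact: on_vertices_tri.
pose D : nerve B 3 := u 3 (mono_id 3).
have S (a b c : 'I_4) (ab : a <= b) (bc : b <= c) (ac : a <= c) := simplex_dt u ab bc ac.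
have as0123 := simplex3_assoc u.
have i12 : i = 1 \/ i = 2 by move: hi; case: (i) => [|[|[|]]] // _; [left | right].
case: i12 => ei; subst i; move: x.
- have c1 := ln o30 o31 o32 isT isT o21 isT isT erefl.
  have c2 := ln o30 o31 o33 isT isT o21 isT isT erefl.
  have c4 := ln o31 o32 o33 isT isT o20 isT isT erefl.
  apply: lean_all_faces => //.
  apply: (tri_eq_cocart (tri_eq_sym (S o30 o32 o33 isT isT isT))).
  apply: (lean_023 hF as0123).
  + apply: (tri_eq_iso (S o30 o31 o32 isT isT isT)); exact: th.
  + exact: (tri_eq_cocart (S o30 o31 o33 isT isT isT) c2).
  + exact: (tri_eq_cocart (S o31 o32 o33 isT isT isT) c4).
- have c1 := ln o30 o31 o32 isT isT o22 isT isT erefl.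
  have c3 := ln o30 o32 o33 isT isT o21 isT isT erefl.
  have c4 := ln o31 o32 o33 isT isT o21 isT isT erefl.
  apply: lean_all_faces => //.
  apply: (tri_eq_cocart (tri_eq_sym (S o30 o31 o33 isT isT isT))).
  apply: (lean_013 hF as0123).
  + apply: (tri_eq_iso (S o31 o32 o33 isT isT isT)); exact: th.
  + exact: (tri_eq_cocart (S o30 o31 o32 isT isT isT) c1).
  + exact: (tri_eq_cocart (S o30 o32 o33 isT isT isT) c3).
Qed.

Lemma rlp_S4
    (f : mbmap
      (@listed (simplex_c01 3) mb_flat mb_flat
        (image_of (quot01 3) (fun t : simplex 3 2 => faces_but 0 t)))
      (@listed (simplex_c01 3) mb_flat mb_flat mb_sharp)) :
    smap_eq f (smap_id (simplex_c01 3)) -> mb_rlp f p.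
Proof.
move=> fE; apply: rlp_same_underlying fE _ => u g e; split=> // x _.
pose w : smap (simplex 3) (nerve B) := smap_comp u (quot01 3).
have S (a b c : 'I_4) (ab : a <= b) (bc : b <= c) (ac : a <= c) := simplex_dt w ab bc ac.
have as0123 := simplex3_assoc w.
have ln (a b c : 'I_4) (ab : a <= b) (bc : b <= c) :
    a < b -> b < c -> val a = 0 -> cocartesian2 F (dt012 (w 2 (tri ab bc))).
  move=> lab lbc ha; apply: lean_cocart; apply: (mm_lean u); apply: Or31.
  by exists (tri ab bc) => //; apply: (faces_but_tri (k := o20)).
have c1 := ln o30 o31 o32 isT isT isT isT erefl.
have c2 := ln o30 o31 o33 isT isT isT isT erefl.
have c3 := ln o30 o32 o33 isT isT isT isT erefl.
(* Simplices of the collapsed edge come from a single vertex, which makes the edge 01 an identity,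
   as [lean_123] requires. *)
have uN m : degenerate (u m.+1 None).
  by apply: (degenerate_smap u); exists 0, (@Mono m.+1 0 (fun _ => ord0) (fun _ _ _ => isT)), None.
have hid : is_id (@de _ _ (w 3 (mono_id 3)) o30 o31 isT).
  apply: hom_eq_is_id (hom_eq_sym (simplex_de w (isT : o30 <= o31))) _.
  apply: degenerate_is_id; rewrite /w /= insubN; first exact: uN.
  by rewrite negbK; apply/forallP; elim/ord2_ind.
have lw : forall y, cocartesian_triangle (nerve_map F) (w 2 y).
  apply: lean_all_faces => //.
  apply: (tri_eq_cocart (tri_eq_sym (S o31 o32 o33 isT isT isT))).
  apply: (lean_123 hF as0123 hid).
  + exact: (tri_eq_cocart (S o30 o31 o32 isT isT isT) c1).
  + exact: (tri_eq_cocart (S o30 o31 o33 isT isT isT) c2).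
  + exact: (tri_eq_cocart (S o30 o32 o33 isT isT isT) c3).
case: x => [y|]; last by apply: thin_lean => //; apply: nerve_thin_deg; exact: uN.
have -> : Some y = quot01 3 2 (val y) by rewrite /= valK.
exact: lw.
Qed.

Lemma rlp_S5
    (f : mbmap
      (@listed (simplex 3) (on_vertices [:: 2; 3]) mb_flat (faces_but 3))
      (@listed (simplex 3) (on_vertices [:: 2; 3]) mb_flat mb_sharp)) :
    smap_eq f (smap_id (simplex 3)) -> mb_rlp f p.
Proof.
move=> fE; apply: rlp_same_underlying fE _ => u g e; split=> // x.
  by move=> hx; apply: (mm_marked u); left.
move=> _; have S (a b c : 'I_4) (ab : a <= b) (bc : b <= c) (ac : a <= c) := simplex_dt u ab bc ac.
have as0123 := simplex3_assoc u.
have ln (a b c : 'I_4) (ab : a <= b) (bc : b <= c) :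
    a < b -> b < c -> val c = 3 -> cocartesian2 F (dt012 (u 2 (tri ab bc))).
  move=> lab lbc ha; apply: lean_cocart; apply: (mm_lean u); apply: Or31.
  by apply: (faces_but_tri (k := o22)).
have c2 := ln o30 o31 o33 isT isT isT isT erefl.
have c3 := ln o30 o32 o33 isT isT isT isT erefl.
have c4 := ln o31 o32 o33 isT isT isT isT erefl.
apply: lean_all_faces => //.
apply: (tri_eq_cocart (tri_eq_sym (S o30 o31 o32 isT isT isT))).
apply: (lean_012 hF as0123).
- apply: (hom_eq_acart (simplex_de u (isT : o32 <= o33))); apply: cartesian_edge_acart.
  by apply: (mm_marked u); left; exact: on_vertices_edg.
- exact: (tri_eq_cocart (S o30 o31 o33 isT isT isT) c2).
- exact: (tri_eq_cocart (S o30 o32 o33 isT isT isT) c3).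
- exact: (tri_eq_cocart (S o31 o32 o33 isT isT isT) c4).
Qed.

(** [t] makes [l] a left inverse of [h], and [s] makes [r] a right inverse, up to invertible
    2-morphisms. The copies [h'] and [h''] come from triangles that share the edge only
    propositionally. *)
Lemma acart_of_triangles (x y z w x' y' x'' y'' : B) (h : hom x y) (l : hom y'' z)
    (h' : hom x'' y'') (i : hom x'' z) (t : c_hom i (comp1 l h')) (r : hom w x')
    (h'' : hom x' y') (j : hom w y') (s : c_hom j (comp1 h'' r)) :
  hom_eq h h' -> hom_eq h h'' -> is_id i -> is_id j -> is_iso t -> is_iso s -> acart F h.
Proof.
move=> e1 e2; have q1 := hom_eq_src e2; have q2 := hom_eq_tgt e2; have q3 := hom_eq_tgt e1.
have q4 := hom_eq_src e1; subst x' y' y'' x''.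
have k1 := hom_eq_eq e1; have k2 := hom_eq_eq e2; subst h' h''.
move=> hi; case: z i / hi l t => l t hj.
case: y j / hj h l e1 e2 t s => h l _ _ t s; exact: acart_equiv.
Qed.

Lemma rlp_E (K : sset)
    (f : mbmap (@listed K mb_flat mb_sharp mb_sharp)
               (@listed K mb_sharp mb_sharp mb_sharp)) :
    kan K -> smap_eq f (smap_id K) -> mb_rlp f p.
Proof.
move=> kK fE; apply: rlp_same_underlying fE _ => u g _; split=> [x _|x _|x _]; last first.
- by apply: (mm_lean u); apply: Or31.
- by apply: (mm_thin u); left.
apply: acart_cartesian_edge => //.
have fill (i j1 j2 : 'I_3) (a1 a2 : K 1) : j1 != i -> j2 != i -> j1 != j2 ->
    act (pt (oret j1 i)) a1 = act (pt (oret j2 i)) a2 ->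
    exists s : K 2, [/\ act (oedge j1) s = a1, act (oedge j2) s = a2 & is_iso (dt012 (u 2 s))].
  move=> h1 h2 h12 cm; have [q [q1 q2]] := horn2_map h1 h2 h12 cm.
  have [|h hh] := kK 2 i isT _ q; first by rewrite -ltnS.
  exists (h 2 (mono_id 2)); split.
  - by rewrite -smap_simplex -(q1 h1) -(hh 1 (horn_edge h1)).
  - by rewrite -smap_simplex -(q2 h2) -(hh 1 (horn_edge h2)).
  - by apply: (mm_thin u); left.
have idd (v : K 0) : is_id (de01 (u 1 (act (codeg 0) v))).
  by apply: degenerate_is_id; apply: (degenerate_smap u); exists 0, (codeg 0), v.
(* Two horns are filled in [K] with a degenerate edge 02: with [x] as edge 01 the filler gives a
   left inverse, with [x] as edge 12 a right inverse. Every triangle of [K] is thin, so the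
   comparison 2-morphisms are invertible. *)
have [||||s [s1 s2 s3]] := fill o20 o22 o21 x (act (codeg 0) (act (pt o10) x)) => //.
  by rewrite -!act_comp; congr (act _ x); apply: mono_ext => k; apply: val_inj.
have [||||r [r1 r2 r3]] := fill o22 o20 o21 x (act (codeg 0) (act (pt o11) x)) => //.
  by rewrite -!act_comp; congr (act _ x); apply: mono_ext => k; apply: val_inj.
have [s12 s02 s01] := oedge_de (u 2 s : nerve B 2).
have [r12 r02 r01] := oedge_de (u 2 r : nerve B 2).
rewrite -(sm_act u) s1 in s01; rewrite -(sm_act u) s2 in s02.
rewrite -(sm_act u) r1 in r12; rewrite -(sm_act u) r2 in r02.
apply: (acart_of_triangles s01 r12 _ _ s3 r3).
- exact: hom_eq_is_id (hom_eq_sym s02) (idd _).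
- exact: hom_eq_is_id (hom_eq_sym r02) (idd _).
Qed.

Lemma rlp_generator A A' (f : mbmap A A') : mb_generator f -> mb_rlp f p.
Proof.
case=> {A A' f}.
- exact: rlp_A1.
- exact: rlp_A2.
- exact: rlp_A3.
- exact: rlp_A4.
- exact: rlp_A5.
- exact: rlp_S1.
- exact: rlp_S2.
- exact: rlp_S3.
- exact: rlp_S4.
- exact: rlp_S5.
- exact: rlp_E.
Qed.

End Generators.

Theorem mainTheorem4 (B C : two_cat) (F : two_functor B C)
    (hF : buckley_2fibration F) :
  exists (hmb : @mb_axioms (Nsc B) (cartesian_edge (nerve_map F))
                  (@thin (Nsc B)) (cocartesian_triangle (nerve_map F)))
         (p : mbmap (MBSSet hmb) (mb_of_scaled (Nsc C))),
    smap_eq p (nerve_map F) /\ two_cartesian_fibration p.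
Proof.
exists (nerve_mb_axioms hF), (nerve_mb_map hF); split; first by [].
move=> A A' i; apply: rlp_saturation; exact: rlp_generator.
Qed.
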